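(* Let $G$ be a Lie group of dimension $n$, endowed with a left-invariant Finsler metric and the Hausdorff $n$-measure. Let $u:G\to\overline{\mathbb R}$ be a function which has an upper gradient $g\in L^p(G)$ for some $p>n$. Then for all $x,y\in G$ with $d(x,y)\leq 1$ we have $$|u(x) - u(y)|\leq C\, d(x,y)^{1-n/p}\,\|g\|_{p, B(x, Cd(x,y))},$$ where $C$ only depends on $p$, $G$, and the left-invariant Finsler metric.
   Context: $d$ is the distance on $G$ induced by the Finsler metric, $B(x,r)$ the closed ball, and $\|g\|_{p,\Omega}$ the $L^p$-norm of $g$ over $\Omega$ with respect to the Hausdorff $n$-measure. A Borel function $g:G\to[0,\infty]$ is an upper gradient of $u:G\to\overline{\mathbb R}$ if $|u(y)-u(x)|\le\int_\gamma g\,ds$ for all $x,y\in G$ and every rectifiable path $\gamma$ in $G$ with endpoints $x$ and $y$; here $|u(y)-u(x)|$ is interpreted as $\infty$ if $|u(x)|=\infty$ or $|u(y)|=\infty$. *)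

(* Defs.v *)
From HB Require Import structures.
From mathcomp Require Import all_boot all_order all_algebra.
From mathcomp Require Import all_classical all_reals all_analysis.
From mathcomp Require Import measurable_realfun.
Import Order.TTheory GRing.Theory Num.Theory numFieldNormedType.Exports.

Set Implicit Arguments.
Unset Strict Implicit.
Unset Printing Implicit Defensive.

Local Open Scope classical_set_scope.
Local Open Scope ring_scope.

(** * Smooth manifolds and Lie groups *)

(* For U open and V finite-dimensional this is the usual C^k: all iterated
   directional derivatives up to order k exist and are continuous on U. *)
Fixpoint Ck_on (R : realType) (V W : normedModType R) (k : nat)
    (U : set V) (f : V -> W) : Prop :=
  (forall x, U x -> {for x, continuous f}) /\
  if k is k'.+1 then
    forall v, (forall x, U x -> derivable f x v) /\ Ck_on k' U ('D_v f)
  else True.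

Definition smooth_on (R : realType) (V W : normedModType R)
    (U : set V) (f : V -> W) : Prop :=
  forall k, Ck_on k U f.

(* A homeomorphism from an open set of M onto an open set of R^n; both
   directions are total functions, with arbitrary values off these sets. *)
Record chart (R : realType) (n : nat) (M : topologicalType) := Chart {
  chart_dom : set M;
  chart_map :> M -> 'rV[R]_n;
  chart_inv : 'rV[R]_n -> M;
  open_chart_dom : open chart_dom;
  open_chart_im : open (chart_map @` chart_dom);
  chart_mapK : {in chart_dom, cancel chart_map chart_inv};
  chart_map_continuous :
    forall x, chart_dom x -> {for x, continuous chart_map};
  chart_inv_continuous :
    forall a, (chart_map @` chart_dom) a -> {for a, continuous chart_inv}
}.

(* The atlas is the family of the charts [chart_at x]: it contains a preferred
   chart around each point. *)
HB.mixin Record isSmoothManifold (R : realType) (n : nat) M of Topological M := {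
  manifold_hausdorff : hausdorff_space M;
  manifold_second_countable : @second_countable M;
  chart_at : M -> chart R n M;
  mem_chart_at : forall x, chart_dom (chart_at x) x;
  chart_at_smooth : forall x y,
    smooth_on (chart_at x @` (chart_dom (chart_at x) `&` chart_dom (chart_at y)))
      (chart_at y \o chart_inv (chart_at x))
}.

#[short(type="smoothManifoldType")]
HB.structure Definition SmoothManifold (R : realType) (n : nat) :=
  { M of Topological M & isSmoothManifold R n M }.

HB.mixin Record isLieGroup (R : realType) (n : nat) G
    of Group G & SmoothManifold R n G := {
  mulg_continuous : continuous (fun xy : G * G => (xy.1 * xy.2)%g);
  invg_continuous : continuous (fun x : G => (x^-1)%g);
  mulg_smooth : forall x y z : G,
    let cx := chart_at x : chart R n G in
    let cy := chart_at y : chart R n G in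
    let cz := chart_at z : chart R n G in
    let mul (ab : 'rV[R]_n * 'rV[R]_n) :=
      (chart_inv cx ab.1 * chart_inv cy ab.2)%g in
    smooth_on
      [set ab | [/\ (cx @` chart_dom cx) ab.1, (cy @` chart_dom cy) ab.2 &
                    chart_dom cz (mul ab)]]
      (cz \o mul);
  invg_smooth : forall x y : G,
    let cx := chart_at x : chart R n G in
    let cy := chart_at y : chart R n G in
    let inv (a : 'rV[R]_n) := ((chart_inv cx a)^-1)%g in
    smooth_on [set a | (cx @` chart_dom cx) a /\ chart_dom cy (inv a)]
      (cy \o inv)
}.

(* The base point plays no role: [measurableType] requires one. *)
#[short(type="lieGroupType")]
HB.structure Definition LieGroup (R : realType) (n : nat) :=
  { G of Group G & Pointed G & SmoothManifold R n G & isLieGroup R n G }.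

(** * Finsler metrics *)

(* The tangent space at x is identified with R^n by means of [chart_at x].
   In these coordinates, [tangent_map f x] is the differential of f at x. *)
Definition tangent_map (R : realType) (n : nat) (M : smoothManifoldType R n)
    (f : M -> M) (x : M) (v : 'rV[R]_n) : 'rV[R]_n :=
  'D_v (chart_at (f x) \o f \o chart_inv (chart_at x)) (chart_at x x).

(* [fnorm x v] is the norm of the tangent vector at x with coordinates v in
   [chart_at x]. Continuity is that of the metric on the tangent bundle, written
   in the trivialization over the domain of each [chart_at x0]; the derivative
   there changes coordinates from [chart_at x0] to [chart_at xv.1]. *)
Record finsler_metric (R : realType) (n : nat) (M : smoothManifoldType R n) :=
  FinslerMetric {
  fnorm :> M -> 'rV[R]_n -> R;
  fnorm_triangle : forall x v w, fnorm x (v + w) <= fnorm x v + fnorm x w;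
  fnormZ : forall x (a : R) v, fnorm x (a *: v) = `|a| * fnorm x v;
  fnorm_eq0 : forall x v, fnorm x v = 0 -> v = 0;
  fnorm_continuous : forall (x0 : M) (xv : M * 'rV[R]_n),
    chart_dom (chart_at x0) xv.1 ->
    {for xv, continuous (fun yw : M * 'rV[R]_n =>
      fnorm yw.1 ('D_(yw.2) (chart_at yw.1 \o chart_inv (chart_at x0))
                    (chart_at x0 yw.1)))}
}.

Definition left_invariant (R : realType) (n : nat) (G : lieGroupType R n)
    (F : finsler_metric G) : Prop :=
  forall (a x : G) (v : 'rV[R]_n),
    F (a * x)%g (tangent_map (fun y : G => (a * y)%g) x v) = F x v.

Section finsler_distance.
Context (R : realType) (n : nat) (M : smoothManifoldType R n)
  (F : finsler_metric M).

Definition curve_C1_on (O : set R) (c : R -> M) : Prop :=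
  (forall t, O t -> {for t, continuous c}) /\
  forall x : M,
    Ck_on (V := R^o) 1 (O `&` c @^-1` chart_dom (chart_at x)) (chart_at x \o c).

(* C^1 on [a, b], endpoints included: c extends to a C^1 curve on a
   neighbourhood of [a, b]. *)
Definition curve_C1_segment (a b : R) (c : R -> M) : Prop :=
  exists e : R, 0 < e /\ exists c' : R -> M,
    curve_C1_on `]a - e, b + e[ c' /\ {in `[a, b], c =1 c'}.

Definition piecewise_C1 (c : R -> M) : Prop :=
  exists s : seq R, itv_partition 0 1 s /\
    forall i, (i < size s)%N ->
      curve_C1_segment (nth 1 (0 :: s) i) (nth 1 (0 :: s) i.+1) c.

Definition speed (c : R -> M) (t : R) : R :=
  F (c t) (derive1 (chart_at (c t) \o c) t).

Definition finsler_length (c : R -> M) : \bar R :=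
  (\int[lebesgue_measure]_(t in `[0%R, 1%R]) (speed c t)%:E)%E.

(* The value is +oo between distinct connected components. *)
Definition finsler_dist (x y : M) : \bar R :=
  ereal_inf [set finsler_length c |
    c in [set c | [/\ piecewise_C1 c, c 0 = x & c 1 = y]]].

Definition finsler_ball (x : M) (r : \bar R) : set M :=
  [set y | (finsler_dist x y <= r)%E].

Local Open Scope ereal_scope.

(* The supremum over the empty set is -oo. *)
Definition ediam (A : set M) : \bar R :=
  ereal_sup [set finsler_dist xy.1 xy.2 | xy in A `*` A].

(* Hausdorff n-measure for [finsler_dist], without normalizing constant; the
   case of set0 matters when n = 0, where diam^0 = 1 on nonempty sets. *)
Definition hausdorff_weight (A : set M) : \bar R :=
  if A == set0 then 0 else ediam A ^+ n.

Definition hausdorff_premeasure (delta : R) (A : set M) : \bar R :=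
  ereal_inf [set \sum_(k <oo) hausdorff_weight (U k) |
    U in [set U : (set M)^nat |
      A `<=` \bigcup_k U k /\ forall k, ediam (U k) <= delta%:E]].

Definition hausdorff_measure (A : set M) : \bar R :=
  ereal_sup [set hausdorff_premeasure delta A | delta in [set e : R | (0 < e)%R]].

(** * Line integrals and upper gradients *)

Definition path_length (a b : R) (c : R -> M) : \bar R :=
  ereal_sup [set \sum_(0 <= i < size s)
      finsler_dist (c (nth b (a :: s) i)) (c (nth b (a :: s) i.+1)) |
    s in itv_partition a b].

Definition rectifiable (a b : R) (c : R -> M) : Prop :=
  [/\ (a <= b)%R, {within `[a, b], continuous c} & path_length a b c < +oo].

(* c is constant on the level sets of its length function, so the choice of t
   does not matter. *)
Definition arclength_param (a b : R) (c : R -> M) (tau : R) : M :=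
  c (xget a [set t | t \in `[a, b] /\ path_length a t c = tau%:E]).

Definition line_integral (a b : R) (c : R -> M) (g : M -> \bar R) : \bar R :=
  \int[lebesgue_measure]_(tau in
      [set tau : R | (0 <= tau)%R /\ tau%:E <= path_length a b c])
    g (arclength_param a b c tau).

End finsler_distance.

Section upper_gradient.
Context (R : realType) (n : nat) (G : lieGroupType R n) (F : finsler_metric G).
Local Open Scope ereal_scope.

Definition borelType : measurableType (@open G).-sigma :=
  g_sigma_algebraType (@open G).

(* The difference of two infinite values is -oo in \bar R, whatever their signs,
   and r - +oo = -oo, r - -oo = +oo; hence |u y - u x| = +oo as soon as u x or
   u y is infinite. *)
Definition upper_gradient (u g : G -> \bar R) : Prop :=
  [/\ measurable_fun setT (g : borelType -> \bar R),
      forall x, 0 <= g x &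
      forall (x y : G) (a b : R) (c : R -> G),
        rectifiable F a b c -> c a = x -> c b = y ->
        `|u y - u x| <= line_integral F a b c g].

Definition Lp_norm (p : R) (D : set G) (g : G -> \bar R) : \bar R :=
  (\int[hausdorff_measure F : set borelType -> \bar R]_(x in D) `|g x| `^ p) `^ p^-1.

Definition in_Lp (p : R) (g : G -> \bar R) : Prop :=
  measurable_fun setT (g : borelType -> \bar R) /\ Lp_norm p setT g < +oo.

End upper_gradient.

(* Main.v *)
Require Import Defs.
From HB Require Import structures.
From mathcomp Require Import all_boot all_order all_algebra.
From mathcomp Require Import all_classical all_reals all_analysis.
From mathcomp Require Import measurable_realfun.
From mathcomp Require Import ring lra.
Import Order.TTheory GRing.Theory Num.Theory numFieldNormedType.Exports.

(** Left translations are isometries, so all estimates can be made in the chart [phi] at 1,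
    which is bi-Lipschitz near [p0 = phi 1]. When r is comparable to d(x, y) and small, join
    x and y to the random point [z = x * phi^-1 (p0 + r xi)] by segments in the chart, xi being
    uniform in [0, 1]^n. Along a segment, |u x - u z| is at most a multiple of
    r int_0^1 g dt; now average over z. A set of diameter delta pulls back at time t into a cube
    of side proportional to delta / (t r), so the law of the point at time t is at most
    (C / (t r))^n times the Hausdorff measure. By Jensen, the average of g at time t is then at most
    C (t r)^(-n/p) times the L^p-norm of g, and t^(-n/p) is integrable on ]0, 1] as p > n. When
    d(x, y) <= 1 is not small, a curve of length less than 2 from x to y is cut into a bounded
    number of short jumps.

    Only the comparison of laws with the Hausdorff measure is used, so there is no need
    to know that the latter is additive on Borel sets. *)

Set Implicit Arguments.
Unset Strict Implicit.
Unset Printing Implicit Defensive.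

Local Open Scope classical_set_scope.
Local Open Scope ring_scope.

(** * C^1 maps *)

Section C1.
Context (R : realType).

(** Joining x and y to the same random point avoids averaging u itself: |u x - u y| is a constant,
    bounded for every outcome by the sum of two line integrals, hence by the sum of their
    expectations. The length of the segments contributes a factor r, which turns r^(-n/p) into
    r^(1-n/p). Of the law of the random point, only the bound P(cube of side l) <= l^n matters.

    Three obstacles shape the development. Line integrals are taken in arc length, while the
    averages are taken at a fixed time t of the chart segment; the length function is merely known
    to be Lipschitz, so the substitution is an inequality of measures, at the cost of a factor 2.
    The speed of a piecewise C^1 curve enters without a proof of measurability, so additivity of
    length and its behaviour under reparametrization are derived from simple functions. Finally, the
    lower Lipschitz bound of the chart concerns all curves between two points, including those that
    wander out of the chart; a first exit argument shows that these are too long to matter. *)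

Lemma Ck_on_subset (V W : normedModType R) k (U U' : set V) (f : V -> W) :
  U' `<=` U -> Ck_on k U f -> Ck_on k U' f.
Proof.
move=> UU'; elim: k f => [|k IH] f [fc fd]; split => //; first by move=> x /UU' /fc.
  by move=> x /UU' /fc.
move=> v; have [d1 d2] := fd v; split; first by move=> x /UU' /d1.
exact: IH.
Qed.

Lemma C1_eq (V W : normedModType R) (U : set V) (f g : V -> W) : open U ->
  (forall x, U x -> f x = g x) -> Ck_on 1 U f -> Ck_on 1 U g.
Proof.
move=> oU fg [fc fd].
have E x : U x -> \forall z \near x, f z = g z.
  by move=> Ux; near=> z; apply: fg; near: z; exact: open_nbhs_nbhs.
split => [x Ux|v].
  have fx : f z @[z --> x] --> f x := fc _ Ux.
  rewrite /prop_for /continuous_at -(fg _ Ux); apply: cvg_trans fx.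
  by apply: near_eq_cvg; exact: E.
have [d1 [d2 _]] := fd v; split; [|split => //] => x Ux.
- have [->|v0] := eqVneq v 0; first exact: derivable0.
  by apply: near_eq_derivable (d1 _ Ux) => //; exact: E.
- have D z : U z -> 'D_v f z = 'D_v g z.
    move=> Uz; have [->|v0] := eqVneq v 0; first by rewrite !derive0.
    by apply: near_eq_derive => //; exact: E.
  have fx : 'D_v f z @[z --> x] --> 'D_v f x := d2 _ Ux.
  rewrite /prop_for /continuous_at -(D _ Ux); apply: cvg_trans fx.
  apply: near_eq_cvg; near=> z; apply: D.
  by near: z; exact: open_nbhs_nbhs.
Unshelve. all: by end_near. Qed.

Lemma derivable_scale (V W : normedModType R) (f : V -> W) x v a :
  derivable f x v -> derivable f x (a *: v) /\ 'D_(a *: v) f x = a *: 'D_v f x.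
Proof.
have [->|a0] := eqVneq a 0.
  by rewrite !scale0r => _; split; [exact: derivable0|rewrite derive0].
move=> fv.
have : (fun h => h^-1 *: ((f \o shift x) (h *: (a *: v)) - f x)) @ 0^' -->
   a *: 'D_v f x.
  have -> : (fun h => h^-1 *: ((f \o shift x) (h *: (a *: v)) - f x)) =
    (fun h => a *: (h^-1 *: ((f \o shift x) (h *: v) - f x))) \o (fun h => h * a).
    apply/funext => h /=; rewrite !scalerA; congr (_ *: _).
    have [->|h0] := eqVneq h 0; first by rewrite mul0r invr0 mulr0.
    by field; rewrite a0 h0.
  have H : (fun h => a *: (h^-1 *: ((f \o shift x) (h *: v) - f x))) @ 0^' -->
      a *: 'D_v f x by apply: cvgZ; [exact: cvg_cst|exact: fv].
  apply: (cvg_comp _ _ _ H).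
  move=> A /= /nbhs_ballP[e /= e0 eA]; apply/nbhs_ballP.
  exists (e / `|a|) => /=; first by rewrite divr_gt0 // normr_gt0.
  move=> h /= hb h0; apply: eA.
    move: hb; rewrite /ball /= !sub0r !normrN normrM ltr_pdivlMr ?normr_gt0//.
  by rewrite mulf_neq0.
by move=> H; split; [apply/cvg_ex; exists (a *: 'D_v f x)|apply/cvg_lim].
Qed.

End C1.
Section rVnorm.
Context (R : realType) (m : nat).
Lemma rV_norm_le (v : 'rV[R]_m) e : 0 <= e -> (forall i, `|v 0 i| <= e) -> `|v| <= e.
Proof.
move=> e0 H; rewrite /Num.Def.normr/= mx_normrE (bigmax_le _ e0)//= => -[i j] _.
by rewrite ord1.
Qed.

Lemma rV_coord_le (v : 'rV[R]_m) i : `|v 0 i| <= `|v|.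
Proof.
rewrite [leRHS]/Num.Def.normr/= mx_normrE.
exact: (le_bigmax _ (fun ij : 'I_1 * 'I_m => `|v ij.1 ij.2|) (0, i)).
Qed.

End rVnorm.

(** * Total differentiability and the chain rule for C^1 maps *)

Section differentiability_of_C1.
Context (R : realType).

Lemma derivable_line (V W : normedModType R) (f : V -> W) p w (t : R) :
  derivable f (p + t *: w) w ->
  derivable (fun s : R => f (p + s *: w)) t 1 /\
  'D_1 (fun s : R => f (p + s *: w)) t = 'D_w f (p + t *: w).
Proof.
rewrite /derivable /derive /=.
suff -> : (fun h : R => h^-1 *: (f (p + (h *: 1 + t) *: w) - f (p + t *: w))) =
   (fun h : R => h^-1 *: (f (h *: w + (p + t *: w)) - f (p + t *: w))) by [].
apply/funext => h; congr (_ *: (f _ - _)).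
by rewrite scalerDl addrCA /GRing.scale/= mulr1.
Qed.

Lemma MVT_line (V : normedModType R) (f : V -> R) p w (c e : R) :
  (forall t : R, 0 <= t <= 1 -> derivable f (p + t *: w) w) ->
  (forall t : R, 0 <= t <= 1 -> `|'D_w f (p + t *: w) - c| <= e) ->
  `|f (p + w) - f p - c| <= e.
Proof.
move=> fd fe.
have D (t : R) : 0 <= t <= 1 ->
    is_derive t 1 (fun s : R => f (p + s *: w)) ('D_w f (p + t *: w)).
  by move=> /fd /derivable_line[H1 H2]; apply: DeriveDef.
have := @MVT_segment R (fun s : R => f (p + s *: w)) (fun t => 'D_w f (p + t *: w)) 0 1 ler01.
case.
- by move=> x; rewrite in_itv/= => /andP[x0 x1]; apply: D; rewrite !ltW.
- apply: derivable_within_continuous => x; rewrite in_itv/= => x01.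
  by have [] := D x x01.
move=> t; rewrite in_itv/= subr0 mulr1 scale1r scale0r addr0 => t01 ->.
exact: fe.
Qed.

(** Going from p to p + k one coordinate at a time, each step is an instance of the mean value
    theorem with a partial derivative close to its value at p. The balls of the sup norm contain all
    the intermediate points. *)
Lemma C1_taylor n (f : 'rV[R]_n -> R) (U : set 'rV[R]_n) p : open U ->
  Ck_on 1 U f -> U p -> forall e : R, 0 < e -> \forall k \near (0 : 'rV[R]_n),
  `|f (p + k) - f p - \sum_(j < n) k 0 j * 'D_(delta_mx 0 j) f p| <= e * `|k|.
Proof.
move=> oU [_ fd] Up e e0.
pose d j : 'rV[R]_n := delta_mx 0 j.
(* The error e is shared among the n coordinates; dividing by n + 1 includes n = 0. *)
have e'0 : 0 < e / n.+1%:R by rewrite divr_gt0.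
have near_p : \forall x \near p, U x /\
    forall j, `|'D_(d j) f x - 'D_(d j) f p| <= e / n.+1%:R.
  apply: filterI; first exact: open_nbhs_nbhs.
  apply: (@filter_forall _ 'I_n (fun j x => `|'D_(d j) f x - 'D_(d j) f p| <= e / n.+1%:R) (nbhs p) _) => j.
  have [_ [+ _]] := fd (d j).
  move=> /(_ _ Up) /cvgrPdist_le /(_ _ e'0).
  by apply: filterS => x; rewrite distrC.
have /nbhs_ballP[r /= r0 rP] := near_p.
apply/nbhs_ballP; exists r => // k; rewrite mx_norm_ball /ball_ /= sub0r normrN => kr.
pose P (j : nat) : 'rV[R]_n := p + \row_i (if (i < j)%N then k 0 i else 0).
have P0 : P 0%N = p by apply/rowP => i; rewrite !mxE addr0.
have Pn : P n = p + k by apply/rowP => i; rewrite !mxE ltn_ord.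
have PS (j : 'I_n) : P j.+1 = P j + k 0 j *: d j.
  rewrite /P -addrA; congr (_ + _); apply/rowP => i; rewrite !mxE eqxx/= ltnS leq_eqVlt.
  have [->|ij] := eqVneq i j; first by rewrite eqxx/= ltnn add0r mulr1.
  have -> : (i == j :> nat) = false by apply: contraNF ij => /eqP/val_inj->.
  by rewrite /= mulr0 addr0.
have Pr (j : 'I_n) (t : R) : 0 <= t <= 1 -> ball p r (P j + t *: (k 0 j *: d j)).
  move=> /andP[t0 t1]; rewrite mx_norm_ball /ball_ /=.
  apply: le_lt_trans kr; apply: rV_norm_le => // i.
  rewrite !mxE eqxx /=.
  have [->|ij] := eqVneq i j.
    rewrite ltnn addr0 mulr1 opprD addNKr normrN normrM ger0_norm//.
    by rewrite (le_trans _ (rV_coord_le k j))// ler_piMl.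
  rewrite !mulr0 addr0 opprD addNKr normrN; case: ifP => _; last by rewrite normr0.
  exact: rV_coord_le.
rewrite -Pn -[X in _ - f X]P0 -(telescope_sumr (fun j => f (P j))) // big_mkord -sumrB.
apply: le_trans (ler_norm_sum _ _ _) _.
apply: (@le_trans _ _ (\sum_(j < n) (e / n.+1%:R * `|k|))); last first.
  rewrite sumr_const card_ord -[X in X <= _]mulr_natl mulrA ler_wpM2r// mulrA.
  by rewrite ler_pdivrMr// mulrC ler_wpM2l ?(ltW e0)// ler_nat.
apply: ler_sum => j _; rewrite PS.
apply: MVT_line => t t01.
  have [_ _] := rP _ (Pr j t t01).
  have [H _] := fd (k 0 j *: d j); apply: H.
  by have [] := rP _ (Pr j t t01).
have [Ux /(_ j) Dj] := rP _ (Pr j t t01).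
have [H _] := fd (d j); have [_ ->] := derivable_scale (k 0 j) (H _ Ux).
rewrite -[_ *: _]/(_ * _) -mulrBr normrM mulrC ler_pM//.
exact: rV_coord_le.
Qed.

Lemma C1_coord (V : normedModType R) m (f : V -> 'rV[R]_m) (U : set V) i :
  open U -> Ck_on 1 U f -> Ck_on 1 U (fun x => f x 0 i).
Proof.
move=> oU [fc fd]; split => [x Ux|v].
  have H : f z @[z --> x] --> f x := fc _ Ux.
  exact: (cvg_comp _ _ H (@coord_continuous _ _ _ 0 i (f x))).
have [d1 [d2 _]] := fd v; split; [|split => //] => x Ux.
  by move/derivable_mxP : (d1 _ Ux); apply.
have E y : U y -> 'D_v (fun x => f x 0 i) y = ('D_v f y) 0 i.
  by move=> Uy; rewrite (derive_mx (d1 _ Uy)) mxE.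
have H : 'D_v f z @[z --> x] --> 'D_v f x := d2 _ Ux.
rewrite /prop_for /continuous_at (E _ Ux).
have H2 := (cvg_comp _ _ H (@coord_continuous _ _ _ 0 i ('D_v f x))).
apply: cvg_trans H2; apply: near_eq_cvg; near=> y; rewrite /= E//.
by near: y; exact: open_nbhs_nbhs.
Unshelve. all: by end_near. Qed.

(** [Ck_on] speaks of directional derivatives only, each continuous in the base point. Total
    differentiability makes the derivative linear in the direction and gives the chain rule along
    curves. *)
Lemma C1_differentiable n m (f : 'rV[R]_n -> 'rV[R]_m) (U : set 'rV[R]_n) p :
  open U -> Ck_on 1 U f -> U p -> differentiable f p.
Proof.
move=> oU fC Up.
pose df (k : 'rV[R]_n) : 'rV[R]_m := \sum_(j < n) k 0 j *: 'D_(delta_mx 0 j) f p.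
have dfl : linear df.
  move=> a u v; rewrite /df scaler_sumr -big_split/=; apply: eq_bigr => j _.
  by rewrite !mxE scalerDl scalerA.
pose dfM := GRing.isLinear.Build _ _ _ _ _ dfl.
pose dfL : {linear _ -> _} := HB.pack df dfM.
have dfc : continuous (df : 'rV[R]_n -> 'rV[R]_m).
  apply: continuous_big => [|j _ x]; first exact: add_continuous.
  have H0 : (fun k : 'rV[R]_n => k 0 j) k @[k --> x] --> x 0 j by exact: coord_continuous.
  first [exact: (cvgZr_tmp H0) | exact: (cvgZr_tmp _ H0) |apply: (cvgZ H0); exact: cvg_cst].
have fT : f \o shift p = cst (f p) + (df : 'rV[R]_n -> 'rV[R]_m) +o_ (0 : 'rV[R]_n) (id : 'rV[R]_n -> 'rV[R]_n).
  apply/eqaddoP => e e0.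
  pose Q (i : 'I_m) (k : 'rV[R]_n) := `|f (p + k) 0 i - f p 0 i -
     \sum_(j < n) k 0 j * 'D_(delta_mx 0 j) (fun x => f x 0 i) p| <= e * `|k|.
  have /nbhs_ballP[r r0 rQ] : nbhs (0 : 'rV[R]_n) [set k | forall i, Q i k].
    apply: (@filter_forall _ _ Q (nbhs (0 : 'rV[R]_n)) _) => i.
    by apply: (C1_taylor oU _ Up e0); exact: C1_coord.
  apply/nbhs_ballP; exists r => // k /rQ H; apply: rV_norm_le.
    by rewrite mulr_ge0 // ltW.
  move=> i; move: (H i); congr (`|_| <= _); rewrite !mxE/= [k + p]addrC opprD addrA.
  congr (_ - _); rewrite summxE; apply: eq_bigr => j _; rewrite !mxE.
  by rewrite derive_mx ?mxE//; have [_ /(_ (delta_mx 0 j))[+ _]] := fC; apply.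
by apply/diff_locallyP; rewrite (@diff_unique _ _ _ f dfL p dfc fT).
Qed.

Lemma derive_curve n m (f : 'rV[R]_n -> 'rV[R]_m) (U : set 'rV[R]_n) (c : R -> 'rV[R]_n) t :
  open U -> Ck_on 1 U f -> U (c t) -> derivable c t 1 ->
  derivable (f \o c) t 1 /\ 'D_1 (f \o c) t = 'D_('D_1 c t) f (c t).
Proof.
move=> oU fC Uc /derivable1_diffP cd.
have fd := C1_differentiable oU fC Uc.
have fcd : differentiable (f \o c) t by exact: differentiable_comp.
split; first exact/derivable1_diffP.
by rewrite !deriveE// diff_comp.
Qed.

Lemma derive_rV n m (f : 'rV[R]_n -> 'rV[R]_m) (U : set 'rV[R]_n) p v :
  open U -> Ck_on 1 U f -> U p ->
  'D_v f p = \sum_(j < n) v 0 j *: 'D_(delta_mx 0 j) f p.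
Proof.
move=> oU fC Up; have fd := C1_differentiable oU fC Up.
rewrite deriveE// {1}(row_sum_delta v) linear_sum; apply: eq_bigr => j _.
by rewrite linearZ/= deriveE.
Qed.

Lemma C1_comp_curve n m (f : 'rV[R]_n -> 'rV[R]_m) (U : set 'rV[R]_n)
    (O : set R) (c : R -> 'rV[R]_n) :
  open U -> Ck_on 1 U f -> open O -> Ck_on (V := R^o) 1 O c ->
  Ck_on (V := R^o) 1 (O `&` c @^-1` U) (f \o c).
Proof.
move=> oU fC oO [cc cd].
have [fc fd] := fC.
have cN t : O t -> U (c t) -> \forall s \near t, O s /\ U (c s).
  move=> Ot Uct; apply: filterI; first exact: open_nbhs_nbhs.
  by apply: (cc _ Ot); apply: open_nbhs_nbhs.
have [c1 [c2 _]] := cd 1.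
(* This form of the derivative is a finite sum of products of functions continuous in t, whereas in
   ['D_('D_1 c t) f (c t)] the direction varies as well. *)
have D t : O t -> U (c t) -> 'D_1 (f \o c) t = \sum_(j < n) ('D_1 c t) 0 j *: 'D_(delta_mx 0 j) f (c t).
  move=> Ot Uct; have [_ ->] := derive_curve oU fC Uct (c1 _ Ot).
  exact: derive_rV oU fC Uct.
split => [t [Ot Uct]|v]; first exact: continuous_comp (cc _ Ot) (fc _ Uct).
have d1 t : O t -> U (c t) -> derivable (f \o c) t 1.
  by move=> Ot Uct; have [] := derive_curve oU fC Uct (c1 _ Ot).
have vE : v = v *: (1 : R^o) by rewrite /GRing.scale/= mulr1.
split => [t [Ot Uct]|].
  by rewrite vE; have [] := derivable_scale v (d1 _ Ot Uct).
split => // t [Ot Uct].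
have E : \forall s \near t, v *: (\sum_(j < n) ('D_1 c s) 0 j *: 'D_(delta_mx 0 j) f (c s)) = 'D_v (f \o c) s.
  apply: filterS (cN _ Ot Uct) => s [Os Ucs].
  have [_ H] := derivable_scale v (d1 _ Os Ucs).
  by rewrite -vE in H; rewrite H D.
rewrite /prop_for /continuous_at -(nbhs_singleton E).
apply: cvg_trans; first by apply: near_eq_cvg; exact: E.
apply: cvgZ; first exact: cvg_cst.
apply: cvg_big => [|j _]; first exact: add_continuous.
apply: cvgZ.
  exact: (cvg_comp _ _ (c2 _ Ot) (@coord_continuous _ _ _ 0 j ('D_1 c t))).
have [_ [fd2 _]] := fd (delta_mx 0 j).
exact: (cvg_comp _ _ (cc _ Ot) (fd2 _ Uct)).
Qed.

End differentiability_of_C1.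

(** * Integrals of nonnegative functions that need not be measurable *)

Section integral_without_measurability.
Local Open Scope ereal_scope.
Context d (T : measurableType d) (R : realType) (mu : {measure set T -> \bar R}).
Import HBNNSimple.

(* The library defines the integral of a nonnegative function as the supremum over the simple
   functions below it, whether or not the function is measurable. *)
Lemma integral_lbound (D : set T) (f : T -> \bar R) (h : {nnsfun T >-> R}) :
  (forall x, D x -> 0 <= f x) -> (forall x, (h x)%:E <= (f \_ D) x) ->
  sintegral mu h <= \int[mu]_(x in D) f x.
Proof. by move=> f0 hf; rewrite ge0_integralE//; apply: ereal_sup_ubound; exists h. Qed.

Lemma integral_ubound (D : set T) (f : T -> \bar R) c :
  (forall x, D x -> 0 <= f x) ->
  (forall h : {nnsfun T >-> R}, (forall x, (h x)%:E <= (f \_ D) x) ->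
    sintegral mu h <= c) ->
  \int[mu]_(x in D) f x <= c.
Proof.
by move=> f0 H; rewrite ge0_integralE//; apply: ge_ereal_sup => _ [h hf <-]; exact: H.
Qed.

Lemma le_integral_gen (D D' : set T) (f g : T -> \bar R) :
  (forall x, D x -> 0 <= f x) -> (forall x, D' x -> 0 <= g x) ->
  (forall x, D x -> D' x /\ f x <= g x) ->
  \int[mu]_(x in D) f x <= \int[mu]_(x in D') g x.
Proof.
move=> f0 g0 fg; apply: integral_ubound => // h hf; apply: integral_lbound => // x.
apply: le_trans (hf x) _; rewrite /patch; have [xD|xD] := pselect (D x).
  by have [xD' fgx] := fg _ xD; rewrite !mem_set.
by rewrite (memNset xD); case: ifPn => //; rewrite inE => /g0.
Qed.

(** As A and B are measurable, restricting a simple function to one of them, and adding two such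
    restrictions, gives simple functions again; this yields the two inequalities. It is applied to
    lengths of curves, where f is the speed. *)
Lemma integral_setU_gen (A B : set T) (f : T -> \bar R) :
  measurable A -> measurable B -> [disjoint A & B] ->
  (forall x, (A `|` B) x -> 0 <= f x) ->
  \int[mu]_(x in A `|` B) f x = \int[mu]_(x in A) f x + \int[mu]_(x in B) f x.
Proof.
move=> mA mB AB f0.
have fA x : A x -> 0 <= f x by move=> Ax; apply: f0; left.
have fB x : B x -> 0 <= f x by move=> Bx; apply: f0; right.
have nAB x : A x -> B x -> False.
  by move=> Ax Bx; move/disj_setPS : AB => /(_ x); apply.
apply/eqP; rewrite eq_le; apply/andP; split.
  apply: integral_ubound => // h hf.
  have -> : sintegral mu h = sintegral mu (add_nnsfun (proj_nnsfun h mA) (proj_nnsfun h mB)).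
    congr (sintegral _ _); apply/funext => x /=; rewrite !mindicE.
    have := hf x; rewrite /patch.
    have [xA|xA] := pselect (A x).
      rewrite (mem_set xA) [x \in B]memNset ?mulr1 ?mulr0 ?addr0// => xB.
      exact: nAB xA xB.
    have [xB|xB] := pselect (B x).
      by rewrite (memNset xA) (mem_set xB) mulr1 mulr0 add0r.
    rewrite memNset; last by case.
    rewrite (memNset xA) (memNset xB) lee_fin !mulr0 addr0 => h0; apply/eqP; rewrite eq_le h0/=; exact: fun_ge0.
  rewrite sintegralD//; apply: leeD; apply: integral_lbound => // x /=.
    have := hf x; rewrite /patch mindicE; have [xA|xA] := pselect (A x).
      by rewrite (mem_set xA) mulr1 mem_set//; left.
    by rewrite (memNset xA) mulr0.
  have := hf x; rewrite /patch mindicE; have [xB|xB] := pselect (B x).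
    by rewrite (mem_set xB) mulr1 mem_set//; right.
  by rewrite (memNset xB) mulr0.
(* Once the total is finite, all the terms are, and the two suprema can be bounded in turn by moving
   terms across the inequality. *)
have [->|Ay] := eqVneq (\int[mu]_(x in A `|` B) f x) +oo; first exact: leey.
have AAB : \int[mu]_(x in A) f x <= \int[mu]_(x in A `|` B) f x.
  by apply: le_integral_gen => // x Ax; split => //; left.
have BAB : \int[mu]_(x in B) f x <= \int[mu]_(x in A `|` B) f x.
  by apply: le_integral_gen => // x Ax; split => //; right.
have A0 := integral_ge0 mu fA; have B0 := integral_ge0 mu fB.
have Afin : \int[mu]_(x in A) f x \is a fin_num.
  by rewrite ge0_fin_numE// (le_lt_trans AAB) // ltey.
have Bfin : \int[mu]_(x in B) f x \is a fin_num.
  by rewrite ge0_fin_numE// (le_lt_trans BAB) // ltey.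
rewrite -leeBrDr//; apply: integral_ubound => // h hf.
rewrite leeBrDr// addeC -leeBrDr; last first.
  rewrite ge0_fin_numE ?sintegral_ge0//.
  by apply: le_lt_trans (integral_lbound fA hf) _; rewrite ltey_eq Afin.
apply: integral_ubound => // h' hf'.
rewrite leeBrDr; last first.
  rewrite ge0_fin_numE ?sintegral_ge0//.
  by apply: le_lt_trans (integral_lbound fA hf) _; rewrite ltey_eq Afin.
rewrite -sintegralD; apply: (@integral_lbound _ _ (add_nnsfun h' h)) => // x /=.
have := hf x; have := hf' x; rewrite /patch.
have [xA|xA] := pselect (A x).
  rewrite (mem_set xA) [x \in B]memNset; last by move=> /(nAB _ xA).
  rewrite mem_set; last by left.
  by rewrite EFinD => h'0 hx; rewrite -[leRHS]add0e; apply: leeD.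
rewrite (memNset xA); have [xB|xB] := pselect (B x).
  rewrite (mem_set xB) mem_set; last by right.
  by rewrite EFinD => hx h0; rewrite -[leRHS]adde0; apply: leeD.
rewrite (memNset xB) memNset; last by case.
by rewrite !lee_fin => h0 h0'; rewrite -[leRHS]addr0; apply: lerD.
Qed.

(** A simple function h below f pulls back to [h \o phi], whose integral is k times that of h; hence
    [h \o phi] divided by k competes in the supremum that defines the integral of g. *)
Lemma le_integral_image (phi : T -> T) (D D' : set T)
    (f g : T -> \bar R) (k : R) : (0 < k)%R ->
  measurable_fun setT phi ->
  (forall A, measurable A -> mu (phi @^-1` A) = k%:E * mu A) ->
  (forall x, D x -> 0 <= f x) -> (forall x, D' x -> 0 <= g x) ->
  (forall x, D (phi x) -> D' x /\ f (phi x) <= k%:E * g x) ->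
  \int[mu]_(x in D) f x <= \int[mu]_(x in D') g x.
Proof.
move=> k0 mphi muphi f0 g0 fg; apply: integral_ubound => // h hf.
have mh : measurable_fun setT (h \o phi) by exact: measurableT_comp.
have fh : finite_set (range (h \o phi)).
  apply: (@sub_finite_set _ _ (range h)); last exact: fimfunP.
  by move=> _ [x _ <-]; exists (phi x).
have nnh x : (0 <= (h \o phi) x)%R by exact: fun_ge0.
pose hm := isMeasurableFun.Build _ _ _ _ _ mh.
pose hf' := FiniteImage.Build _ _ _ fh.
pose hn := isNonNegFun.Build _ _ _ nnh.
pose h' : {nnsfun T >-> R} := HB.pack (h \o phi) hm hf' hn.
have E : sintegral mu h' = k%:E * sintegral mu h.
  rewrite /sintegral ge0_mule_fsumr; last exact: nnsfun_mulemu_ge0.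
  apply: eq_fsbigr => x _; rewrite muleCA; congr (_ * _).
  rewrite comp_preimage muphi//.
have -> : sintegral mu h = sintegral mu (cst k^-1 \* h')%R.
  by rewrite sintegralrM E muleA -EFinM mulVf ?gt_eqF// mul1e.
have k1 : (0 <= k^-1)%R by rewrite invr_ge0 ltW.
apply: (@integral_lbound _ _ (scale_nnsfun h' k1)) => // x /=.
have := hf (phi x); rewrite /patch; have [Dp|Dp] := pselect (D (phi x)).
  have [D'x fgx] := fg _ Dp; rewrite (mem_set Dp) (mem_set D'x) => H.
  by rewrite EFinM lee_pdivrMl// (le_trans H).
rewrite (memNset Dp) lee_fin => H.
apply: (@le_trans _ _ 0%:E); first by rewrite lee_fin pmulr_rle0// invr_gt0.
by case: ifPn => //; rewrite inE => /g0.
Qed.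

Lemma ge0_le_integral_cst (D : set T) (f : T -> \bar R) (c : R) :
  measurable D -> (0 <= c)%R -> (forall x, D x -> 0 <= f x) ->
  (forall x, D x -> f x <= c%:E) ->
  \int[mu]_(x in D) f x <= c%:E * mu D.
Proof.
move=> mD c0 f0 fc; rewrite -integral_cst//.
by apply: le_integral_gen => // x Dx; split => //; exact: fc.
Qed.

End integral_without_measurability.

(** * Lebesgue measure under affine maps *)

Section lebesgue_affine.
Local Open Scope ereal_scope.
Context (R : realType).
Local Notation mu := (@lebesgue_measure R).

(** The rescaled pushforward agrees with the Lebesgue measure on half-open intervals, so uniqueness
    applies. *)
Lemma lebesgue_measure_affine (a k : R) (A : set (measurableTypeR R)) : (0 < k)%R -> measurable A ->
  mu ((fun x : R => (x - a) / k)%R @^-1` A) = k%:E * mu A.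
Proof.
move=> k0 mA.
pose phi (x : measurableTypeR R) : measurableTypeR R := ((x - a) / k)%R.
have mphi : measurable_fun setT phi.
  by apply: measurable_funM => //; exact: measurable_funB.
have k1 : (0 <= k^-1)%R by rewrite invr_ge0 ltW.
pose nu := mscale (NngNum k1) (pushforward mu phi).
have -> : mu A = nu mphi A.
  apply: (@lebesgue_measure_unique _ (nu mphi)) => // _ [[x y]] _ <-.
  rewrite /nu/= /mscale /= /pushforward.
  have -> : phi @^-1` `]x, y]%classic = `](k * x + a)%R, (k * y + a)%R]%classic.
    apply/seteqP; split => z /=; rewrite !in_itv/= /phi ltr_pdivlMr// ler_pdivrMr// ltrBrDr lerBlDr;
    by rewrite ![(k * _)%R]mulrC.
  rewrite !lebesgue_measure_itv/= !lte_fin ltrD2r ltr_pM2l//.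
  case: ifPn => _; last by rewrite mule0.
  rewrite -EFinB -EFinM opprD addrACA subrr addr0 -mulrBr mulrA mulVf ?mul1r//.
  by rewrite gt_eqF.
have kk : (k / k = 1)%R by rewrite divff// gt_eqF.
by rewrite /nu /mscale/= muleA -EFinM kk mul1e.
Qed.

End lebesgue_affine.

(** * Integrals against set functions *)

Section raw_integral.
Local Open Scope ereal_scope.
Context d (T : measurableType d) (R : realType).
Import HBNNSimple.

Lemma sintegral_raw (m : set T -> \bar R) (h : {nnsfun T >-> R}) : m set0 = 0 ->
  sintegral m h = \sum_(x \in range h) x%:E * m (h @^-1` [set x]).
Proof.
move=> m0; rewrite /sintegral (fsbig_widen (range h) setT)//= => x [_ Nhx] /=.
by rewrite preimage10// m0 mule0.
Qed.

(** The integral is a difference of two suprema, one for each sign of f. The work is to see that the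
    one for the negative part is 0, and this follows from [m set0 = 0]. *)
Lemma integral_raw_lbound (m : set T -> \bar R) (D : set T) (f : T -> \bar R)
    (h : {nnsfun T >-> R}) : m set0 = 0 ->
  (forall x, D x -> 0 <= f x) -> (forall x, (h x)%:E <= (f \_ D) x) ->
  sintegral m h <= \int[m]_(x in D) f x.
Proof.
move=> m0 f0 hf; rewrite /integral funeneg_restrict funepos_restrict.
have /eq_restrictP-> := ge0_funeposE f0.
have /eq_restrictP-> := ge0_funenegE f0.
rewrite erestrict0 [X in _ <= _ - X](_ : _ = 0) ?sube0.
  by apply: ereal_sup_ubound; exists h.
have H0 (k : {nnsfun T >-> R}) : (forall x, (k x)%:E <= 0) -> sintegral m k = 0.
  move=> k0; have kE x : k x = 0%R.
    by apply/eqP; rewrite eq_le -lee_fin k0/=; exact: fun_ge0.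
  rewrite /sintegral fsbig1// => x _.
  have [->|x0] := eqVneq x 0%R; first by rewrite mul0e.
  rewrite preimage10 ?m0 ?mule0// => -[t _]; rewrite kE => /esym/eqP.
  by rewrite (negbTE x0).
apply/eqP; rewrite eq_le; apply/andP; split.
  by apply: ge_ereal_sup => _ [k k0 <-]; rewrite H0.
by apply: ereal_sup_ubound; exists (@nnsfun0 _ T R) => //; exact: H0.
Qed.

(* [m2] is an arbitrary set function: its integral is still defined by the same formula. *)
Lemma le_integral_measure (m1 : {measure set T -> \bar R}) (m2 : set T -> \bar R)
    (D D' : set T) (f : T -> \bar R) (k : R) : (0 <= k)%R ->
  m2 set0 = 0 -> (forall A, 0 <= m2 A) ->
  (forall A, measurable A -> A `<=` D -> m1 A <= k%:E * m2 A) ->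
  D `<=` D' -> (forall x, D' x -> 0 <= f x) ->
  \int[m1]_(x in D) f x <= k%:E * \int[m2]_(x in D') f x.
Proof.
move=> k0 m20 m2ge0 m12 DD' f0; apply: integral_ubound => [x /DD'/f0//|h hf].
apply: (@le_trans _ _ (k%:E * sintegral m2 h)); last first.
  apply: lee_wpmul2l => //; apply: integral_raw_lbound => // x.
  apply: le_trans (hf x) _; rewrite /patch; have [xD|xD] := pselect (D x).
    by rewrite (mem_set xD) mem_set//; exact: DD'.
  by rewrite (memNset xD); case: ifPn => //; rewrite inE => /f0.
rewrite !sintegral_raw// ge0_mule_fsumr; last first.
  move=> x; have [[t _ <-]|Nx] := pselect (range h x).
    by rewrite mule_ge0// lee_fin.
  by rewrite preimage10// m20 mule0.
apply: lee_fsum => // x [t _ <-]; rewrite muleCA.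
have [->|ht0] := eqVneq (h t) 0%R; first by rewrite !mul0e.
apply: lee_wpmul2l; first by rewrite lee_fin.
(* The level set of h at a nonzero value lies in D, since h is below a function that vanishes off
   D. *)
apply: m12 => // s /= hs.
have := hf s; rewrite /patch; have [Ds//|Ds] := pselect (D s).
rewrite (memNset Ds) hs lee_fin => h0; have : (0 <= h t)%R by exact: fun_ge0.
by move=> h0'; move: ht0; rewrite eq_le h0 h0'.
Qed.

End raw_integral.

(** * Substitution by a map whose inverse is Lipschitz *)

Section lipschitz_substitution.
Local Open Scope ereal_scope.
Context (R : realType).
Local Notation mu := (@lebesgue_measure R).

(** By construction, the Lebesgue measure is an infimum over countable covers by half-open
    intervals, so a lower bound can be checked on these covers. *)
Lemma lebesgue_measure_cover (A : set (measurableTypeR R)) (c : \bar R) :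
  (forall F : (set R)^nat, (forall k, exists ab : R * R, F k = `]ab.1, ab.2]%classic) ->
     A `<=` \bigcup_k F k -> c <= \sum_(k <oo) mu (F k)) -> c <= mu A.
Proof.
move=> H; apply: le_ereal_inf_tmp => _ [F [mF AF] <-].
rewrite (eq_eseriesr (g := fun k => mu (F k))); last first.
  move=> k _; apply/esym.
  exact: (@measurable_mu_extE _ R _ (wlength idfun : {measure set _ -> \bar R}) _ (mF k)).
apply: (H F) => // k; have [ab _ <-] := mF k; by exists ab.
Qed.

(** The preimage under T of an interval of length l lies within M l of any of its points s, hence in
    an interval of length 2 M l centred at s. So the pushforward by T is at most 2 M times the
    Lebesgue measure, first on intervals and then, by covers, on Borel sets. *)
Lemma le_integral_lipschitz_inverse (T : R -> R) (D D' : set (measurableTypeR R))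
    (f : R -> \bar R) (M z : R) :
  (0 < M)%R -> measurable D -> measurable D' -> ~ D' z ->
  measurable_fun D (T : measurableTypeR R -> measurableTypeR R) ->
  (forall s t, D s -> D t -> `|s - t| <= M * `|T s - T t|)%R ->
  (forall t, D t -> D' (T t)) ->
  measurable_fun D' (f : measurableTypeR R -> \bar R) -> (forall x, D' x -> 0 <= f x) ->
  \int[mu]_(t in D) f (T t) <= (2 * M)%:E * \int[mu]_(t in D') f t.
Proof.
move=> M0 mD mD' D'z mT TM TD mf f0.
(* Points off D are sent to z, which is not in D', so that the preimage of D' is exactly D. *)
pose T' (t : measurableTypeR R) : measurableTypeR R := if t \in D then T t else z.
have mT' : measurable_fun setT T'.
  rewrite -(setUv D); apply/measurable_funU => //; first exact: measurableC.
  split.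
    apply: eq_measurable_fun mT => t tD; by rewrite /T' tD.
  apply: (eq_measurable_fun (cst z)); last exact: measurable_cst.
  by move=> t; rewrite inE => tD; rewrite /T' memNset.
have T'D : T' @^-1` D' = D.
  apply/seteqP; split => t /=; rewrite /T'.
    by case: ifPn => [|_ /D'z//]; rewrite inE.
  by move=> tD; rewrite mem_set//; exact: TD.
have -> : \int[mu]_(t in D) f (T t) = \int[pushforward mu T']_(t in D') f t.
  rewrite ge0_integral_pushforward//; last by move=> x /[!inE]; exact: f0.
  rewrite T'D; apply: eq_integral => t tD /=; by rewrite /T' tD.
apply: (@le_integral_measure _ _ _ (pushforward mu T' : {measure set _ -> \bar R})) => //.
  by rewrite mulr_ge0// ltW.
move=> A mA AD'; rewrite -lee_pdivrMl ?mulr_gt0//.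
apply: lebesgue_measure_cover => F Foc AF.
rewrite lee_pdivrMl ?mulr_gt0//.
have mFD k : measurable (T' @^-1` (F k `&` D')).
  rewrite -[X in measurable X]setTI; apply: mT' => //.
  by have [ab ->] := Foc k; apply: measurableI => //; exact: measurable_itv.
have mTA : measurable (T' @^-1` A) by rewrite -[X in measurable X]setTI; exact: mT'.
apply: (@le_trans _ _ (\sum_(k <oo) mu (T' @^-1` (F k `&` D')))).
  apply: (measure_sigma_subadditive (mu : {measure set _ -> \bar R}) mFD mTA).
  by move=> t At; have [k _ Fk] := AF _ At; exists k => //; split => //; exact: AD'.
rewrite -nneseriesZl//; apply: lee_nneseries => [//|k _].
have [->|/set0P[s [Fs D's]]] := eqVneq (T' @^-1` (F k `&` D')) set0.
  by rewrite measure0 mule_ge0 ?lee_fin ?mulr_ge0// ltW.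
have [[a b]/= E] := Foc k.
have Ds : D s by rewrite -T'D.
have TE t : D t -> T' t = T t by move=> Dt; rewrite /T' mem_set.
move: Fs; rewrite E /= in_itv/= TE// => /andP[as_ sb].
have ab : (a < b)%R by rewrite (lt_le_trans as_).
apply: (@le_trans _ _ (mu `[(s - M * (b - a))%R, (s + M * (b - a))%R]%classic)).
  apply: le_measure; rewrite ?inE//; first by rewrite -E; exact: mFD.
  move=> t [/= Ft D't]; have Dt : D t by rewrite -T'D.
  move: Ft; rewrite in_itv/= TE// => /andP[at_ tb].
  have := TM _ _ Dt Ds; have : (`|T t - T s| <= b - a)%R.
    rewrite ler_norml; lra.
  rewrite in_itv/= => H1 H2; have : (`|t - s| <= M * (b - a))%R.
    by rewrite (le_trans H2)// ler_wpM2l// ltW.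
  by rewrite ler_norml; lra.
rewrite !lebesgue_measure_itv/= !lte_fin ab.
have Mab : (0 < M * (b - a))%R by rewrite mulr_gt0// subr_gt0.
rewrite ifT; last lra.
by rewrite -!EFinB -EFinM lee_fin; lra.
Qed.

End lipschitz_substitution.

(** * Charts, curves and length *)

Lemma C1_local (R : realType) (V W : normedModType R) (U : set V) (f : V -> W) :
  (forall x, U x -> exists2 B, B x & Ck_on 1 B f) -> Ck_on 1 U f.
Proof.
move=> H; split => [x /H[B Bx [fc _]]|v]; first exact: fc.
split; [|split => //] => x /H[B Bx [_ /(_ v)[d1 [d2 _]]]]; [exact: d1|exact: d2].
Qed.

Lemma open_nbhs_mem (T : topologicalType) (A : set T) (x : T) : open A -> A x -> nbhs x A.
Proof. by move=> oA Ax; apply: open_nbhs_nbhs. Qed.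

Lemma nbhs_setI (T : topologicalType) (A B : set T) (x : T) : nbhs x A -> nbhs x B -> nbhs x (A `&` B).
Proof. exact: filterI. Qed.

Section smooth_maps.
Context (R : realType) (n : nat) (M : smoothManifoldType R n).

Definition chart_im (x : M) : set 'rV[R]_n := chart_at x @` chart_dom (chart_at x).

Lemma open_chart_at_dom (x : M) : open (chart_dom (chart_at x)).
Proof. exact: open_chart_dom. Qed.

Lemma open_chart_at_im (x : M) : open (chart_im x).
Proof. exact: open_chart_im. Qed.

Lemma chart_invK (x z : M) : chart_dom (chart_at x) z ->
  chart_inv (chart_at x) (chart_at x z) = z.
Proof. by move=> xz; apply: chart_mapK; rewrite inE. Qed.

Lemma chart_inv_dom (x : M) a : chart_im x a -> chart_dom (chart_at x) (chart_inv (chart_at x) a).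
Proof. by case=> z xz <-; rewrite chart_invK. Qed.

Lemma chart_map_invK (x : M) a : chart_im x a -> chart_at x (chart_inv (chart_at x) a) = a.
Proof. by case=> z xz <-; rewrite chart_invK. Qed.

Definition chart_rel_dom (f : M -> M) (x y : M) : set 'rV[R]_n :=
  [set a | chart_im x a /\ chart_dom (chart_at y) (f (chart_inv (chart_at x) a))].

Definition chart_rel (f : M -> M) (x y : M) : 'rV[R]_n -> 'rV[R]_n :=
  chart_at y \o f \o chart_inv (chart_at x).

(** Continuity is what makes the sets [chart_rel_dom f x y] open. *)
Definition C1_map (f : M -> M) := continuous f /\
  forall x y, Ck_on 1 (chart_rel_dom f x y) (chart_rel f x y).

Lemma open_chart_rel_dom (f : M -> M) x y : continuous f -> open (chart_rel_dom f x y).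
Proof.
move=> fc; rewrite openE => a [xa ya]; rewrite /interior.
rewrite (_ : chart_rel_dom f x y = chart_im x `&`
  (f \o chart_inv (chart_at x)) @^-1` chart_dom (chart_at y))//.
apply: nbhs_setI; first exact: (open_nbhs_mem (@open_chart_at_im x) xa).
have ic : {for a, continuous (chart_inv (chart_at x))} by exact: chart_inv_continuous.
apply: (continuous_comp ic (fc _)).
exact: (open_nbhs_mem (@open_chart_at_dom y) ya).
Qed.

(** In charts the identity is the transition map, so changes of chart are treated below as the case
    f = id of statements about C^1 maps. *)
Lemma C1_map_id : C1_map id.
Proof.
split; first by move=> x A.
move=> x y; apply: Ck_on_subset (chart_at_smooth x y 1) => a [[z xz <-]] /=.
by rewrite chart_invK// => yz; exists z.
Qed.

Lemma curve_near_dom (O : set R) (c : R -> M) x t : open O -> curve_C1_on O c -> O t ->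
  chart_dom (chart_at x) (c t) -> \forall s \near t, O s /\ chart_dom (chart_at x) (c s).
Proof.
move=> oO [cc _] Ot xct; apply: filterI; first exact: open_nbhs_nbhs.
by apply: (cc _ Ot); apply: (open_nbhs_mem (@open_chart_at_dom x) _).
Qed.

Lemma derive_C1_map (f : M -> M) (O : set R) (c : R -> M) x y t : C1_map f ->
  open O -> curve_C1_on O c -> O t ->
  chart_dom (chart_at x) (c t) -> chart_dom (chart_at y) (f (c t)) ->
  'D_1 (chart_at y \o (f \o c)) t =
    'D_('D_1 (chart_at x \o c) t) (chart_rel f x y) (chart_at x (c t)).
Proof.
move=> [fc fC] oO cC Ot xct yfct.
have [_ /(_ 1)[cd _]] := cC.2 x.
have := @derive_curve _ _ _ (chart_rel f x y) (chart_rel_dom f x y) (chart_at x \o c) t.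
case=> //.
- exact: open_chart_rel_dom.
- by split; [exists (c t)|rewrite /= chart_invK].
- exact: cd.
move=> _ <-.
have E : \forall s \near t, (chart_at y \o (f \o c)) s = (chart_rel f x y \o (chart_at x \o c)) s.
  apply: filterS (curve_near_dom oO cC Ot xct) => s [_ xcs] /=.
  by rewrite /chart_rel /= chart_invK.
have n1 : (1 : R) != 0 by rewrite oner_eq0.
by apply: near_eq_derive => //; exact: E.
Qed.

Lemma curve_C1_comp (f : M -> M) (O : set R) (c : R -> M) : C1_map f ->
  open O -> curve_C1_on O c -> curve_C1_on O (f \o c).
Proof.
move=> [fc fC] oO cC; split => [t Ot|y].
  by apply: continuous_comp; [exact: cC.1|exact: fc].
(* Near t the curve stays in the domain of the chart at c t, where [f \o c] becomes
   [chart_rel f x y] applied to a C^1 curve of coordinates. *)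
apply: C1_local => t [Ot yfct]; pose x := c t.
have xct := mem_chart_at x.
have oO' : open (O `&` c @^-1` chart_dom (chart_at x)).
  rewrite openE => s [Os xcs]; exact: curve_near_dom cC Os xcs.
have := C1_comp_curve (@open_chart_rel_dom _ x y fc) (fC x y) oO' (cC.2 x).
set O' := (_ `&` _) => C; exists O'.
  split; first by split.
  by split; [exists (c t)|rewrite /= chart_invK].
have oO'' : open O'.
  rewrite openE => s [[Os xcs] Ws]; apply: filterI; first by move: (oO'); rewrite openE; apply; split.
  have cs : {for s, continuous (chart_at x \o c)}.
    by apply: continuous_comp; [exact: cC.1|exact: chart_map_continuous].
  exact: (cs _ (open_nbhs_mem (@open_chart_rel_dom _ x y fc) Ws)).
apply: C1_eq C => // s [[Os xcs] _] /=.
by rewrite /chart_rel /= chart_invK.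
Qed.

End smooth_maps.

Lemma derive_affine (R : realType) (W : normedModType R) (f : R -> W) (e k t v : R) :
  (derivable f (e + t * k) (v * k) -> derivable (fun s : R => f (e + s * k)) t v) /\
  'D_v (fun s : R => f (e + s * k)) t = 'D_(v * k) f (e + t * k).
Proof.
rewrite /derivable /derive /=.
suff -> : (fun h : R => h^-1 *: (f (e + (h *: v + t) * k) - f (e + t * k))) =
   (fun h : R => h^-1 *: (f (h *: (v * k) + (e + t * k)) - f (e + t * k))) by [].
apply/funext => h; congr (_ *: (f _ - _)).
by rewrite /GRing.scale/=; ring.
Qed.

Lemma C1_affine (R : realType) (W : normedModType R) (U : set R) (f : R -> W) (e k : R) :
  Ck_on (V := R^o) 1 U f ->
  Ck_on (V := R^o) 1 ((fun s : R => e + s * k) @^-1` U) (fun s : R => f (e + s * k)).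
Proof.
move=> [fc fd].
have Ac : continuous (fun s : R => e + s * k).
  by move=> s; apply: cvgD; [exact: cvg_cst|apply: cvgM; [exact: cvg_id|exact: cvg_cst]].
split => [t Ut|v].
  exact: (@continuous_comp _ _ _ (fun s : R => e + s * k) f t (Ac t) (fc _ Ut)).
have [d1 [d2 _]] := fd (v * k).
split => [t Ut|]; first by have [H _] := derive_affine f e k t v; exact: H (d1 _ Ut).
split => // t Ut.
have -> : 'D_v (fun s : R => f (e + s * k)) = 'D_(v * k) f \o (fun s : R => e + s * k).
  by apply/funext => s; have [_ ->] := derive_affine f e k s v.
exact: (@continuous_comp _ _ _ (fun s : R => e + s * k) ('D_(v * k) f) t (Ac t) (d2 _ Ut)).
Qed.

Section finsler_length.
Context (R : realType) (n : nat) (M : smoothManifoldType R n) (F : finsler_metric M).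

Lemma fnorm0 x : F x 0 = 0.
Proof. by rewrite -(scale0r 0) fnormZ normr0 mul0r. Qed.

Lemma fnorm_ge0 x v : 0 <= F x v.
Proof.
have := fnorm_triangle F x v (- v); rewrite subrr fnorm0 -scaleN1r fnormZ normrN1 mul1r.
by rewrite -mulr2n pmulrn_lge0.
Qed.

Lemma speed_ge0 c t : 0 <= speed F c t.
Proof. exact: fnorm_ge0. Qed.

Lemma speed_near (c c' : R -> M) t : (\forall s \near t, c s = c' s) ->
  speed F c t = speed F c' t.
Proof.
move=> E; rewrite /speed (nbhs_singleton E) !derive1E; congr (F _ _).
have n1 : (1 : R) != 0 by rewrite oner_eq0.
apply: near_eq_derive => //; apply: filterS E => s /= E.
by rewrite E.
Qed.

Lemma speed_chart (O : set R) (c : R -> M) x t : open O -> curve_C1_on O c -> O t ->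
  chart_dom (chart_at x) (c t) ->
  speed F c t = F (c t) ('D_('D_1 (chart_at x \o c) t) (chart_rel id x (c t)) (chart_at x (c t))).
Proof.
move=> oO cC Ot xct; rewrite /speed derive1E; congr (F _ _).
by apply: (derive_C1_map (C1_map_id M) oO cC Ot xct); exact: mem_chart_at.
Qed.

(** The infinitesimal notion: the differential of f preserves the norms of tangent vectors. Its
    effect on distances is [finsler_dist_isometric]. *)
Definition isometric (f : M -> M) := forall x v,
  F (f x) ('D_v (chart_rel f x (f x)) (chart_at x x)) = F x v.

Lemma speed_isometric (f : M -> M) (O : set R) (c : R -> M) t :
  C1_map f -> isometric f -> open O -> curve_C1_on O c -> O t ->
  speed F (f \o c) t = speed F c t.
Proof.
move=> fC fF oO cC Ot; rewrite /speed !derive1E /=.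
rewrite (derive_C1_map fC oO cC Ot (mem_chart_at (c t)) (mem_chart_at (f (c t)))).
exact: fF.
Qed.

Lemma speed_affine (O : set R) (c : R -> M) (e k t : R) : 0 < k ->
  curve_C1_on O c -> O (e + t * k) ->
  speed F (fun s => c (e + s * k)) t = k * speed F c (e + t * k).
Proof.
move=> k0 [_ cC] Ot; rewrite /speed !derive1E /=.
set p := e + t * k; set x := c p.
have [_ ->] := derive_affine (chart_at x \o c) e k t 1.
have [_ /(_ 1)[/(_ p) d1 _]] := cC x.
have d1' : derivable (chart_at x \o c) p 1.
  by apply: d1; split => //; exact: mem_chart_at.
have [_ H] := derivable_scale k d1'.
have -> : 1 * k = k *: (1 : R) by rewrite /GRing.scale/= mul1r mulr1.
by rewrite H fnormZ gtr0_norm.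
Qed.

End finsler_length.

Section piecewise.
Context (R : realType) (n : nat) (M : smoothManifoldType R n).

(* [piecewise_C1] on an arbitrary, possibly degenerate, interval. *)
Inductive pw (c : R -> M) : R -> R -> Prop :=
| pw_nil a : pw c a a
| pw_cons a b d : a < b -> curve_C1_segment a b c -> pw c b d -> pw c a d.

Lemma pw_le c a b : pw c a b -> a <= b.
Proof. by elim => // {}a {}b d ab _ _ /(le_trans (ltW ab)). Qed.

Lemma pw_seg c a b : a < b -> curve_C1_segment a b c -> pw c a b.
Proof. by move=> ab sab; apply: pw_cons sab _ => //; exact: pw_nil. Qed.

Lemma pw_cat c a b d : pw c a b -> pw c b d -> pw c a d.
Proof. by elim => // {}a x {}b ax sax _ IH /IH; exact: pw_cons. Qed.

Lemma piecewise_C1P c : piecewise_C1 c <-> pw c 0 1.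
Proof.
split.
  move=> [s [sP sC]]; move: sP sC; rewrite /itv_partition.
  move: (0 : R) => a [].
  elim: s a => [|x s IH] a /=; first by move=> _ /eqP -> _; exact: pw_nil.
  move=> /andP[ax xs] l1 H; apply: (pw_cons ax); first exact: (H 0%N).
  by apply: IH => // i si; exact: (H i.+1).
suff H a b : pw c a b -> exists s, itv_partition a b s /\
    forall i, (i < size s)%N -> curve_C1_segment (nth 1 (a :: s) i) (nth 1 (a :: s) i.+1) c.
  by move=> /H[s [s1 s2]]; exists s.
elim => {a b} [a|a b d ab sab _ [s [[s1 s2] s3]]]; first by exists [::]; split => //; split => /=.
exists (b :: s); split; first by split => //=; rewrite ab.
by case.
Qed.

Lemma curve_C1_on_subset (O O' : set R) (c : R -> M) : O' `<=` O ->
  curve_C1_on O c -> curve_C1_on O' c.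
Proof.
move=> OO' [c1 c2]; split => [t /OO'/c1//|x].
by apply: Ck_on_subset (c2 x) => t [/OO' ? ?].
Qed.

Lemma segment_sub a b a' b' (c : R -> M) : a <= a' -> b' <= b ->
  curve_C1_segment a b c -> curve_C1_segment a' b' c.
Proof.
move=> aa bb [e [e0 [c' [c'C cc']]]]; exists e; split => //; exists c'; split.
  apply: curve_C1_on_subset c'C => t /=; rewrite !in_itv/= => /andP[t1 t2].
  by apply/andP; split; lra.
by move=> t; rewrite in_itv/= => /andP[t1 t2]; apply: cc'; rewrite in_itv/=; apply/andP; split; lra.
Qed.

Lemma pw_split c a b t : pw c a b -> a <= t <= b -> pw c a t /\ pw c t b.
Proof.
elim => {a b} [a|a b d ab sab pbd IH] /andP[ta tb].
  have -> : t = a by apply/eqP; rewrite eq_le tb ta.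
  by split; exact: pw_nil.
have [tb'|bt] := ltP t b; last first.
  have [|p1 p2] := IH; first by rewrite bt.
  by split => //; apply: pw_cons p1.
have sat : curve_C1_segment a t c by apply: segment_sub sab => //; exact: ltW.
have stb : curve_C1_segment t b c by apply: segment_sub sab.
split; last exact: pw_cons pbd.
move: ta; rewrite le_eqVlt => /orP[/eqP <-|ta]; [exact: pw_nil|exact: pw_seg].
Qed.

Lemma segment_eq a b (c c' : R -> M) : {in `[a, b], c =1 c'} ->
  curve_C1_segment a b c -> curve_C1_segment a b c'.
Proof.
move=> cc' [e [e0 [d [dC cd]]]]; exists e; split => //; exists d; split => // t tab.
by rewrite -cc'// cd.
Qed.

Lemma pw_eq a b (c c' : R -> M) : {in `[a, b], c =1 c'} -> pw c a b -> pw c' a b.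
Proof.
move=> + pc; elim: pc => {a b} [a|a b d ab sab pbd IH] H; first exact: pw_nil.
have bd := pw_le pbd.
apply: (pw_cons ab).
  apply: segment_eq sab => t; rewrite in_itv/= => /andP[t1 t2].
  by apply: H; rewrite in_itv/= t1/=; exact: le_trans bd.
apply: IH => t; rewrite in_itv/= => /andP[t1 t2]; apply: H.
by rewrite in_itv/= t2 andbT (le_trans _ t1)// ltW.
Qed.

Lemma pw_map (f : M -> M) a b c : C1_map f -> pw c a b -> pw (f \o c) a b.
Proof.
move=> fC; elim => {a b} [a|a b d ab [e [e0 [c' [c'C cc']]]] _]; first exact: pw_nil.
apply: pw_cons ab _; exists e; split => //; exists (f \o c'); split.
  exact: curve_C1_comp c'C.
by move=> t /cc' /= ->.
Qed.

Lemma curve_C1_affine (O : set R) (c : R -> M) (e k : R) :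
  curve_C1_on O c ->
  curve_C1_on ((fun s => e + s * k) @^-1` O) (fun s => c (e + s * k)).
Proof.
move=> [cc cC].
have Ac : continuous (fun s : R => e + s * k).
  by move=> s; apply: cvgD; [exact: cvg_cst|apply: cvgM; [exact: cvg_id|exact: cvg_cst]].
split => [t Ot|x].
  exact: (@continuous_comp _ _ _ (fun s : R => e + s * k) c t (Ac t) (cc _ Ot)).
exact: (C1_affine e k (cC x)).
Qed.

Lemma pw_affine c a b e k : 0 < k -> pw c a b ->
  pw (fun s => c (e + s * k)) ((a - e) / k) ((b - e) / k).
Proof.
move=> k0; elim => {a b} [a|a b d ab [r [r0 [c' [c'C cc']]]] _ IH]; first exact: pw_nil.
apply: pw_cons IH; first by rewrite ltr_pM2r ?invr_gt0// ltrD2r.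
exists (r / k); split; first by rewrite divr_gt0.
exists (fun s => c' (e + s * k)); split.
  apply: curve_C1_on_subset (curve_C1_affine e k c'C) => t /=.
  rewrite !in_itv/= -mulrBl -mulrDl ltr_pdivrMr// ltr_pdivlMr// => /andP[t1 t2].
  by apply/andP; split; lra.
move=> t; rewrite in_itv/= ler_pdivrMr// ler_pdivlMr// => /andP[t1 t2].
by apply: cc'; rewrite in_itv/=; apply/andP; split; lra.
Qed.

Lemma continuous_segment (c : R -> M) (a b : R) : curve_C1_segment a b c -> {within `[a, b], continuous c}.
Proof.
move=> [e [e0 [c' [[c'c _] cc']]]].
apply: (@subspace_eq_continuous _ _ _ c'); last first.
  apply: continuous_in_subspaceT => t; rewrite inE/= in_itv/= => /andP[t1 t2].
  by apply: c'c; rewrite /= in_itv/=; apply/andP; split; lra.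
by move=> t; rewrite inE/= => tab; rewrite /from_subspace/= cc'.
Qed.

Lemma continuous_pw (c : R -> M) (a b : R) : pw c a b -> {within `[a, b], continuous c}.
Proof.
elim => {a b} [a|a b d ab sab pbd IH].
  by rewrite set_itv1; exact: continuous_subspace1.
have bd := pw_le pbd.
rewrite (_ : `[a, d]%classic = `[a, b] `|` `[b, d]).
  apply: withinU_continuous => //; [exact: interval_closed..|].
  exact: continuous_segment.
apply/seteqP; split => t /=; rewrite !in_itv/=.
  by move=> /andP[t1 t2]; case: (leP t b) => tb; [left|right]; rewrite ?t1 ?t2//= ltW.
by move=> [|] /andP[t1 t2]; apply/andP; split; lra.
Qed.

End piecewise.

Section length.
Context (R : realType) (n : nat) (M : smoothManifoldType R n) (F : finsler_metric M).
Local Open Scope ereal_scope.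
Local Notation mu := (@lebesgue_measure R).

(** The interval is open because the derivative at an end point would also depend on c outside the
    interval. On the open interval, c can be replaced by the C^1 extension of each of its pieces
    ([len_eq]). *)
Definition len (c : R -> M) (a b : R) : \bar R :=
  \int[mu]_(t in `]a, b[%classic) (speed F c t)%:E.

Lemma speed_ge0E c t : 0 <= (speed F c t)%:E.
Proof. by rewrite lee_fin speed_ge0. Qed.

Lemma len_ge0 c a b : 0 <= len c a b.
Proof. by apply: integral_ge0 => t _; exact: speed_ge0E. Qed.

Lemma lenxx c a : len c a a = 0.
Proof. by rewrite /len set_itvoo0 integral_set0. Qed.

Lemma len_split c a b d : (a <= b)%R -> (b <= d)%R -> len c a d = len c a b + len c b d.
Proof.
rewrite le_eqVlt => /predU1P[->|ab]; first by rewrite lenxx add0e.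
rewrite le_eqVlt => /predU1P[->|bd]; first by rewrite lenxx adde0.
rewrite /len (_ : `]a, d[%classic = `]a, b[ `|` ([set b] `|` `]b, d[)); last first.
  apply/seteqP; split => t /=; rewrite !in_itv/=.
    move=> /andP[t1 t2]; case: (ltgtP t b) => tb; [left|right;right|right;left] => //; by rewrite ?t1 ?t2.
  by move=> [|[->|]]; [|by rewrite ab|]; move=> /andP[t1 t2]; apply/andP; split; lra.
rewrite integral_setU_gen//.
- by rewrite integral_setU_gen// ?integral_set1 ?add0e//; 
    [apply/disj_setPS => t /= [->]; rewrite in_itv/= ltxx|move=> *; exact: speed_ge0E].
- exact: measurableU.
- by apply/disj_setPS => t /= []; rewrite !in_itv/= => /andP[t1 t2] [tb|/andP[t3 t4]]; lra.
- by move=> *; exact: speed_ge0E.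
Qed.

Lemma len_eq (c c' : R -> M) a b : {in `]a, b[, c =1 c'} -> len c a b = len c' a b.
Proof.
move=> cc'; apply: eq_integral => t; rewrite inE/= => tab; congr EFin.
apply: speed_near; near=> s; apply: cc'.
by near: s; apply: near_in_itvoo.
Unshelve. all: by end_near. Qed.

Lemma len_isometric (f : M -> M) a b c : C1_map f -> isometric F f ->
  pw c a b -> len (f \o c) a b = len c a b.
Proof.
move=> fC fF; elim => {a b} [a|a b d ab [e [e0 [c' [c'C cc']]]] pbd IH]; first by rewrite !lenxx.
rewrite (len_split (f \o c) (ltW ab) (pw_le pbd)) (len_split c (ltW ab) (pw_le pbd)) IH.
suff -> : len (f \o c) a b = len c a b by reflexivity.
have cc'o : {in `]a, b[, c =1 c'} by move=> t tab; apply: cc'; exact: subset_itv_oo_cc tab.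
have fcc'o : {in `]a, b[, f \o c =1 f \o c'} by move=> t tab /=; rewrite cc'o.
rewrite (len_eq cc'o) (len_eq fcc'o) /len; apply: eq_integral => t.
rewrite inE/= in_itv/= => /andP[t1 t2].
have oI : open `](a - e)%R, (b + e)%R[%classic by exact: interval_open.
have tI : `](a - e)%R, (b + e)%R[%classic t by rewrite /= in_itv/=; apply/andP; split; lra.
by rewrite (speed_isometric fC fF oI c'C tI).
Qed.

Lemma len_affine a b c (e k : R) : (0 < k)%R -> pw c a b ->
  len (fun s => c (e + s * k)%R) ((a - e) / k)%R ((b - e) / k)%R <= len c a b.
Proof.
move=> k0; elim => {a b} [a|a b d ab [r [r0 [c' [c'C cc']]]] pbd IH]; first by rewrite !lenxx.
have k0' : (0 < k^-1)%R by rewrite invr_gt0.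
have abk : ((a - e) / k < (b - e) / k)%R by rewrite ltr_pM2r// ltrD2r.
have bd := pw_le pbd.
have bdk : ((b - e) / k <= (d - e) / k)%R by rewrite ler_pM2r// lerD2r.
rewrite (len_split _ (ltW abk) bdk) (len_split c (ltW ab) bd).
apply: leeD; last exact: IH.
move=> {IH}.
have cc'o : {in `]a, b[, c =1 c'} by move=> t tab; apply: cc'; exact: subset_itv_oo_cc tab.
pose A s := (e + s * k)%R.
have Acc'o : {in `]((a - e) / k)%R, ((b - e) / k)%R[, c \o A =1 c' \o A}.
  move=> t; rewrite in_itv/= ltr_pdivrMr// ltr_pdivlMr// => /andP[t1 t2] /=.
  by apply: cc'o; rewrite in_itv/= /A; apply/andP; split; lra.
rewrite (len_eq cc'o) -/(c \o A) (len_eq Acc'o).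
apply: (@le_integral_image _ _ _ mu (fun t : R => (t - e) / k)%R _ _ _ _ k) => //.
- by apply: measurable_funM => //; exact: measurable_funB.
- by move=> B mB; exact: lebesgue_measure_affine.
- by move=> *; exact: speed_ge0E.
- by move=> *; exact: speed_ge0E.
move=> t /=; rewrite !in_itv/= !ltr_pM2r// !ltrD2r => tab; split => //.
rewrite -EFinM lee_fin.
have At : (e + (t - e) / k * k = t)%R by rewrite divfK ?gt_eqF// addrC subrK.
rewrite (speed_affine F k0 c'C); rewrite At//= in_itv/=.
by case/andP : tab => t1 t2; apply/andP; split; lra.
Qed.

End length.

(** * The Finsler distance *)

Section finsler_dist_theory.
Context (R : realType) (n : nat) (M : smoothManifoldType R n) (F : finsler_metric M).
Local Open Scope ereal_scope.
Local Notation mu := (@lebesgue_measure R).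

Lemma derive_line_id (a v : 'rV[R]_n) (t u : R) :
  derivable (fun s : R => a + s *: v)%R t u /\ 'D_u (fun s : R => a + s *: v)%R t = (u *: v)%R.
Proof.
have H0 : derivable (@id 'rV[R]_n) (a + t *: v)%R v by exact: derivable_id.
have [H1 H2] := @derivable_line R _ _ (@id 'rV[R]_n) a v t H0.
have uE : u = (u *: (1 : R))%R by rewrite /GRing.scale/= mulr1.
have [H3 H4] := derivable_scale u H1; rewrite -uE in H3 H4; split; first exact: H3.
rewrite [LHS]H4; congr (_ *: _)%R; rewrite [LHS]H2; exact: derive_id.
Qed.

Lemma C1_line (a v : 'rV[R]_n) (O : set R) :
  Ck_on (V := R^o) 1 O (fun t : R => a + t *: v)%R.
Proof.
split => [t _|u].
  apply: cvgD; first exact: cvg_cst.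
  apply: cvgZ; [exact: cvg_id|exact: cvg_cst].
split => [t _|]; first by have [] := derive_line_id a v t u.
split => // t _.
have -> : 'D_u (fun s : R => a + s *: v)%R = cst (u *: v)%R.
  by apply/funext => s; have [_ ->] := derive_line_id a v s u.
exact: cvg_cst.
Qed.

Lemma curve_C1_line (x : M) (a v : 'rV[R]_n) (O : set R) : open O ->
  (forall t, O t -> chart_im x (a + t *: v)%R) ->
  curve_C1_on O (fun t => chart_inv (chart_at x) (a + t *: v)%R).
Proof.
move=> oO H; have lC := C1_line a v O; split.
  move=> t Ot; have lt : {for t, continuous (fun t : R => a + t *: v)%R} by exact: lC.1 Ot.
  apply: (@continuous_comp _ _ _ (fun t : R => a + t *: v)%R (chart_inv (chart_at x)) t lt).
  by apply: chart_inv_continuous; exact: H.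
move=> y.
have idc : continuous (@id M) by move=> z A.
have := C1_comp_curve (@open_chart_rel_dom _ _ _ id x y idc) ((C1_map_id M).2 x y) oO lC.
apply: Ck_on_subset => t [Ot yt]; split => //; split => //; exact: H.
Qed.

Lemma finsler_lengthE (c : R -> M) : finsler_length F c = len F c 0 1.
Proof.
rewrite /finsler_length /len.
rewrite (_ : `[0%R, 1%R]%classic = `]0%R, 1%R[ `|` ([set 0%R] `|` [set 1%R])); last first.
  apply/seteqP; split => t /=; rewrite !in_itv/=.
    move=> /andP[]; rewrite le_eqVlt => /predU1P[<- _|t0]; first by right; left.
    rewrite le_eqVlt => /predU1P[->|t1]; first by right; right.
    by left; rewrite t0.
  by move=> [/andP[t0 t1]|[|] ->]; rewrite ?lexx ?ler01// !ltW.
rewrite integral_setU_gen//; last 3 first.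
- exact: measurableU.
- by apply/disj_setPS => t /= []; rewrite in_itv/= => /andP[t1 t2] [] E; move: t1 t2; rewrite E ltxx.
- by move=> *; exact: speed_ge0E.
rewrite integral_setU_gen ?integral_set1 ?add0e ?adde0//.
  by apply/disj_setPS => t /= [-> /esym/eqP]; rewrite oner_eq0.
by move=> *; exact: speed_ge0E.
Qed.

Lemma finsler_dist_ge0 x y : 0 <= finsler_dist F x y.
Proof.
by apply: le_ereal_inf_tmp => _ [c _ <-]; rewrite finsler_lengthE len_ge0.
Qed.

Lemma finsler_dist_xx x : finsler_dist F x x = 0.
Proof.
apply/eqP; rewrite eq_le finsler_dist_ge0 andbT.
have -> : 0 = len F (fun _ => x) 0 1.
  rewrite /len integral0_eq// => t _; congr EFin; rewrite /speed.
  have -> : chart_at x \o (fun _ : R => x) = cst (chart_at x x) by [].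
  by rewrite derive1E derive_cst fnorm0.
rewrite -finsler_lengthE; apply: ereal_inf_lbound; exists (fun _ => x) => //.
split => //; apply/piecewise_C1P; apply: pw_seg => //.
exists 1%R; split => //; exists (fun _ => x); split => //.
have oI : open `](0 - 1)%R, (1 + 1 : R)%R[%classic by exact: interval_open.
have := @curve_C1_line x (chart_at x x) 0%R _ oI.
have xE : (fun t : R => chart_inv (chart_at x) (chart_at x x + t *: 0)%R) = (fun _ => x).
  by apply/funext => t; rewrite scaler0 addr0 chart_invK//; exact: mem_chart_at.
rewrite xE; apply => //.
by move=> t _; rewrite scaler0 addr0; exists x => //; exact: mem_chart_at.
Qed.

Lemma finsler_dist_le_len (c : R -> M) a b : pw c a b -> finsler_dist F (c a) (c b) <= len F c a b.
Proof.
move=> pc; have := pw_le pc; rewrite le_eqVlt => /predU1P[->|ab].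
  by rewrite finsler_dist_xx len_ge0.
have k0 : (0 < b - a)%R by rewrite subr_gt0.
have := len_affine F a k0 pc; have := pw_affine a k0 pc.
rewrite subrr mul0r divff ?gt_eqF// => pc'; apply: le_trans.
rewrite -finsler_lengthE; apply: ereal_inf_lbound; exists (fun s => c (a + s * (b - a))%R) => //.
split; first exact/piecewise_C1P.
  by rewrite mul0r addr0.
by rewrite mul1r addrC subrK.
Qed.

Lemma finsler_dist_lt x y r : finsler_dist F x y < r ->
  exists c, [/\ pw c 0 1, c 0%R = x, c 1%R = y & len F c 0 1 < r].
Proof.
move=> /ereal_inf_lt[_ [c [cC c0 c1] <-] cr]; exists c; split => //.
  exact/piecewise_C1P.
by rewrite -finsler_lengthE.
Qed.

Lemma finsler_dist_triangle y x z :
  finsler_dist F x z <= finsler_dist F x y + finsler_dist F y z.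
Proof.
have [->|xy] := eqVneq (finsler_dist F x y) +oo.
  by rewrite addye ?leey// -ltNye (lt_le_trans _ (finsler_dist_ge0 _ _)).
have [->|yz] := eqVneq (finsler_dist F y z) +oo.
  by rewrite addey ?leey// -ltNye (lt_le_trans _ (finsler_dist_ge0 _ _)).
have xyf : finsler_dist F x y \is a fin_num by rewrite ge0_fin_numE ?finsler_dist_ge0// ltey.
have yzf : finsler_dist F y z \is a fin_num by rewrite ge0_fin_numE ?finsler_dist_ge0// ltey.
apply/lee_addgt0Pr => e e0; have e2 : (0 < e / 2)%R by rewrite divr_gt0.
have [|c1 [p1 c10 c11 l1]] := @finsler_dist_lt x y (finsler_dist F x y + (e / 2)%:E).
  by rewrite lteDl// lte_fin.
have [|c2 [p2 c20 c21 l2]] := @finsler_dist_lt y z (finsler_dist F y z + (e / 2)%:E).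
  by rewrite lteDl// lte_fin.
(* The second curve is delayed to [1, 2], and the two are glued at time 1; the result can stay on
   [0, 2], as [finsler_dist_le_len] holds on every interval. *)
pose c2' := fun s : R => c2 (- 1 + s * 1)%R.
have p2' := pw_affine (-1) ltr01 p2; have l2' := len_affine F (-1) ltr01 p2.
have E0 : ((0 - -1) / 1 = 1 :> R)%R by rewrite divr1 opprK add0r.
have E1 : ((1 - -1) / 1 = 2 :> R)%R by rewrite divr1 opprK.
rewrite E0 E1 in p2' l2'.
pose c (t : R) := if (t <= 1)%R then c1 t else c2' t.
have cc1 : {in `[0%R, 1%R], c1 =1 c} by move=> t; rewrite in_itv/= /c => /andP[_ ->].
have cc2 : {in `[1%R, 2%R], c2' =1 c}.
  move=> t; rewrite in_itv/= /c => /andP[t1 _]; case: ifPn => // t1'.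
  have -> : t = 1%R by apply/eqP; rewrite eq_le t1 t1'.
  by rewrite c11 /c2' mulr1 addNr c20.
have pc1 := pw_eq cc1 p1; have pc2 := pw_eq cc2 p2'.
have pc := pw_cat pc1 pc2.
have := finsler_dist_le_len pc.
have -> : c 0%R = x by rewrite -cc1 ?c10// in_itv/= lexx ler01.
have -> : c 2%R = z by rewrite -cc2 ?in_itv/= ?lexx ?ler1n// /c2' mulr1 (_ : - 1 + 2 = 1)%R//; lra.
move=> /le_trans; apply.
have le12 : (1 <= 2 :> R)%R by rewrite ler1n.
rewrite (len_split F c ler01 le12).
have L1 : len F c 0 1 <= finsler_dist F x y + (e / 2)%:E.
  have cc1o : {in `]0%R, 1%R[, c1 =1 c} by move=> t t01; apply: cc1; exact: subset_itv_oo_cc t01.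
  by rewrite -(len_eq F cc1o) ltW.
have L2 : len F c 1 2 <= finsler_dist F y z + (e / 2)%:E.
  have cc2o : {in `]1%R, 2%R[, c2' =1 c} by move=> t t01; apply: cc2; exact: subset_itv_oo_cc t01.
  by rewrite -(len_eq F cc2o); exact: le_trans l2' (ltW l2).
rewrite (_ : finsler_dist F x y + finsler_dist F y z + e%:E =
  (finsler_dist F x y + (e / 2)%:E) + (finsler_dist F y z + (e / 2)%:E)).
  exact: leeD L1 L2.
by rewrite addeACA -EFinD -splitr.
Qed.

Lemma finsler_dist_isometric (f : M -> M) x y : C1_map f -> isometric F f ->
  finsler_dist F (f x) (f y) <= finsler_dist F x y.
Proof.
move=> fC fF; apply: le_ereal_inf_tmp => _ [c [/piecewise_C1P cC <- <-] <-].
rewrite finsler_lengthE -(len_isometric fC fF cC).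
exact: (finsler_dist_le_len (pw_map fC cC)).
Qed.

End finsler_dist_theory.

Lemma derive_partial (R : realType) (V1 V2 W : normedModType R) (f : V1 * V2 -> W) (a : V1) (b v : V2) :
  (derivable f (a, b) (0, v) -> derivable (fun y => f (a, y)) b v) /\
  'D_v (fun y => f (a, y)) b = 'D_(0, v) f (a, b).
Proof.
rewrite /derivable /derive /=.
suff -> : (fun h : R => h^-1 *: (f (a, h *: v + b) - f (a, b))) =
   (fun h : R => h^-1 *: (f (h *: (0, v) + (a, b)) - f (a, b))) by [].
apply/funext => h; congr (_ *: (f _ - _)).
by apply: injective_projections; rewrite //= scaler0 add0r.
Qed.

Lemma C1_partial (R : realType) (V1 V2 W : normedModType R) (D : set (V1 * V2))
    (f : V1 * V2 -> W) (a : V1) :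
  Ck_on 1 D f -> Ck_on 1 [set b | D (a, b)] (fun b => f (a, b)).
Proof.
move=> [fc fd].
have ac (b : V2) : {for b, continuous (fun y : V2 => (a, y))}.
  by apply: cvg_pair; [exact: cvg_cst|exact: cvg_id].
split => [b Db|v].
  exact: (@continuous_comp _ _ _ (fun y : V2 => (a, y)) f b (ac b) (fc _ Db)).
have [d1 [d2 _]] := fd (0, v); split => [b Db|].
  by have [H _] := derive_partial f a b v; exact: H (d1 _ Db).
split => // b Db.
have -> : 'D_v (fun y => f (a, y)) = 'D_(0, v) f \o (fun y : V2 => (a, y)).
  by apply/funext => y; have [_ ->] := derive_partial f a y v.
exact: (@continuous_comp _ _ _ (fun y : V2 => (a, y)) ('D_(0, v) f) b (ac b) (d2 _ Db)).
Qed.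

(** * Left translations are isometries *)

Section left_translation.
Context (R : realType) (n : nat) (G : lieGroupType R n) (F : finsler_metric G).

Lemma continuous_mulg_l (a : G) : continuous (fun y : G => (a * y)%g).
Proof.
move=> y; apply: (@continuous_comp _ _ _ (fun y : G => (a, y)) (fun xy : G * G => (xy.1 * xy.2)%g)).
  by apply: cvg_pair; [exact: cvg_cst|exact: cvg_id].
exact: mulg_continuous.
Qed.

Lemma C1_map_mulg (a : G) : C1_map (fun y : G => (a * y)%g).
Proof.
split; first exact: continuous_mulg_l.
move=> x y.
(* The translation is the multiplication with its first argument frozen at a, read in the chart
   around a; the final 1 is the order of differentiability. *)
have := C1_partial (chart_at a a) (mulg_smooth a x y 1).
have aa := mem_chart_at a.
have -> : chart_rel (fun y : G => (a * y)%g) x y =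
  (fun b => (chart_at y \o (fun ab => (chart_inv (chart_at a) ab.1 * chart_inv (chart_at x) ab.2)%g)) (chart_at a a, b)).
  by apply/funext => b; rewrite /chart_rel /= chart_invK.
apply: Ck_on_subset => b [xb yb]; split => //=; first by exists a.
by rewrite chart_invK.
Qed.

Lemma isometric_mulg (a : G) : left_invariant F -> isometric F (fun y : G => (a * y)%g).
Proof. by move=> lF x v; exact: lF. Qed.

Lemma finsler_dist_mulg (a x y : G) : left_invariant F ->
  finsler_dist F (a * x)%g (a * y)%g = finsler_dist F x y.
Proof.
move=> lF; apply/eqP; rewrite eq_le; apply/andP; split.
  exact: (finsler_dist_isometric _ _ (C1_map_mulg a) (isometric_mulg a lF)).
have := finsler_dist_isometric (a * x)%g (a * y)%g (C1_map_mulg a^-1%g) (isometric_mulg a^-1%g lF).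
by rewrite !mulKg.
Qed.

End left_translation.

(** * Comparison of the distance with a chart *)

Section local_geometry.
Context (R : realType) (n : nat) (M : smoothManifoldType R n) (F : finsler_metric M) (x0 : M).
Local Notation phi := (chart_at x0).
Local Notation psi := (chart_inv (chart_at x0)).
Local Notation p0 := (chart_at x0 x0).
Local Notation mu := (@lebesgue_measure R).

(* The norm at y of the vector with coordinates w in the chart at x0. *)
Definition chart_fnorm (y : M) (w : 'rV[R]_n) : R :=
  F y ('D_w (chart_rel id x0 y) (phi y)).

Lemma chart_fnorm_near (w : 'rV[R]_n) (y : M) (P : set R) : chart_dom phi y ->
  nbhs (chart_fnorm y w) P ->
  exists A B, [/\ nbhs y A, nbhs w B & forall z v, A z -> B v -> P (chart_fnorm z v)].
Proof.
move=> yd nP; have Fc := @fnorm_continuous _ _ _ F x0 (y, w) yd.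
have := Fc _ nP; move=> [[A B] /= [nA nB] AB].
by exists A, B; split => // z v Az Bv; exact: (AB (z, v)).
Qed.

Lemma chart_rel_id_dom y : chart_dom phi y -> chart_rel_dom id x0 y (phi y).
Proof.
by move=> yd; split; [exists y|rewrite chart_invK//; exact: mem_chart_at].
Qed.

Lemma chart_fnormZ y w (s : R) : chart_dom phi y ->
  chart_fnorm y (s *: w) = `|s| * chart_fnorm y w.
Proof.
move=> yd; rewrite /chart_fnorm.
have [_ /(_ w)[d _]] := (C1_map_id M).2 x0 y.
by have [_ ->] := derivable_scale s (d _ (chart_rel_id_dom yd)); rewrite fnormZ.
Qed.

Lemma chart_fnorm_base w : chart_fnorm x0 w = F x0 w.
Proof.
rewrite /chart_fnorm; congr (F _ _).
have [->|w0] := eqVneq w 0; first by rewrite derive0.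
rewrite -[RHS](derive_id (p0) w); apply: near_eq_derive => //.
have im0 : chart_im x0 p0 by exists x0 => //; exact: mem_chart_at.
apply: filterS (open_nbhs_mem (@open_chart_at_im _ _ _ x0) im0) => a xa.
by rewrite /chart_rel/= chart_map_invK.
Qed.

Lemma near_chart_inv (A : set M) : nbhs x0 A ->
  exists2 d : R, 0 < d & forall a, ball p0 d a -> chart_im x0 a /\ A (psi a).
Proof.
move=> nA; have im0 : chart_im x0 p0 by exists x0 => //; exact: mem_chart_at.
have ic : {for p0, continuous psi} by exact: chart_inv_continuous.
have nA' : nbhs p0 (psi @^-1` A).
  by apply: ic; rewrite chart_invK//; exact: mem_chart_at.
have /nbhs_ballP[d d0 dP] := nbhs_setI (open_nbhs_mem (@open_chart_at_im _ _ _ x0) im0) nA'.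
by exists d => // a /dP.
Qed.

(** By continuity at (x0, 0), the norm is less than 1 for points near x0 and |w| < e. Scaling an
    arbitrary w to length e / 2 gives L = 2 / e. *)
Lemma chart_fnorm_ub : exists d L : R, [/\ 0 < d, 0 < L &
  forall a, ball p0 d a -> chart_im x0 a /\ forall w, chart_fnorm (psi a) w <= L * `|w|].
Proof.
have [|A [B [nA nB AB]]] := @chart_fnorm_near 0 x0 [set r | r < 1] (mem_chart_at x0).
  rewrite chart_fnorm_base fnorm0; exact: (open_nbhs_mem (@open_lt _ 1) ltr01).
have [d d0 dA] := near_chart_inv nA.
have /nbhs_ballP[e /= e0 eB] := nB.
exists d, (2 / e); split => //; first by rewrite divr_gt0.
move=> a /dA[ia Aa]; split => // w.
have [->|w0] := eqVneq w 0.
  by rewrite /chart_fnorm derive0 fnorm0 normr0 mulr0.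
have wp : 0 < `|w| by rewrite normr_gt0.
have e2 : 0 < e / (2 * `|w|) by rewrite divr_gt0// mulr_gt0.
have := AB (psi a) ((e / (2 * `|w|)) *: w) Aa; rewrite chart_fnormZ; last exact: chart_inv_dom.
have Bw : B ((e / (2 * `|w|)) *: w).
  apply: eB; rewrite mx_norm_ball /ball_ /= sub0r normrN normrZ gtr0_norm//.
  have -> : e / (2 * `|w|) * `|w| = e / 2 by field; rewrite gt_eqF.
  by rewrite ltr_pdivrMr// ltr_pMr// ltr1n.
move=> /(_ Bw) /=; rewrite gtr0_norm// => H.
rewrite -(ler_pM2l e2); apply: le_trans (ltW H) _.
by rewrite le_eqVlt; apply/orP; left; apply/eqP; field; rewrite !gt_eqF.
Qed.

(** At x0 the norm is positive on the unit sphere of coordinates, which is compact. Positivity with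
    a margin persists near each pair (x0, w), so compactness gives one constant for all
    directions. *)
Lemma chart_fnorm_lb : exists d k : R, [/\ 0 < d, 0 < k &
  forall a, ball p0 d a -> chart_im x0 a /\ forall w, k * `|w| <= chart_fnorm (psi a) w].
Proof.
have cS : compact [set w : 'rV[R]_n | `|w| = 1].
  apply: bounded_closed_compact.
    exists 1; split; first exact: num_real.
    by move=> y y1 w /= ->; exact: ltW.
  have -> : [set w : 'rV[R]_n | `|w| = 1] = (@Num.norm _ 'rV[R]_n) @^-1` [set 1] by [].
  by apply: closed_comp; [move=> w _; exact: norm_continuous|exact: closed_eq].
(* The parameter is a pair (y, k) near (x0, 0), so one covering argument provides both the
   neighbourhood of x0 and the constant k. *)
have /compact_near_coveringP/(_ (M * R)%type (filter_prod (nbhs x0) (nbhs (0 : R)))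
   (fun yk w => yk.2 < chart_fnorm yk.1 w) _) := cS.
case.
  move=> w /= w1.
  have c0 : 0 < chart_fnorm x0 w.
    rewrite chart_fnorm_base lt_neqAle fnorm_ge0 andbT eq_sym; apply/eqP => /fnorm_eq0 w0.
    by move: w1; rewrite w0 normr0 => /esym/eqP; rewrite oner_eq0.
  have c2 : chart_fnorm x0 w / 2 < chart_fnorm x0 w by rewrite ltr_pdivrMr// ltr_pMr// ltr1n.
  have [|A [B [nA nB AB]]] := @chart_fnorm_near w x0 [set r | chart_fnorm x0 w / 2 < r] (mem_chart_at x0).
    exact: (open_nbhs_mem (@open_gt _ _) c2).
  exists (B, A `*` [set k | k < chart_fnorm x0 w / 2]) => /=.
    split => //; exists (A, [set k | k < chart_fnorm x0 w / 2]) => //=; split => //.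
    by apply: (open_nbhs_mem (@open_lt _ _)); rewrite /= divr_gt0.
  move=> [v [z k]] /= [Bv [Az kc]]; exact: lt_trans kc (AB _ _ Az Bv).
move=> [A K] /= [nA nK] AK.
have [d d0 dA] := near_chart_inv nA.
have /nbhs_ballP[e /= e0 eK] := nK.
exists d, (e / 2); split => //; first by rewrite divr_gt0.
move=> a /dA[ia Aa]; split => // w.
have [->|w0] := eqVneq w 0; first by rewrite normr0 mulr0 fnorm_ge0.
have wp : 0 < `|w| by rewrite normr_gt0.
have Ke : K (e / 2).
  by apply: eK; rewrite /ball /= sub0r normrN gtr0_norm ?divr_gt0// ltr_pdivrMr// ltr_pMr// ltr1n.
have := AK (psi a, e / 2) (conj Aa Ke) (`|w|^-1 *: w) => /=.
rewrite normrZ normfV normr_id mulVf ?gt_eqF// => /(_ erefl).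
rewrite chart_fnormZ; last exact: chart_inv_dom.
by rewrite normfV normr_id ltr_pdivlMl// mulrC => /ltW.
Qed.

Lemma ball_rVE (a b : 'rV[R]_n) r : ball a r b = (`|a - b| < r) :> Prop.
Proof. by rewrite mx_norm_ball. Qed.

Lemma finsler_dist_chart_ub : exists d L : R, [/\ 0 < d, 0 < L &
  forall a b, ball p0 d a -> ball p0 d b ->
    (finsler_dist F (psi a) (psi b) <= (L * `|b - a|)%:E)%E].
Proof.
have [d [L [d0 L0 dL]]] := chart_fnorm_ub.
(* The curve must be C^1 on a neighbourhood of [0, 1], so the segment is prolonged to times in ]-1,
   2[. It then stays within d / 8 + 2 (d / 8 + d / 8) < d of p0. *)
exists (d / 8), L; split => //; first by rewrite divr_gt0.
move=> a b; rewrite !ball_rVE => pa pb.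
move: (a : 'rV[R]_n) (b : 'rV[R]_n) pa pb => {}a {}b pa pb.
pose l := fun t : R => a + t *: (b - a).
pose c := fun t : R => psi (l t).
have lb (t : R) : -1 < t < 2 -> ball p0 d (l t).
  move=> t12; rewrite ball_rVE /l opprD addrA.
  have h1 : `|p0 - a - t *: (b - a)| <= `|p0 - a| + `|t| * `|b - a|.
    by rewrite -normrZ; exact: ler_normB.
  have h2 : `|b - a| <= `|p0 - a| + `|p0 - b|.
    have -> : b - a = (p0 - a) - (p0 - b) by rewrite opprB [RHS]addrC addrA subrK.
    exact: ler_normB.
  have h3 : `|t| <= 2 by rewrite ler_norml; lra.
  apply: (le_lt_trans h1).
  have h4 : `|t| * `|b - a| <= 2 * (`|p0 - a| + `|p0 - b|) by apply: ler_pM.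
  by lra.
have oO : open `](0 - 1), (1 + 1 : R)[%classic by exact: interval_open.
have lO (t : R) : `](0 - 1), (1 + 1 : R)[%classic t -> ball p0 d (l t).
  by rewrite /= in_itv/= => t12; apply: lb; lra.
have cC : curve_C1_on `](0 - 1), (1 + 1 : R)[%classic c.
  by apply: curve_C1_line => // t /lO /dL [].
have pc : pw c 0 1.
  by apply: pw_seg => //; exists 1; split => //; exists c; split.
have := finsler_dist_le_len F pc; rewrite /c /l scale0r addr0 scale1r addrC subrK.
move=> /le_trans; apply.
have -> : (L * `|b - a|)%:E = ((L * `|b - a|)%:E * mu `]0%R, 1%R[%classic)%E.
  by rewrite lebesgue_measure_itv/= lte_fin ltr01 sube0 mule1.
apply: ge0_le_integral_cst => //.
- by rewrite mulr_ge0// ltW.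
- by move=> t _; exact: speed_ge0E.
move=> t /=; rewrite in_itv/= => /andP[t0 t1]; rewrite lee_fin.
have Ot : `](0 - 1), (1 + 1 : R)[%classic t by rewrite /= in_itv/=; lra.
have [ilt lL] := dL _ (lO _ Ot).
rewrite (@speed_chart _ _ _ F _ c x0 t oO cC Ot); last exact: chart_inv_dom.
have -> : 'D_1 (phi \o c) t = b - a.
  have n1 : (1 : R) != 0 by rewrite oner_eq0.
  have [_ H] := derive_line_id a (b - a) t 1.
  rewrite scale1r in H; rewrite -H; apply: near_eq_derive => //.
  apply: filterS (open_nbhs_mem oO Ot) => s Os /=.
  by rewrite /c chart_map_invK//; have [] := dL _ (lO _ Os).
exact: lL.
Qed.

(** The first alternative is the only one for n = 0, where there are no coordinates. *)
Lemma rV_norm_attained (v : 'rV[R]_n) : `|v| = 0 \/ exists i, `|v| = `|v 0 i|.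
Proof.
have [v0|v0] := eqVneq `|v| 0; first by left.
right; have [[i j] E] := mx_norm_neq0 v0; exists j.
by rewrite [LHS]E /= ord1.
Qed.

(** * Curves that stay in the chart, and short curves do stay *)

Section lower_bound.
Variables (d k : R) (d0 : 0 < d) (k0 : 0 < k).
Hypothesis dk : forall a, ball p0 d a ->
  chart_im x0 a /\ forall w, k * `|w| <= chart_fnorm (psi a) w.

Definition in_chart_ball (y : M) := chart_dom phi y /\ ball p0 d (phi y).

(** The sup norm of the displacement is the variation of one coordinate h. By the fundamental
    theorem of calculus it is at most the integral of |h'|, and k |h'| is bounded by the speed. *)
Lemma segment_len_lb a b c : a < b -> curve_C1_segment a b c ->
  (forall t, a <= t <= b -> in_chart_ball (c t)) ->
  ((k * `|phi (c b) - phi (c a)|)%:E <= len F c a b)%E.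
Proof.
move=> ab [e [e0 [c' [c'C cc']]]] cW.
set O := `](a - e), (b + e)[%classic in c'C.
have oO : open O by exact: interval_open.
have abO t : a <= t <= b -> O t by move=> tab; rewrite /O /= in_itv/=; apply/andP; split; lra.
have c'W t : a <= t <= b -> in_chart_ball (c' t).
  by move=> tab; rewrite -cc'; [exact: cW|rewrite in_itv].
have cc'o : {in `]a, b[, c =1 c'} by move=> t tab; apply: cc'; exact: subset_itv_oo_cc tab.
rewrite (len_eq F cc'o) !cc' ?in_itv/= ?lexx ?(ltW ab)//.
have [hc0 hd0] := c'C.2 x0.
set O' := (O `&` c' @^-1` chart_dom phi) in hc0 hd0.
have abO' t : a <= t <= b -> O' t by move=> tab; split; [exact: abO|exact: (c'W _ tab).1].
have oO' : open O'.
  by rewrite openE => s [Os xcs]; exact: curve_near_dom c'C Os xcs.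
have hC : Ck_on (V := R^o) 1 O' (phi \o c') by exact: c'C.2.
have [->|[i ->]] := rV_norm_attained (phi (c' b) - phi (c' a)).
  by rewrite mulr0 len_ge0.
pose h (t : R) : R := (phi (c' t)) 0 i.
have [hc hd] : Ck_on (V := R^o) 1 O' h by exact: C1_coord.
have [hd1 [hd2 _]] := hd 1.
have fE t : O' t -> `|'D_1 h t| <= `|'D_1 (phi \o c') t|.
  move=> O't; have [_ /(_ 1)[pd _]] := hC.
  by have := derive_mx (pd _ O't) => E; rewrite (_ : 'D_1 h t = ('D_1 (phi \o c') t) 0 i) ?rV_coord_le// E mxE.
have fcont : {within `[a, b], continuous ('D_1 h : R -> R)}.
  apply: continuous_in_subspaceT => t; rewrite inE/= in_itv/= => tab.
  exact: hd2 (abO' _ tab).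
have abab t : t \in `]a, b[ -> a <= t <= b by rewrite in_itv/= => /andP[t1 t2]; rewrite !ltW.
have FTC : (\int[mu]_(t in `[a, b]) ('D_1 h t)%:E = (h b)%:E - (h a)%:E)%E.
  apply: continuous_FTC2 => //.
    split.
    - by move=> t /abab tab; exact: hd1 (abO' _ tab).
    - apply: cvg_at_right_filter; apply: (hc a); apply: abO'; rewrite lexx ltW//.
    - apply: cvg_at_left_filter; apply: (hc b); apply: abO'; rewrite lexx ltW//.
  by move=> t _; rewrite derive1E.
have mf : measurable_fun `[a, b] ('D_1 h : R -> R) by exact: subspace_continuous_measurable_fun.
have mfo : measurable_fun `]a, b[ ('D_1 h : R -> R).
  by apply: measurable_funS mf => //; exact: subset_itv_oo_cc.
rewrite !mxE -[_ - _]/(h b - h a) EFinM.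
have -> : (`|h b - h a|%:E = `|\int[mu]_(t in `[a, b]) ('D_1 h t)%:E|)%E by rewrite FTC.
apply: (@le_trans _ _ (k%:E * \int[mu]_(t in `]a, b[) `|('D_1 h t)%:E|)%E).
  rewrite lee_pmul2l ?lte_fin//.
  apply: le_trans (le_abse_integral _ _ _) _ => //; first exact/measurable_EFinP.
  rewrite le_eqVlt; apply/orP; left; apply/eqP; apply: integral_itv_bndoo.
  by apply: measurableT_comp => //; exact/measurable_EFinP.
rewrite -ge0_integralZl_EFin//; last 2 first.
- by apply: measurableT_comp => //; exact/measurable_EFinP.
- exact: ltW.
apply: le_integral_gen.
- by move=> t _; rewrite mule_ge0// lee_fin ltW.
- by move=> t _; exact: speed_ge0E.
move=> t /= tab0; split => //; have tab := abab _ tab0.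
have [dt bt] := c'W _ tab.
rewrite (@speed_chart _ _ _ F _ c' x0 t oO c'C (abO _ tab))// -EFinM lee_fin.
have [_ H] := dk bt; have := H ('D_1 (phi \o c') t); rewrite /chart_fnorm chart_invK//.
by apply: le_trans; rewrite ler_wpM2l ?(ltW k0)//; exact: fE (abO' _ tab).
Qed.

Lemma pw_len_lb a b c : pw c a b ->
  (forall t, a <= t <= b -> in_chart_ball (c t)) ->
  ((k * `|phi (c b) - phi (c a)|)%:E <= len F c a b)%E.
Proof.
elim => {a b} [a|a b e ab sab pbe IH] cW; first by rewrite subrr normr0 mulr0 len_ge0.
have be := pw_le pbe.
rewrite (len_split F c (ltW ab) be).
apply: (@le_trans _ _ ((k * `|phi (c b) - phi (c a)|)%:E + (k * `|phi (c e) - phi (c b)|)%:E)%E).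
  rewrite -EFinD lee_fin -mulrDr ler_wpM2l ?(ltW k0)// [leRHS]addrC.
  have -> : phi (c e) - phi (c a) = (phi (c e) - phi (c b)) + (phi (c b) - phi (c a)) by rewrite subrKA.
  exact: ler_normD.
apply: leeD.
  by apply: segment_len_lb => // t /andP[t1 t2]; apply: cW; rewrite t1/= (le_trans t2).
by apply: IH => t /andP[t1 t2]; apply: cW; rewrite t2 andbT (le_trans _ t1)// ltW.
Qed.

Lemma within_itv_open (c : R -> M) (a b T : R) (U : set M) : {within `[a, b], continuous c} ->
  a <= T <= b -> open U -> U (c T) ->
  exists2 e : R, 0 < e & forall t, a <= t <= b -> `|T - t| < e -> U (c t).
Proof.
move=> cc aTb oU UT.
have /subspace_continuousP/(_ T) H := cc.
have /nbhs_ballP[e /= e0 eP] : nbhs T [set t | `[a, b]%classic t -> U (c t)].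
  by have := H aTb _ (open_nbhs_mem oU UT).
by exists e => // t tab te; apply: eP.
Qed.

(** Let T be the infimum of the times at which c is outside K. Since K is closed, c T is still in K,
    and by [pw_len_lb] the coordinates have moved by less than d / 4 until then. So c T lies in the
    open set V inside K, and by continuity c stays in K for some time after T, a contradiction. *)
Lemma curve_stays (c : R -> M) : pw c 0 1 -> chart_dom phi (c 0) ->
  ball p0 (d / 4) (phi (c 0)) -> (len F c 0 1 < (k * (d / 4))%:E)%E ->
  forall t, 0 <= t <= 1 -> in_chart_ball (c t).
Proof.
move=> pc dc0 bc0 lc.
have cc := continuous_pw pc.
pose cb := [set a : 'rV[R]_n | `|p0 - a| <= d / 2].
pose K := psi @` cb.
have d2d : d / 2 < d by rewrite ltr_pdivrMr// ltr_pMr// ltr1n.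
have cbb a : cb a -> ball p0 d a by rewrite /cb /= ball_rVE => /le_lt_trans; apply.
have ccb : compact cb.
  have -> : cb = closed_ball_ (fun x : 'rV[R]_n => `|x|) p0 (d / 2) by [].
  apply: bounded_closed_compact; last exact: closed_closed_ball_.
  exists (`|p0| + d / 2); split; first exact: num_real.
  move=> y yd a /= ad; apply: le_trans (ltW yd).
  have -> : a = p0 - (p0 - a) by rewrite opprB addrC subrK.
  by apply: le_trans (ler_normB _ _) _; rewrite lerD2l.
(* Here the Hausdorff property enters: K is compact, hence closed in M and not only in the domain of
   the chart, so a curve cannot slip out through the missing boundary of the domain. *)
have cK : closed K.
  apply: compact_closed; first exact: manifold_hausdorff.
  apply: continuous_compact => //; apply: continuous_in_subspaceT => a; rewrite inE => /cbb/dk[ia _].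
  exact: chart_inv_continuous.
have KW y : K y -> in_chart_ball y.
  move=> [a ca <-]; have ba := cbb _ ca; have [ia _] := dk ba.
  by split; [exact: chart_inv_dom|rewrite chart_map_invK].
pose V := [set y | chart_dom phi y /\ ball p0 (d / 2) (phi y)].
have oV : open V.
  rewrite openE => y [yd yb]; apply: nbhs_setI; first exact: (open_nbhs_mem (@open_chart_at_dom _ _ _ x0) yd).
  have pc' : {for y, continuous phi} by exact: chart_map_continuous.
  by apply: pc'; apply: open_nbhs_mem yb; exact: ball_open.
have VK y : V y -> K y.
  move=> [yd]; rewrite ball_rVE => yb; exists (phi y); last exact: chart_invK.
  exact: ltW.
have V0 : V (c 0).
  split => //; move: bc0; rewrite !ball_rVE => H; apply: lt_trans H _.
  by rewrite ltr_pdivrMr// -mulrA ltr_pMr//; lra.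
suff H : forall t, 0 <= t <= 1 -> K (c t) by move=> t /H/KW.
apply: contrapT => /existsNP[t0 /not_implyP[t01 nK]].
pose B := [set t : R | 0 <= t <= 1 /\ ~ K (c t)].
have B0 : B t0 by [].
have lB : lbound B 0 by move=> t [/andP[]].
have hB : has_inf B by split; [exists t0|exists 0].
pose T := inf B.
have T0 : 0 <= T by apply: lb_le_inf => //; exists t0.
have Tt0 : T <= t0 by apply: ge_inf => //; exists 0.
have T01 : 0 <= T <= 1 by rewrite T0 (le_trans Tt0)//; case/andP: t01.
have below s : 0 <= s < T -> K (c s).
  move=> /andP[s0 sT]; apply: contrapT => nKs.
  have : B s by split => //; rewrite s0 (le_trans (ltW sT))//; case/andP : T01.
  have Bl : has_lbound B by exists 0.
  by move=> /(ge_inf Bl); rewrite leNgt sT.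
have KT : K (c T).
  move: T0; rewrite le_eqVlt => /predU1P[<-|T0]; first exact: VK.
  apply: contrapT => nKT.
  have [e e0 eP] := within_itv_open cc T01 (closed_openC cK) nKT.
  pose s := Num.max 0 (T - e / 2).
  have sT : s < T by rewrite gt_max T0 gtrBl divr_gt0.
  have s0 : 0 <= s by rewrite le_max lexx.
  have sTe : T - e / 2 <= s by rewrite le_max lexx orbT.
  apply: (eP s); last by apply: below; rewrite s0.
    by rewrite s0 (le_trans (ltW sT))//; case/andP : T01.
  by rewrite gtr0_norm ?subr_gt0//; lra.
have WT s : 0 <= s <= T -> in_chart_ball (c s).
  move=> /andP[s0]; rewrite le_eqVlt => /predU1P[->|sT]; apply: KW => //.
  by apply: below; rewrite s0.
have [pT pT1] := pw_split pc T01.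
have := pw_len_lb pT WT; have lT : (len F c 0 T <= len F c 0 1)%E.
  have [T0' T1'] := andP T01.
  by rewrite (len_split F c T0' T1') leeDl// len_ge0.
move=> /le_trans/(_ lT)/le_lt_trans/(_ lc); rewrite lte_fin ltr_pM2l// => H.
have VT : V (c T).
  have [dT _] := KW _ KT; split => //; rewrite ball_rVE.
  move: bc0; rewrite ball_rVE => bc0.
  have -> : p0 - phi (c T) = (p0 - phi (c 0)) - (phi (c T) - phi (c 0)).
    by rewrite opprB addrA subrK.
  by apply: le_lt_trans (ler_normB _ _) _; lra.
have [e e0 eP] := within_itv_open cc T01 oV VT.
have [s Bs sT] := inf_adherent e0 hB.
have Ts : T <= s by apply: ge_inf => //; exists 0.
case: (Bs) => s01 nKs; apply: nKs; apply: VK; apply: eP => //.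
by rewrite distrC ger0_norm ?subr_ge0// ltrBlDl.
Qed.

End lower_bound.

(** A curve that nearly realizes a distance less than d / K is too short to leave the chart, so
    [pw_len_lb] applies to the whole of it. *)
Lemma finsler_dist_chart_lb : exists d K : R, [/\ 0 < d, 0 < K &
  forall a y, ball p0 d a -> (finsler_dist F (psi a) y < (d / K)%:E)%E ->
    chart_dom phi y /\ ((`|phi y - a|)%:E <= K%:E * finsler_dist F (psi a) y)%E].
Proof.
have [d [k [d0 k0 dk]]] := chart_fnorm_lb.
have k1 : 0 < k^-1 by rewrite invr_gt0.
have d4 : 0 < d / 4 by rewrite divr_gt0.
have d4d : d / 4 < d by rewrite ltr_pdivrMr// ltr_pMr// ltr1n.
exists (d / 4), k^-1; split => //.
move=> a y ba; rewrite invrK => dy.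
have ba' : ball p0 d a by move: ba; rewrite !ball_rVE => /lt_trans; apply.
have [ia _] := dk _ ba'.
have key r : (finsler_dist F (psi a) y < r)%E -> (r <= (d / 4 * k)%:E)%E ->
    chart_dom phi y /\ ((`|phi y - a|)%:E <= (k^-1)%:E * r)%E.
  move=> ar rd; have [c [pc c0 c1 lc]] := finsler_dist_lt ar.
  have W : forall t, 0 <= t <= 1 -> in_chart_ball d (c t).
    apply: (curve_stays d0 k0 dk pc); rewrite ?c0 ?chart_map_invK//.
      exact: chart_inv_dom.
    by apply: lt_le_trans lc _; rewrite mulrC.
  have lb := pw_len_lb k0 dk pc W; rewrite c0 c1 chart_map_invK// in lb.
  split; first by have := W 1; rewrite c1 ler01 lexx => /(_ isT)[].
  by rewrite -lee_pdivrMl// invrK muleC -EFinM mulrC; exact: le_trans lb (ltW lc).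
split; first by have [] := key _ dy (lexx _).
have dfin : finsler_dist F (psi a) y \is a fin_num.
  by rewrite ge0_fin_numE ?finsler_dist_ge0// (lt_trans dy)// ltry.
apply/lee_addgt0Pr => e e0.
(* The slack k e becomes e after division by k. If it makes r exceed the range of [key], the end of
   that range is used instead. *)
pose r := (finsler_dist F (psi a) y + (k * e)%:E)%E.
have dr : (finsler_dist F (psi a) y < r)%E by rewrite lteDl// lte_fin mulr_gt0.
have rE : ((k^-1)%:E * finsler_dist F (psi a) y + e%:E = (k^-1)%:E * r)%E.
  rewrite /r muleDr ?fin_num_adde_defl// -[X in (_ = _ + X)%E]EFinM.
  by rewrite mulrA mulVf ?mul1r ?gt_eqF.
rewrite rE; have [rd|rd] := leP r (d / 4 * k)%:E; first by have [_] := key _ dr rd.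
have [_ H] := key _ dy (lexx _).
by apply: (le_trans H); rewrite lee_pmul2l ?ltW.
Qed.

End local_geometry.

(** * Lipschitz paths *)

Section lipschitz_path.
Context (R : realType) (n : nat) (M : smoothManifoldType R n) (F : finsler_metric M).
Local Open Scope ereal_scope.
Local Notation mu := (@lebesgue_measure R).
Variables (c : R -> M) (L : R).
Hypothesis L0 : (0 < L)%R.
Hypothesis cL : forall s t, (0 <= s)%R -> (s <= t)%R -> (t <= 1)%R ->
  finsler_dist F (c s) (c t) <= (L * (t - s))%:E.

Fixpoint polygon_length (a : R) (s : seq R) : \bar R :=
  if s is x :: s' then finsler_dist F (c a) (c x) + polygon_length x s' else 0.

Lemma polygon_lengthE (a b : R) s :
  \sum_(0 <= i < size s) finsler_dist F (c (nth b (a :: s) i)) (c (nth b (a :: s) i.+1))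
  = polygon_length a s.
Proof.
elim: s a => [|x s IH] a /=; first by rewrite big_geq.
by rewrite big_nat_recl//= -IH.
Qed.

Lemma polygon_length_ge0 a s : 0 <= polygon_length a s.
Proof. by elim: s a => //= x s IH a; rewrite adde_ge0// finsler_dist_ge0. Qed.

Lemma path_lengthE a b : path_length F a b c = ereal_sup [set polygon_length a s | s in itv_partition a b].
Proof.
by rewrite /path_length; congr ereal_sup; apply/seteqP; split => _ [s sP <-]; exists s => //; rewrite polygon_lengthE.
Qed.

Lemma polygon_length_le a b s : (0 <= a)%R -> (b <= 1)%R -> itv_partition a b s ->
  polygon_length a s <= (L * (b - a))%:E.
Proof.
move=> + b1; elim: s a => [|x s IH] a a0 [/= xs ls]; first by rewrite (eqP ls) subrr mulr0.
case/andP : xs => ax xs; have sP : itv_partition x b s by split.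
have x0 : (0 <= x)%R by rewrite (le_trans a0)// ltW.
have xb := itv_partition_le sP.
apply: (@le_trans _ _ ((L * (x - a))%:E + (L * (b - x))%:E)).
  by apply: leeD; [apply: cL => //; [exact: ltW|exact: le_trans b1]|exact: IH].
by rewrite -EFinD lee_fin; lra.
Qed.

(** At most one link of the polygon straddles t. It is cut at t by the triangle inequality, and
    everything after t is bounded by L times the elapsed time. *)
Lemma polygon_length_trunc a t b s : (0 <= a)%R -> (b <= 1)%R -> (a <= t)%R -> (t <= b)%R ->
  itv_partition a b s -> exists2 s1, itv_partition a t s1 &
  polygon_length a s <= polygon_length a s1 + (L * (b - t))%:E.
Proof.
move=> + b1 + tb; elim: s a => [|x s IH] a a0 ta sP.
  have ab : a = b by apply: itv_partition_nil.
  have -> : t = a by apply/eqP; rewrite eq_le ta ab tb.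
  by exists [::]; [split|rewrite /= add0e lee_fin ab subrr mulr0].
have [/= /andP[ax xs] ls] := sP; have sP' : itv_partition x b s by split.
have x0 : (0 <= x)%R by rewrite (le_trans a0)// ltW.
have xb := itv_partition_le sP'.
have [xt|tx] := leP x t.
  have [s1 [s1P1 s1P2] s1l] := IH _ x0 xt sP'.
  exists (x :: s1); first by split => //=; rewrite ax.
  by rewrite /= -addeA; apply: leeD.
have t0 := le_trans a0 ta.
have st : polygon_length x s <= (L * (b - x))%:E by exact: polygon_length_le.
have tx' : finsler_dist F (c t) (c x) <= (L * (x - t))%:E by apply: cL => //; [exact: ltW|exact: le_trans b1].
have bE : (L * (b - t))%:E = (L * (x - t))%:E + (L * (b - x))%:E.
  by rewrite -EFinD; congr EFin; lra.
move: ta; rewrite le_eqVlt => /predU1P[at_|at_].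
  exists [::]; first by split => //=; rewrite at_.
  rewrite /= add0e bE; apply: leeD => //; by rewrite at_.
exists [:: t]; first exact: itv_partition1.
rewrite /= adde0 bE addeA; apply: leeD => //.
by apply: le_trans (finsler_dist_triangle F (c t) _ _) _; exact: leeD.
Qed.

Lemma path_length_ge0 a b : (a <= b)%R -> 0 <= path_length F a b c.
Proof.
move=> ab; rewrite path_lengthE.
move: ab; rewrite le_eqVlt => /predU1P[<-|ab].
  by apply: ereal_sup_ubound; exists [::] => //; split => /=.
apply: le_trans (polygon_length_ge0 a [:: b]) _; apply: ereal_sup_ubound; exists [:: b] => //.
exact: itv_partition1.
Qed.

Lemma path_length_lip s t : (0 <= s)%R -> (s <= t)%R -> (t <= 1)%R ->
  path_length F 0 t c <= path_length F 0 s c + (L * (t - s))%:E.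
Proof.
move=> s0 st t1; rewrite [leLHS]path_lengthE; apply: ge_ereal_sup => _ [p pP <-].
have [p1 p1P] := polygon_length_trunc (lexx 0%R) t1 s0 st pP.
move=> /le_trans; apply; apply: leeD => //.
by rewrite path_lengthE; apply: ereal_sup_ubound; exists p1.
Qed.

Lemma path_length_mono s t : (0 <= s)%R -> (s <= t)%R ->
  path_length F 0 s c <= path_length F 0 t c.
Proof.
move=> s0; rewrite le_eqVlt => /predU1P[->//|st].
rewrite !path_lengthE; apply: ge_ereal_sup => _ [p [p1 p2] <-].
apply: (@le_trans _ _ (polygon_length 0 (rcons p t))).
  elim: p (0%R) {p1 p2 s0} => [|x p IH] a /=; first by rewrite adde0 finsler_dist_ge0.
  by apply: leeD.
apply: ereal_sup_ubound; exists (rcons p t) => //; split.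
  by rewrite rcons_path p1 (eqP p2).
by rewrite last_rcons.
Qed.

Lemma path_length_le t : (0 <= t)%R -> (t <= 1)%R -> path_length F 0 t c <= (L * t)%:E.
Proof.
move=> t0 t1; rewrite path_lengthE; apply: ge_ereal_sup => _ [p pP <-].
by have := polygon_length_le (lexx 0%R) t1 pP; rewrite subr0.
Qed.

Definition rlength (t : R) : R := fine (path_length F 0 t c).

Lemma rlengthE t : (0 <= t)%R -> (t <= 1)%R -> path_length F 0 t c = (rlength t)%:E.
Proof.
move=> t0 t1; rewrite /rlength fineK// ge0_fin_numE ?path_length_ge0//.
exact: le_lt_trans (path_length_le t0 t1) (ltry _).
Qed.

Lemma rlength_mono s t : (0 <= s)%R -> (s <= t)%R -> (t <= 1)%R -> (rlength s <= rlength t)%R.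
Proof.
move=> s0 st t1; rewrite -lee_fin -!rlengthE ?path_length_mono//; first exact: le_trans st.
exact: le_trans t1.
Qed.

Lemma rlength_lip s t : (0 <= s <= 1)%R -> (0 <= t <= 1)%R ->
  (`|rlength s - rlength t| <= L * `|s - t|)%R.
Proof.
wlog st : s t / (s <= t)%R.
  move=> H s01 t01; have [st|ts] := leP s t; first exact: H.
  by rewrite distrC [in leRHS]distrC; apply: H => //; exact: ltW.
move=> /andP[s0 s1] /andP[t0 t1].
rewrite distrC [in leRHS]distrC !ger0_norm ?subr_ge0//; last exact: rlength_mono.
by have := path_length_lip s0 st t1; rewrite !rlengthE// -EFinD lee_fin lerBlDl.
Qed.

Lemma rlength_continuous : {within `[0%R, 1%R], continuous rlength}.
Proof.
apply/subspace_continuousP => t; rewrite /= in_itv/= => t01.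
apply/cvgrPdist_le => e e0; near=> s.
have s01 : (0 <= s <= 1)%R.
  have : `[0%R, 1%R]%classic s by near: s; exact: withinT.
  by rewrite /= in_itv.
apply: le_trans (rlength_lip t01 s01) _.
rewrite -ler_pdivlMl// mulrC; near: s; apply: cvg_within.
have e'0 : (0 < e / L)%R by rewrite divr_gt0.
by apply/nbhs_ballP; exists (e / L)%R => //= s; rewrite /ball/= => /ltW.
Unshelve. all: by end_near. Qed.

Lemma rlength0 : rlength 0 = 0%R.
Proof.
apply/eqP; rewrite eq_le -!lee_fin -rlengthE ?ler01// path_length_ge0// andbT.
by have := path_length_le (lexx 0%R) ler01; rewrite mulr0.
Qed.

Lemma rectifiable_lipschitz : {within `[0%R, 1%R], continuous c} -> rectifiable F 0 1 c.
Proof.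
by move=> cc; split => //; rewrite rlengthE// ltry.
Qed.

(** The arc length parametrization evaluates c at T tau, where T is a right inverse of the length
    function. As the latter is L-Lipschitz, [le_integral_lipschitz_inverse] applies with M = L. *)
Lemma line_integral_le (g : M -> \bar R) :
  (forall x, 0 <= g x) -> measurable_fun (`[0%R, 1%R]%classic : set (measurableTypeR R)) (fun t => g (c t)) ->
  line_integral F 0 1 c g <= (2 * L)%:E * \int[mu]_(t in `[0%R, 1%R]) g (c t).
Proof.
move=> g0 mg; rewrite /line_integral /arclength_param.
pose T (tau : R) := xget 0%R [set t | t \in `[0%R, 1%R] /\ path_length F 0 t c = tau%:E].
have -> : [set tau : R | (0 <= tau)%R /\ tau%:E <= path_length F 0 1 c] = `[0%R, rlength 1]%classic.
  apply/seteqP; split => t /=; rewrite rlengthE// lee_fin in_itv/=; first by case=> -> ->.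
  by move=> /andP.
(* By the intermediate value theorem every such tau is a value of [rlength], so the default value of
   [xget] never occurs here. *)
have TP tau : `[0%R, rlength 1]%classic tau -> (0 <= T tau <= 1)%R /\ rlength (T tau) = tau.
  rewrite /= in_itv/= => /andP[t0 t1].
  have [|t t01 tE] := @IVT R rlength 0%R 1%R tau ler01 rlength_continuous.
    rewrite rlength0 minEle maxEle; have -> : (0 <= rlength 1)%R by rewrite (le_trans t0).
    by rewrite t0.
  have : [set t | t \in `[0%R, 1%R] /\ path_length F 0 t c = tau%:E] (T tau).
    apply: xgetPex; exists t; split => //; move: t01; rewrite in_itv/= => /andP[t01 t02].
    by rewrite rlengthE// tE.
  move=> [T01 TE]; move: T01; rewrite in_itv/= => T01; split => //.
  by move: TE; case/andP : T01 => T01 T02; rewrite rlengthE// => -[].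
(* The final 2 is a point outside [0, 1], as required of z. *)
apply: (@le_integral_lipschitz_inverse _ T `[0%R, rlength 1]%classic `[0%R, 1%R]%classic (fun t => g (c t)) L 2) => //.
- by rewrite /= in_itv/= => /andP[_]; rewrite leNgt ltr1n.
(* A right inverse of a monotone function is monotone. Precomposing T with the retraction P onto
   [0, rlength 1] makes it monotone on the whole line, hence measurable. *)
- pose P (t : R) := Num.max 0%R (Num.min t (rlength 1)).
  have l1 : (0 <= rlength 1)%R by rewrite -rlength0; exact: rlength_mono.
  have PD t : `[0%R, rlength 1]%classic (P t).
    by rewrite /= in_itv/= le_max lexx/= ge_max l1 ge_min lexx orbT.
  apply: (@eq_measurable_fun _ _ _ _ _ (T \o P : measurableTypeR R -> measurableTypeR R)).
    move=> t; rewrite inE/= in_itv/= => /andP[t0 t1].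
    by rewrite /P min_l// max_r.
  apply: nondecreasing_measurable => // s t st.
  have Pst : (P s <= P t)%R.
    by rewrite /P ge_max le_max lexx/= le_max; apply/orP; right; rewrite le_min !ge_min st lexx orbT.
  have [s01 sE] := TP _ (PD s); have [t01 tE] := TP _ (PD t).
  rewrite leNgt; apply/negP => /= ts.
  have := rlength_mono; move=> /(_ (T (P t)) (T (P s))).
  case/andP : t01 => -> _; case/andP : s01 => _ -> /(_ isT (ltW ts) isT); rewrite sE tE => ts'.
  have stE : P s = P t by apply/eqP; rewrite eq_le Pst ts'.
  by move: ts; rewrite stE ltxx.
- move=> s t sD tD; have [s01 sE] := TP _ sD; have [t01 tE] := TP _ tD.
  by rewrite -{1}sE -{1}tE; exact: rlength_lip.
- by move=> t tD; have [t01 _] := TP _ tD; rewrite /= in_itv.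
Qed.

End lipschitz_path.

(** * Hausdorff measure *)

Section frostman_family.
Context (R : realType).
Local Notation mu := (@lebesgue_measure R).

(** It makes bounds hold everywhere: the uniform variable takes values in [0, 1] on all of R, and
    the segments stay in the chart for every real time. *)
Definition clamp (s : R) : R := Num.max 0 (Num.min s 1).

Lemma clamp_itv s : 0 <= clamp s <= 1.
Proof. by rewrite /clamp le_max lexx/= ge_max ler01 ge_min lexx orbT. Qed.

Lemma clamp_id s : 0 <= s <= 1 -> clamp s = s.
Proof. by move=> /andP[s0 s1]; rewrite /clamp min_l// max_r. Qed.

Lemma measurable_clamp : measurable_fun setT (clamp : measurableTypeR R -> measurableTypeR R).
Proof.
apply: measurable_maxr; first exact: measurable_cst.
by apply: measurable_minr; [exact: measurable_id|exact: measurable_cst].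
Qed.

Lemma measurable_forall_ord d (T : measurableType d) m (A : 'I_m -> set T) :
  (forall i, measurable (A i)) -> measurable [set t | forall i, A i t].
Proof.
move=> mA.
have -> : [set t | forall i, A i t] = ~` (\bigcup_i (~` A i)).
  apply/seteqP; split => t /=; first by move=> H [i _]; apply.
  by move=> H i; apply: contrapT => nA; apply: H; exists i.
apply: measurableC; apply: countable_bigcupT_measurable; first exact: countableP.
by move=> i; exact: measurableC.
Qed.

Lemma measurable_dist_le d (T : measurableType d) (f : T -> R) (a e : R) :
  measurable_fun setT (f : T -> measurableTypeR R) -> measurable [set t | `|f t - a| <= e].
Proof.
move=> mf.
have -> : [set t | `|f t - a| <= e] = setT `&` f @^-1` `[a - e, a + e]%classic.
  by rewrite setTI; apply/seteqP; split => t /=; rewrite in_itv/= ler_norml; lra.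
exact: mf.
Qed.

(* T carries n independent uniform variables, built by induction with product measures. *)
Lemma frostman_family n : exists d (T : measurableType d) (P : probability T R)
    (psi : 'I_n -> T -> R),
  [/\ forall i, measurable_fun setT (psi i : T -> measurableTypeR R),
      forall i t, 0 <= psi i t <= 1 &
      forall (a : 'I_n -> R) (e : R), 0 <= e ->
        (P [set t | forall i, (`|psi i t - a i| <= e)%R] <= ((2 * e) ^+ n)%:E)%E].
Proof.
elim: n => [|n [d [T [P [psi [mpsi psi01 Ppsi]]]]]].
  exists _, unit, (dirac tt : probability unit R), (fun i => fun=> 0); split => //.
    by move=> i t; rewrite lexx ler01.
  by move=> a e e0; rewrite expr0; apply: probability_le1.
pose U := uniform_prob (@ltr01 R).
pose psi' (i : 'I_n.+1) (x : measurableTypeR R * T) : R :=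
  if unlift ord0 i is Some j then psi j x.2 else clamp x.1.
exists _, (measurableTypeR R * T)%type, ((U : probability _ R) \x P)%E, psi'; split.
- move=> i; rewrite /psi'; case: (unlift ord0 i) => [j|].
    exact: (measurableT_comp (mpsi j) measurable_snd).
  exact: (measurableT_comp measurable_clamp measurable_fst).
- by move=> i x; rewrite /psi'; case: (unlift ord0 i) => [j|]; [exact: psi01|exact: clamp_itv].
move=> a e e0.
pose A1 : set (measurableTypeR R) := [set s | `|clamp s - a ord0| <= e].
pose A2 := [set t | forall j, `|psi j t - a (lift ord0 j)| <= e].
have mA1 : measurable A1 by exact: (measurable_dist_le _ _ measurable_clamp).
have mA2 : measurable A2.
  by apply: measurable_forall_ord => j; exact: (measurable_dist_le _ _ (mpsi j)).
rewrite (_ : [set t | _] = A1 `*` A2); last first.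
  apply/seteqP; split => -[s t] /= H.
    split => [|j]; first by have := H ord0; rewrite /psi' unlift_none.
    by have := H (lift ord0 j); rewrite /psi' liftK.
  move=> i; rewrite /psi'; case: unliftP => [j ->|->] /=; [exact: H.2|exact: H.1].
have E := @product_measure1E _ _ _ _ R (U : probability _ R) P A1 A2 mA1 mA2.
apply: (@le_trans _ _ (U A1 * P A2)%E).
  by rewrite le_eqVlt; apply/orP; left; apply/eqP; exact: E.
rewrite exprS EFinM; apply: lee_pmul => //; last exact: Ppsi.
(* The uniform density is at most 1 and only [0, 1] counts, where [clamp] is the identity; an
   interval of half-width e thus has probability at most 2 e. *)
rewrite [leLHS]/U /uniform_prob integral_uniform_pdf.
apply: (@le_trans _ _ (1%:E * mu (A1 `&` `[0%R, 1%R]%classic))%E).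
  apply: ge0_le_integral_cst => //; first exact: measurableI.
    by move=> s _; rewrite lee_fin uniform_pdf_ge0.
  move=> s _; rewrite lee_fin /uniform_pdf; case: ifP => // _.
  by rewrite subr0 invr1.
rewrite mul1e; apply: (@le_trans _ _ (mu `[a ord0 - e, a ord0 + e]%classic)).
  apply: le_measure; rewrite ?inE//; first exact: measurableI.
  move=> s []; rewrite /A1 /= !in_itv/= => sA s01.
  by move: sA; rewrite clamp_id// ler_norml; lra.
rewrite lebesgue_measure_itv/= lte_fin; case: ifP => [_|_]; last by rewrite lee_fin mulr_ge0.
by rewrite -EFinB lee_fin; lra.
Qed.

End frostman_family.

(** * Measurability of maps given by coordinates *)

Section borel_rV.
Context (R : realType).

(** An open set is a countable union of closed cubes with rational centres and half-sides 1 / (k +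
    1), and the preimage of a cube is a finite intersection of conditions on the coordinates. *)
Lemma measurable_rV_open d (T : measurableType d) m (w : T -> 'rV[R]_m) (V : set 'rV[R]_m) :
  (forall i, measurable_fun setT ((fun t => w t 0 i) : T -> measurableTypeR R)) ->
  open V -> measurable (w @^-1` V).
Proof.
move=> mw oV.
pose B (z : 'rV[rat]_m) (k : nat) : set 'rV[R]_m := [set a | forall i, `|a 0 i - ratr (z 0 i)| <= k.+1%:R^-1].
pose I := ('rV[rat]_m * nat)%type.
pose C (zk : I) : set T := if pselect (B zk.1 zk.2 `<=` V) then w @^-1` (B zk.1 zk.2) else set0.
have -> : w @^-1` V = \bigcup_zk C zk.
  apply/seteqP; split => t /=; last first.
    by move=> [zk _]; rewrite /C; case: pselect => //= BV wB; exact: BV.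
  move=> Vt; have /nbhs_ballP[e /= e0 eV] := open_nbhs_mem oV Vt.
  have e3 : 0 < e / 3 by rewrite divr_gt0.
  (* A cube of half-side less than e / 3 that contains w t lies within 2 e / 3 of it. *)
  pose k := Num.truncn (e / 3)^-1.
  have kP : k.+1%:R^-1 < e / 3.
    by rewrite -[ltRHS]invrK ltf_pV2 ?posrE ?invr_gt0// truncnS_gt.
  have k0 : 0 < (k.+1%:R^-1 : R) by rewrite invr_gt0.
  have H i : exists q : rat, `|w t 0 i - ratr q| <= k.+1%:R^-1.
    have [|q] := @rat_in_itvoo R (w t 0 i - k.+1%:R^-1) (w t 0 i + k.+1%:R^-1).
      by rewrite ltrBlDr -addrA ltrDl addr_gt0.
    by rewrite in_itv/= => q12; exists q; rewrite distrC ltW// ltr_distl.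
  have [q qP] := choice H.
  exists (\row_i q i, k) => //; rewrite /C; case: pselect => [BV|nBV] /=.
    by move=> i; rewrite mxE.
  apply: nBV => a Ba; apply: eV; rewrite ball_rVE; apply: (@le_lt_trans _ _ (2 * (e / 3))); last lra.
  apply: rV_norm_le; first lra.
  move=> i; rewrite !mxE; have := Ba i; rewrite /= mxE => h1; have h2 := qP i.
  have -> : w t 0 i - a 0 i = (w t 0 i - ratr (q i)) - (a 0 i - ratr (q i)) by rewrite opprB addrA subrK.
  apply: le_trans (ler_normB _ _) _; move: h1 h2 kP.
  by move: (k.+1%:R^-1 : R) => kk; lra.
apply: countable_bigcupT_measurable; first exact: countableP.
move=> [z k]; rewrite /C /=; case: pselect => _ /=; last exact: measurable0.
have -> : w @^-1` B z k = [set t | forall i, [set t | `|w t 0 i - ratr (z 0 i)| <= k.+1%:R^-1] t] by [].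
by apply: measurable_forall_ord => i; exact: measurable_dist_le.
Qed.

End borel_rV.

(** * Comparison of laws with the Hausdorff measure *)

Section hausdorff.
Context (R : realType) (n : nat) (M : smoothManifoldType R n) (F : finsler_metric M).
Local Open Scope ereal_scope.

Lemma ediam_ge (A : set M) x y : A x -> A y -> finsler_dist F x y <= ediam F A.
Proof. by move=> Ax Ay; apply: ereal_sup_ubound; exists (x, y). Qed.

Lemma ediam_ge0 (A : set M) : A !=set0 -> 0 <= ediam F A.
Proof. by move=> [x Ax]; apply: le_trans (ediam_ge Ax Ax); exact: finsler_dist_ge0. Qed.

Lemma hausdorff_weight_ge0 (A : set M) : 0 <= hausdorff_weight F A.
Proof.
rewrite /hausdorff_weight; case: eqP => // /eqP/set0P A0.
by apply: expe_ge0; exact: ediam_ge0.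
Qed.

Lemma hausdorff_premeasure_ge0 (A : set M) e : 0 <= hausdorff_premeasure F e A.
Proof.
apply: le_ereal_inf_tmp => _ [U _ <-]; apply: nneseries_ge0 => k _ _.
exact: hausdorff_weight_ge0.
Qed.

Lemma hausdorff_measure_ge0 (A : set M) : 0 <= hausdorff_measure F A.
Proof.
apply: le_trans (hausdorff_premeasure_ge0 A 1) _.
by apply: ereal_sup_ubound; exists 1%R => /=.
Qed.

Lemma hausdorff_measure0 : hausdorff_measure F set0 = 0.
Proof.
apply/eqP; rewrite eq_le hausdorff_measure_ge0 andbT.
apply: ge_ereal_sup => _ [e /= e0 <-]; apply: ereal_inf_lbound.
exists (fun=> set0).
  split => // k; by rewrite /ediam setX0 image_set0 ereal_sup0 leNye.
by rewrite eseries0// => i _ _; rewrite /hausdorff_weight eqxx.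
Qed.

Section frostman.
Context d (T : measurableType d) (P : probability T R) (psi : 'I_n -> T -> R).
Hypothesis mpsi : forall i, measurable_fun setT (psi i : T -> measurableTypeR R).
Hypothesis Ppsi : forall (a : 'I_n -> R) (e : R), (0 <= e)%R ->
  P [set t | forall i, (`|psi i t - a i| <= e)%R] <= ((2 * e) ^+ n)%:E.
Variables (theta : T -> M) (k : R).
Hypothesis k0 : (0 < k)%R.
Hypothesis psi_theta : forall s t i,
  (`|psi i s - psi i t|)%:E <= k%:E * finsler_dist F (theta s) (theta t).

(* A set of diameter r pulls back into a box of side 2kr, hence of probability at most (2kr)^n. *)
Lemma frostman_le_hausdorff (A : set M) : measurable (theta @^-1` A) ->
  P (theta @^-1` A) <= ((2 * k) ^+ n)%:E * hausdorff_measure F A.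
Proof.
move=> mA; have k2 : (0 < (2 * k) ^+ n)%R by rewrite exprn_gt0// mulr_gt0.
(* Scale 1 suffices as a lower bound for the supremum over scales, and it makes the diameters of the
   covering sets finite. *)
apply: (@le_trans _ _ (((2 * k) ^+ n)%:E * hausdorff_premeasure F 1 A)); last first.
  by apply: lee_wpmul2l; [exact: ltW|apply: ereal_sup_ubound; exists 1%R => /=].
rewrite -lee_pdivrMl//; apply: le_ereal_inf_tmp => _ [U [AU U1] <-].
rewrite lee_pdivrMl//.
have finU j x : U j x -> ediam F (U j) \is a fin_num /\ (0 <= fine (ediam F (U j)))%R.
  move=> Ux; have U0 : 0 <= ediam F (U j) by apply: ediam_ge0; exists x.
  split; last exact: fine_ge0.
  by rewrite ge0_fin_numE//; exact: le_lt_trans (U1 j) (ltry _).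
have [box [mbox Ubox Pbox]] : exists box : (set T)^nat, [/\ forall j, measurable (box j),
    forall j, theta @^-1` (U j) `<=` box j &
    forall j, P (box j) <= ((2 * k) ^+ n)%:E * hausdorff_weight F (U j)].
  suff /choice[box boxP] : forall j, exists B : set T, [/\ measurable B, theta @^-1` (U j) `<=` B &
      P B <= ((2 * k) ^+ n)%:E * hausdorff_weight F (U j)].
    by exists box; split => j; have [] := boxP j.
  move=> j; have [[s /= Us]|nU] := pselect ((theta @^-1` (U j)) !=set0); last first.
    exists set0; split => // [t Ut|]; first by apply: nU; exists t.
    by rewrite measure0 mule_ge0 ?hausdorff_weight_ge0// lee_fin ltW.
  have [Ufin U0] := finU _ _ Us.
  set r := fine (ediam F (U j)) in U0.
  have kr0 : (0 <= k * r)%R by rewrite mulr_ge0// ltW.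
  exists [set t | forall i, (`|psi i t - psi i s| <= k * r)%R]; split.
  - by apply: measurable_forall_ord => i; exact: measurable_dist_le.
  - move=> t /= Ut i; rewrite -lee_fin; apply: le_trans (psi_theta t s i) _.
    rewrite EFinM; apply: lee_wpmul2l; first by rewrite lee_fin ltW.
    by rewrite /r fineK//; exact: ediam_ge.
  - apply: le_trans (Ppsi (fun i => psi i s) kr0) _.
    rewrite /hausdorff_weight ifF; last first.
      by apply/negbTE/set0P; exists (theta s).
    by rewrite -(fineK Ufin) -/r -EFin_expe -EFinM lee_fin mulrA exprMn.
apply: (@le_trans _ _ (\sum_(j <oo) P (box j))).
  apply: (measure_sigma_subadditive P mbox mA).
  by move=> t /AU[j _ Uj]; exists j => //; exact: Ubox.
rewrite -nneseriesZl; last by move=> j _; exact: hausdorff_weight_ge0.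
by apply: lee_nneseries => // j _; exact: Pbox.
Qed.

End frostman.
End hausdorff.

(** * The estimate at small distance *)

Section one_variable.
Context (R : realType).
Local Open Scope ereal_scope.

(** Either r <= A, or (r / A)^(p - 1) >= 1. Integrated, this replaces Jensen's inequality at the
    price of a factor 2. *)
Lemma le_add_powR (A r p : R) : (0 < A)%R -> (0 <= r)%R -> (1 <= p)%R ->
  (r <= A + A `^ (1 - p) * r `^ p)%R.
Proof.
move=> A0 r0 p1; have c0 : (0 <= A `^ (1 - p) * r `^ p)%R by rewrite mulr_ge0 ?powR_ge0.
have [rA|Ar] := leP r A; first lra.
have r1 : (0 < r)%R by exact: lt_trans Ar.
suff : (r <= A `^ (1 - p) * r `^ p)%R by lra.
have p0 : (0 < p)%R by lra.
rewrite -(mulr_powRB1 r0 p0).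
have -> : (1 - p = - (p - 1))%R by ring.
rewrite powRN mulrCA ler_peMr// mulrC ler_pdivlMr ?powR_gt0// mul1r.
by apply: ge0_ler_powR; rewrite ?nnegrE//; lra.
Qed.

(* Integrating [f <= A + A^(1-p) f^p], with A close to B^(1/p). *)
Lemma le_integral_powR d (T : measurableType d) (P : probability T R) (f : T -> \bar R)
    (p B : R) : (1 <= p)%R -> (0 <= B)%R -> measurable_fun setT f -> (forall x, 0 <= f x) ->
  \int[P]_x (f x `^ p) <= B%:E -> \int[P]_x f x <= (2 * B `^ p^-1)%:E.
Proof.
move=> p1 B0 mf f0 fB.
have p0 : (0 < p)%R by lra.
apply/lee_addgt0Pr => e e0.
(* The e / 2 keeps A positive when B = 0 and accounts for the e of the final bound, which is 2 A. *)
pose A := (B `^ p^-1 + e / 2)%R.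
have A0 : (0 < A)%R by rewrite /A; have := powR_ge0 B p^-1; lra.
have mfp : measurable_fun setT (fun x => f x `^ p) by exact: measurableT_comp (measurable_poweR p) mf.
apply: (@le_trans _ _ (\int[P]_x (A%:E + (A `^ (1 - p))%:E * f x `^ p))).
  apply: ge0_le_integral => //.
  - apply: emeasurable_funD; first exact: measurable_cst.
    exact: emeasurable_funM (measurable_cst _) mfp.
  - move=> x _; have := f0 x; case: (f x) => [r|_|//].
    - rewrite lee_fin => r0; rewrite poweR_EFin -EFinM -EFinD lee_fin.
      exact: le_add_powR.
    - by rewrite poweRyr ?gt_eqF// gt0_muley ?lte_fin ?powR_gt0// addey.
rewrite ge0_integralD//; last 3 first.
- by move=> x _; rewrite lee_fin ltW.
- by move=> x _; rewrite mule_ge0 ?poweR_ge0// lee_fin powR_ge0.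
- exact: emeasurable_funM (measurable_cst _) mfp.
have -> : \int[P]__ A%:E = A%:E.
  apply: etrans (integral_cst P measurableT A%:E) _.
  by apply: etrans (congr1 (mule A%:E) (probability_setT P)) _; exact: mule1.
rewrite ge0_integralZl//; last 2 first.
- by move=> x _; exact: poweR_ge0.
- by rewrite lee_fin powR_ge0.
have AB : (B <= A `^ p)%R.
  rewrite -[leLHS]powRr1// -(mulVf (lt0r_neq0 p0)) powRrM.
  apply: ge0_ler_powR; rewrite ?nnegrE ?powR_ge0//; [exact: ltW|exact: ltW|].
  by rewrite /A; lra.
have AA : (A `^ (1 - p) * A `^ p = A)%R.
  by rewrite -powRD ?subrK ?powRr1 ?ltW// gt_eqF ?implybT.
apply: (@le_trans _ _ (A%:E + (A `^ (1 - p))%:E * (A `^ p)%:E)).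
  apply: leeD => //; apply: lee_pmul => //.
  - by rewrite lee_fin powR_ge0.
  - by apply: integral_ge0 => x _; exact: poweR_ge0.
  - by apply: le_trans fB _; rewrite lee_fin.
rewrite -EFinM AA -!EFinD lee_fin /A; lra.
Qed.

Lemma integral_powR_le (a : R) : (0 <= a)%R -> (a < 1)%R ->
  \int[lebesgue_measure]_(t in `]0%R, 1%R] : set (measurableTypeR R)) ((t `^ (- a))%:E) <= ((1 - a)^-1)%:E.
Proof.
move=> a0 a1; have b0 : (0 < 1 - a)%R by lra.
(* The integrand may be unbounded at 0, so ]0, 1] is exhausted by the intervals [1 / (k + 2), 1];
   the shift by 2 keeps the left end below 1. *)
pose D (k : nat) : set (measurableTypeR R) := `[(k.+2%:R^-1)%R : R, 1%R]%classic.
have mp A : measurable_fun (A : set (measurableTypeR R)) (fun t : measurableTypeR R => (t `^ (- a))%:E).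
  by apply/measurable_EFinP; apply: measurable_funTS; exact: measurable_powR.
have U : \bigcup_k D k = `]0%R, 1%R]%classic.
  apply/seteqP; split => [t [k _]|t]; rewrite /D /= !in_itv/=.
    by move=> /andP[kt ->]; rewrite andbT (lt_le_trans _ kt)// invr_gt0 ltr0n.
  move=> /andP[t0 t1]; have [k _] := near_infty_natSinv_lt (PosNum t0).
  move=> /(_ k (leqnn k))/= kt; exists k => //; rewrite /D /= in_itv/= t1 andbT.
  apply: le_trans (ltW kt); rewrite lef_pV2 ?posrE ?ltr0n// ler_nat//.
rewrite -U.
have Dmono : nondecreasing_seq D.
  move=> i j ij; apply/subsetPset => t; rewrite /D /= !in_itv/= => /andP[it ->].
  by rewrite andbT (le_trans _ it)// lef_pV2 ?posrE ?ltr0n// ler_nat.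
have C : \int[lebesgue_measure]_(t in D k) (t `^ (- a))%:E @[k --> \oo] -->
    \int[lebesgue_measure]_(t in \bigcup_k D k) (t `^ (- a))%:E.
  apply: ge0_nondecreasing_set_cvg_integral => //.
  - by move=> k; exact: measurable_itv.
  - by move=> k t _; rewrite lee_fin powR_ge0.
rewrite -(cvg_lim _ C)//; apply: lime_le; first by apply/cvg_ex; eexists; exact: C.
apply: nearW => k.
pose F (t : R) : R := (t `^ (1 - a) / (1 - a))%R.
have k0 : (0 < k.+2%:R^-1 :> R)%R by rewrite invr_gt0 ltr0n.
have k1 : (k.+2%:R^-1 < 1 :> R)%R by rewrite invf_lt1 ?ltr0n// ltr1n.
have dF (t : R) : (0 < t)%R -> is_derive t 1%R F (t `^ (- a))%R.
  move=> t0; rewrite /F.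
  have H := is_derive1_powR (1 - a) t0.
  apply: is_derive_eq.
  rewrite scaler0 add0r /GRing.scale /= mulrA mulVf ?gt_eqF// mul1r.
  by congr (powR _ _); ring.
rewrite (@continuous_FTC2 _ _ F)//.
- rewrite /F powR1 -EFinB lee_fin div1r gerBl divr_ge0 ?powR_ge0//; exact: ltW.
- apply: continuous_in_subspaceT => t; rewrite inE/= in_itv/= => /andP[kt _].
  have t0 : (0 < t)%R by exact: lt_le_trans kt.
  apply: differentiable_continuous; apply/derivable1_diffP.
  by apply: derivable_powR; rewrite in_itv/= t0.
- split.
  + move=> t; rewrite in_itv/= => /andP[kt _].
    have t0 : (0 < t)%R by exact: lt_trans kt.
    by have [] := dF t t0.
  + apply: cvg_at_right_filter; apply: differentiable_continuous; apply/derivable1_diffP.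
    by have [] := dF _ k0.
  + apply: cvg_at_left_filter; apply: differentiable_continuous; apply/derivable1_diffP.
    by have [] := dF 1%R ltr01.
- move=> t; rewrite in_itv/= => /andP[kt _].
  have t0 : (0 < t)%R by exact: lt_trans kt.
  by have [_ E] := dF t t0; rewrite derive1E E.
Qed.
End one_variable.

(** * Bi-Lipschitz charts *)

Section local_chart.
Context (R : realType) (n : nat) (M : smoothManifoldType R n) (F : finsler_metric M) (x0 : M).
Local Notation phi := (chart_at x0).
Local Notation psi := (chart_inv (chart_at x0)).
Local Notation p0 := (chart_at x0 x0).
Local Open Scope ereal_scope.

Lemma chart_bilipschitz : exists d L K : R, [/\ (0 < d)%R, (0 < L)%R, (0 < K)%R &
  [/\ forall a, ball p0 d a -> chart_im x0 a,
     forall a b, ball p0 d a -> ball p0 d b ->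
       finsler_dist F (psi a) (psi b) <= (L * `|b - a|)%:E,
     forall a b, ball p0 d a -> ball p0 d b ->
       (`|b - a|)%:E <= K%:E * finsler_dist F (psi a) (psi b) &
     forall y, finsler_dist F x0 y < (d / K)%:E ->
       exists2 b, psi b = y & (`|b - p0|)%:E <= K%:E * finsler_dist F x0 y]].
Proof.
have [d1 d10 H1] := near_chart_inv (@filterT _ (nbhs x0) _).
have [d2 [L [d20 L0 H2]]] := finsler_dist_chart_ub F x0.
have [d3 [K [d30 K0 H3]]] := finsler_dist_chart_lb F x0.
pose d := Num.min (Num.min d1 d2) d3.
have d0 : (0 < d)%R by rewrite !lt_min d10 d20 d30.
have dd1 : (d <= d1)%R by rewrite !ge_min lexx.
have dd2 : (d <= d2)%R by rewrite !ge_min lexx orbT.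
have dd3 : (d <= d3)%R by rewrite ge_min lexx orbT.
have im a : ball p0 d a -> chart_im x0 a.
  by move=> /(le_ball dd1)/H1[].
have K20 : (0 < 2 * K)%R by rewrite mulr_gt0.
exists d, L, (2 * K)%R; split => //; split => //.
- by move=> a b /(le_ball dd2) Ha /(le_ball dd2) Hb; exact: H2.
- move=> a b Ha Hb.
  have [lt|ge] := ltP (finsler_dist F (psi a) (psi b)) (d3 / K)%:E.
    have [_] := H3 a (psi b) (le_ball dd3 Ha) lt.
    rewrite (chart_map_invK (im _ Hb)) => /le_trans; apply.
    by apply: lee_pmul => //; [rewrite lee_fin ltW|exact: finsler_dist_ge0|rewrite lee_fin; lra].
  (* These points are out of reach of [H3]: their distance is at least d3 / K, while |b - a| < 2 d
     <= 2 d3. Hence the doubled constant. *)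
  apply: (@le_trans _ _ ((2 * K)%:E * (d3 / K)%:E)); last first.
    by apply: lee_pmul => //; rewrite lee_fin ltW// divr_gt0.
  rewrite -EFinM lee_fin.
  have -> : (2 * K * (d3 / K) = d3 + d3)%R by field; rewrite gt_eqF.
  have Ea : (`|p0 - a| < d)%R by move: Ha; rewrite ball_rVE.
  have Eb : (`|p0 - b| < d)%R by move: Hb; rewrite ball_rVE.
  have : (`|b - a| <= `|p0 - a| + `|p0 - b|)%R.
    by rewrite (distrC p0 b) [leRHS]addrC; exact: ler_distD.
  by lra.
- move=> y ylt; exists (phi y); last first.
    have := @H3 p0 y (le_ball dd3 (ballxx _ d0)); rewrite chart_invK; last exact: mem_chart_at.
    case=> [|_ /le_trans]; last first.
      apply; apply: lee_pmul => //; [rewrite lee_fin ltW|exact: finsler_dist_ge0|rewrite lee_fin; lra]; lra.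
    apply: lt_le_trans ylt _; rewrite lee_fin ler_pM// ?invr_ge0 ?(ltW d0) ?(ltW K20)//.
    by rewrite lef_pV2 ?posrE//; lra.
  apply: chart_invK.
  have := @H3 p0 y (le_ball dd3 (ballxx _ d0)); rewrite chart_invK; last exact: mem_chart_at.
  case=> //.
  apply: lt_le_trans ylt _; rewrite lee_fin ler_pM// ?invr_ge0 ?(ltW d0) ?(ltW K20)//.
  by rewrite lef_pV2 ?posrE//; lra.
Qed.

Lemma open_chart_ball (r : R) :
  open [set z : M | chart_dom phi z /\ (`|phi z - p0| < r)%R].
Proof.
rewrite openE => z [zd zr].
have D : {for z, continuous (phi : M -> 'rV[R]_n)} by exact: chart_map_continuous.
apply: nbhs_setI; first exact: open_nbhs_mem (@open_chart_at_dom _ _ _ x0) zd.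
have B : nbhs (phi z) [set a | (`|a - p0| < r)%R].
  apply/nbhs_ballP; exists (r - `|phi z - p0|)%R => /=; first by rewrite subr_gt0.
  move=> a; rewrite ball_rVE /= => H.
  have : (`|a - p0| <= `|phi z - a| + `|phi z - p0|)%R.
    by rewrite (distrC _ a); exact: ler_distD.
  by lra.
exact: D _ B.
Qed.
End local_chart.

Section translated_chart.
Context (R : realType) (n : nat) (G : lieGroupType R n).
Local Notation psi := (chart_inv (chart_at (1%g : G))).
Local Notation p0 := (chart_at (1%g : G) (1%g : G)).

Lemma measurable_translated_chart d (T : measurableType d) (x : G) (r : R) (w : T -> 'rV[R]_n) :
  (forall a, ball p0 r a -> chart_im (1%g : G) a) ->
  (forall i, measurable_fun setT ((fun t => w t 0 i) : T -> measurableTypeR R)) ->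
  (forall t, ball p0 r (w t)) ->
  measurable_fun setT ((fun t => (x * psi (w t))%g) : T -> borelType G).
Proof.
move=> im mw wr.
apply: measurability; first reflexivity.
move=> _ [A oA <-]; rewrite setTI.
pose V := [set a : 'rV[R]_n | chart_im (1%g : G) a /\ A (x * psi a)%g].
have -> : (fun t => (x * psi (w t))%g) @^-1` A = w @^-1` V.
  by apply/seteqP; split => t /=; [split => //; exact: im|case].
apply: measurable_rV_open => //.
rewrite openE => a [ima Aa].
apply: nbhs_setI; first exact: open_nbhs_mem (@open_chart_at_im _ _ _ (1%g : G)) ima.
have C : {for a, continuous psi} by exact: chart_inv_continuous.
have C2 : {for a, continuous (fun a => (x * psi a)%g)}.
  by apply: (@continuous_comp _ _ _ psi (fun y => (x * y)%g)) => //; exact: continuous_mulg_l.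
by apply: C2; exact: open_nbhs_mem.
Qed.

Lemma open_translated_ball (x : G) (r : R) :
  open [set z : G | chart_dom (chart_at (1%g : G)) (x^-1 * z)%g /\
                    `|chart_at (1%g : G) (x^-1 * z)%g - p0| < r].
Proof.
apply: (@open_comp _ _ (fun z : G => (x^-1 * z)%g)) (@open_chart_ball _ _ _ (1%g : G) r).
by move=> z _; exact: continuous_mulg_l.
Qed.
End translated_chart.

(** * Random segments and averages of the upper gradient *)

Section segment_pencil.
Context (R : realType) (n : nat) (G : lieGroupType R n) (F : finsler_metric G).
Hypothesis Fl : left_invariant F.
Local Notation psi := (chart_inv (chart_at (1%g : G))).
Local Notation p0 := (chart_at (1%g : G) (1%g : G)).
Local Notation mu := (@lebesgue_measure R).
Local Open Scope ereal_scope.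
Variables d L K : R.
Hypotheses (d0 : (0 < d)%R) (L0 : (0 < L)%R) (K0 : (0 < K)%R).
Hypothesis im : forall a, ball p0 d a -> chart_im (1%g : G) a.
Hypothesis dist_ub : forall a b, ball p0 d a -> ball p0 d b ->
  finsler_dist F (psi a) (psi b) <= (L * `|b - a|)%:E.
Hypothesis dist_lb : forall a b, ball p0 d a -> ball p0 d b ->
  (`|b - a|)%:E <= K%:E * finsler_dist F (psi a) (psi b).
Context dT (T : measurableType dT) (P : probability T R) (xi : 'I_n -> T -> R).
Hypothesis mxi : forall i, measurable_fun setT (xi i : T -> measurableTypeR R).
Hypothesis xi01 : forall i s, (0 <= xi i s <= 1)%R.
Hypothesis Pxi : forall (a : 'I_n -> R) (e : R), (0 <= e)%R ->
  P [set s | forall i, (`|xi i s - a i| <= e)%R] <= ((2 * e) ^+ n)%:E.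
Variables (x : G) (r : R) (q : 'rV[R]_n).
Hypotheses (r0 : (0 < r)%R) (rd : (2 * r <= d)%R) (qr : (`|q - p0| <= r)%R).

(* The segments from q to the random points of the cube p0 + [0, r]^n. *)
Definition pencil (s : T) (t : R) : 'rV[R]_n :=
  (q + t *: (p0 + r *: (\row_i xi i s) - q))%R.

Definition pencil_curve (s : T) (t : R) : G := (x * psi (pencil s t))%g.

Lemma xi_norm s : (`|\row_i xi i s : 'rV[R]_n| <= 1)%R.
Proof.
apply: rV_norm_le => // i; rewrite mxE; have /andP[? ?] := xi01 i s.
by rewrite ger0_norm.
Qed.

Lemma pencil_near s t : (0 <= t <= 1)%R -> (`|pencil s t - p0| <= r)%R.
Proof.
move=> /andP[t0 t1].
have -> : (pencil s t - p0 = (1 - t) *: (q - p0) + t *: (r *: \row_i xi i s))%R.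
  rewrite /pencil; apply/rowP => i; rewrite !mxE; ring.
apply: le_trans (ler_normD _ _) _; rewrite !normrZ (ger0_norm t0) ger0_norm ?subr_ge0//.
rewrite (ger0_norm (ltW r0)).
have A : ((1 - t) * `|q - p0| <= (1 - t) * r)%R by rewrite ler_wpM2l// subr_ge0.
have B : (t * (r * `|\row_i xi i s : 'rV[R]_n|) <= t * r)%R.
  by rewrite ler_wpM2l// ler_piMr ?xi_norm// ltW.
by move: A B; lra.
Qed.

Lemma pencil_ball s t : (0 <= t <= 1)%R -> ball p0 d (pencil s t).
Proof.
move=> t01; have rd' : (r < d)%R by apply: lt_le_trans rd; rewrite mulr_natl mulr2n ltrDl.
by rewrite ball_rVE distrC; exact: le_lt_trans (pencil_near s t01) rd'.
Qed.

Lemma pencil_clamp_ball s t : ball p0 d (pencil s (clamp t)).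
Proof. exact/pencil_ball/clamp_itv. Qed.

Lemma pencil_curve0 s : pencil_curve s 0 = (x * psi q)%g.
Proof. by rewrite /pencil_curve /pencil scale0r addr0. Qed.

Lemma pencil_curve1 s : pencil_curve s 1 = (x * psi (p0 + r *: (\row_i xi i s)))%g.
Proof. by rewrite /pencil_curve /pencil scale1r addrC subrK. Qed.

(** Joint measurability in the outcome and the time prepares Tonelli's theorem. *)
Lemma measurable_pencil : measurable_fun setT
  ((fun z => pencil_curve z.1 (clamp z.2)) : T * measurableTypeR R -> borelType G).
Proof.
apply: (@measurable_translated_chart R n G _ (T * measurableTypeR R)%type x d (fun z => pencil z.1 (clamp z.2))) => //.
  move=> i; rewrite /pencil.
  rewrite (_ : (fun _ => _) = (fun z : T * measurableTypeR R =>
      q 0 i + clamp z.2 * (p0 0 i + r * xi i z.1 - q 0 i))%R); last first.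
    by apply/funext => z; rewrite !mxE.
  have mc : measurable_fun setT ((fun z => clamp z.2) : T * measurableTypeR R -> measurableTypeR R).
    exact: measurableT_comp (@measurable_clamp R) measurable_snd.
  have mx : measurable_fun setT ((fun z => xi i z.1) : T * measurableTypeR R -> measurableTypeR R).
    exact: measurableT_comp (mxi i) measurable_fst.
  apply: measurable_funD; first exact: measurable_cst.
  apply: measurable_funM; first exact: mc.
  apply: measurable_funB; last exact: measurable_cst.
  apply: measurable_funD; first exact: measurable_cst.
  apply: measurable_funM; first exact: measurable_cst.
  exact: mx.
by move=> z; exact: pencil_clamp_ball.
Qed.

Lemma measurable_pencil_curve t : (0 <= t <= 1)%R ->
  measurable_fun setT ((fun s => pencil_curve s t) : T -> borelType G).
Proof.
move=> t01; rewrite (_ : (fun s => _) = fun s : T => pencil_curve s (clamp t)).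
  exact: (measurable_fun_pair1 (t : measurableTypeR R) measurable_pencil).
by apply/funext => s; rewrite clamp_id.
Qed.

Lemma pencil_curve_lipschitz s t t' : (0 <= t)%R -> (t <= t')%R -> (t' <= 1)%R ->
  finsler_dist F (pencil_curve s t) (pencil_curve s t') <= (2 * r * L * (t' - t))%:E.
Proof.
move=> t0 tt' t1; rewrite /pencil_curve finsler_dist_mulg//.
apply: le_trans (dist_ub _ _) _; [apply: pencil_ball; lra|apply: pencil_ball; lra|].
rewrite lee_fin.
have -> : (pencil s t' - pencil s t = (t' - t) *: (p0 + r *: (\row_i xi i s) - q))%R.
  by rewrite /pencil; apply/rowP => i; rewrite !mxE; ring.
rewrite normrZ ger0_norm ?subr_ge0//.
have A : (`|p0 + r *: (\row_i xi i s) - q| <= 2 * r)%R.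
  have -> : (p0 + r *: (\row_i xi i s) - q = r *: (\row_i xi i s) - (q - p0))%R.
    by apply/rowP => i; rewrite !mxE; ring.
  apply: le_trans (ler_normB _ _) _; rewrite normrZ (ger0_norm (ltW r0)).
  by rewrite mulr_natl mulr2n lerD// ler_piMr ?xi_norm// ltW.
rewrite (_ : 2 * r * L * (t' - t) = L * ((t' - t) * (2 * r)))%R; last by ring.
by rewrite ler_wpM2l ?(ltW L0)// ler_wpM2l// subr_ge0.
Qed.

(** The starting point q cancels: at time t the coordinates of two segments differ by t r (xi s' -
    xi s). With the lower Lipschitz bound this is the hypothesis [psi_theta] of the Frostman
    estimate, with constant K / (t r). *)
Lemma xi_pencil_curve t s s' i : (0 < t)%R -> (t <= 1)%R ->
  (`|xi i s - xi i s'|)%:E <=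
    (K / (t * r))%:E * finsler_dist F (pencil_curve s t) (pencil_curve s' t).
Proof.
move=> t0 t1; rewrite /pencil_curve finsler_dist_mulg//.
have tr : (0 < t * r)%R by rewrite mulr_gt0.
have t01 : (0 <= t <= 1)%R by rewrite ltW.
have := dist_lb (pencil_ball s t01) (pencil_ball s' t01).
have : (t * r * `|xi i s - xi i s'| <= `|pencil s' t - pencil s t|)%R.
  have -> : (pencil s' t - pencil s t = t *: (r *: (\row_j (xi j s' - xi j s))))%R.
    by rewrite /pencil; apply/rowP => j; rewrite !mxE; ring.
  rewrite !normrZ (gtr0_norm t0) (gtr0_norm r0) mulrA (ler_pM2l tr) distrC.
  by have := rV_coord_le (\row_j (xi j s' - xi j s))%R i; rewrite mxE.
move=> A B; have {A B} A : (t * r * `|xi i s - xi i s'|)%:E <=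
    K%:E * finsler_dist F (psi (pencil s t)) (psi (pencil s' t)).
  by apply: le_trans B; rewrite lee_fin.
have -> : ((`|xi i s - xi i s'|)%:E = ((t * r)^-1)%:E * (t * r * `|xi i s - xi i s'|)%:E).
  by rewrite -EFinM mulrA mulVf ?mul1r// gt_eqF.
rewrite (mulrC K) [X in _ <= X * _]EFinM -[leRHS]muleA; apply: lee_pmul => //.
  by rewrite lee_fin invr_ge0 ltW.
by rewrite lee_fin !mulr_ge0// ltW.
Qed.

Variable g : G -> \bar R.
Hypothesis mg : measurable_fun setT (g : borelType G -> \bar R).
Hypothesis g0 : forall z, 0 <= g z.

Lemma pencil_slice_le (B : set (borelType G)) (p N t : R) :
  finsler_ball F x (2 * L * r)%:E `<=` B -> (1 <= p)%R -> (0 <= N)%R -> (0 < t)%R -> (t <= 1)%R ->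
  \int[hausdorff_measure F : set (borelType G) -> \bar R]_(z in B) `|g z| `^ p <= N%:E ->
  \int[P]_s g (pencil_curve s t) <= (2 * ((2 * (K / (t * r))) ^+ n * N) `^ p^-1)%:E.
Proof.
move=> ballB p1 N0 t0 t1 gN; have t01 : (0 <= t <= 1)%R by rewrite ltW.
have tr : (0 < t * r)%R by rewrite mulr_gt0.
have k0 : (0 < K / (t * r))%R by rewrite divr_gt0.
pose th : T -> borelType G := fun s => pencil_curve s t.
have mth : measurable_fun setT th by exact: measurable_pencil_curve.
have mgp : measurable_fun setT ((fun z => `|g z| `^ p) : borelType G -> \bar R).
  apply: (@measurableT_comp _ _ _ _ _ _ (fun y : \bar R => y `^ p)).
    exact: measurable_poweR.
  by apply: measurableT_comp => //; exact: measurable_abse.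
have c0 : (0 <= (2 * (K / (t * r))) ^+ n)%R by rewrite exprn_ge0// mulr_ge0// ltW.
apply: (le_integral_powR p1 (mulr_ge0 c0 N0) (measurableT_comp mg mth)) => // [s|]; first exact: g0.
(* S is open, lies in B and carries the whole law of the point at time t, so the pushforward formula
   is applied on S, whose measurability is clear, and B enters only by inclusion. *)
pose S := [set z : G | chart_dom (chart_at (1%g : G)) (x^-1 * z)%g /\
                    (`|chart_at (1%g : G) (x^-1 * z)%g - p0| < 2 * r)%R].
have mS : measurable (S : set (borelType G)).
  by apply: sub_sigma_algebra; exact: open_translated_ball.
have SB : S `<=` B.
  move=> z [zd zr]; apply: ballB.
  have Ez : z = (x * psi (chart_at (1%g : G) (x^-1 * z)%g))%g.
    by rewrite chart_invK// mulgA mulgV mul1g.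
  have Ex : x = (x * psi p0)%g by rewrite chart_invK ?mulg1//; exact: mem_chart_at.
  rewrite /finsler_ball /= {1}Ex Ez finsler_dist_mulg//.
  apply: le_trans (dist_ub _ _) _.
  - exact: ballxx.
  - by rewrite ball_rVE distrC; exact: lt_le_trans rd.
  - by rewrite lee_fin (mulrC (2%R : R)) -mulrA ler_wpM2l ?ltW.
have thS : th @^-1` S = setT.
  apply/seteqP; split => // s _; rewrite /S /th /pencil_curve /= mulgA mulVg mul1g.
  have ims := im (pencil_ball s t01).
  split; first exact: chart_inv_dom.
  rewrite chart_map_invK//; apply: le_lt_trans (pencil_near s t01) _.
  by rewrite mulr_natl mulr2n ltrDl.
have E : \int[P]_s (g (th s) `^ p) = \int[pushforward P th]_(z in S) (`|g z| `^ p).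
  rewrite (@ge0_integral_pushforward _ _ _ _ _ th mth)//; last 2 first.
  - exact: measurable_funTS.
  - by move=> z _; exact: poweR_ge0.
  by rewrite thS; apply: eq_integral => s _ /=; rewrite gee0_abs.
rewrite E EFinM.
apply: (@le_trans _ _ (((2 * (K / (t * r))) ^+ n)%:E *
  \int[hausdorff_measure F : set (borelType G) -> \bar R]_(z in B) `|g z| `^ p)); last by apply: lee_wpmul2l.
apply: le_integral_measure => //.
- exact: hausdorff_measure0.
- exact: hausdorff_measure_ge0.
- move=> A mA _; apply: (frostman_le_hausdorff mxi Pxi k0).
    by move=> s s' i; exact: xi_pencil_curve.
  by rewrite -[X in measurable X]setTI; exact: mth.
- by move=> z _; exact: poweR_ge0.
Qed.

Local Notation I01 := (`]0%R, 1%R]%classic : set (measurableTypeR R)).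

(** Extension by 0 off ]0, 1], so that Tonelli's theorem applies on the whole product. Time 0 is
    left out because the slice bound is stated for t > 0. *)
Definition pencil_density (z : T * measurableTypeR R) : \bar R :=
  if z.2 \in I01 then g (pencil_curve z.1 (clamp z.2)) else 0.

Lemma measurable_pencil_density : measurable_fun setT pencil_density.
Proof.
rewrite (_ : pencil_density =
    (fun z : T * measurableTypeR R => g (pencil_curve z.1 (clamp z.2))) \_ (setT `*` I01)); last first.
  by apply/funext => z; rewrite /pencil_density patchE in_setX in_setT.
apply/(measurable_restrictT _ _).1; first by apply: measurableX => //; exact: measurable_itv.
by apply: measurable_funTS; exact: measurableT_comp mg measurable_pencil.
Qed.

Lemma pencil_density_ge0 z : 0 <= pencil_density z.
Proof. by rewrite /pencil_density; case: ifP => // _; exact: g0. Qed.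

Lemma measurable_pencil_section s A :
  measurable_fun (A : set (measurableTypeR R)) (fun t => g (pencil_curve s (clamp t))).
Proof.
apply: measurable_funTS.
exact: (measurable_fun_pair2 s (measurableT_comp mg measurable_pencil)).
Qed.

Lemma measurable_pencil_path s :
  measurable_fun (`[0%R, 1%R]%classic : set (measurableTypeR R)) (fun t => g (pencil_curve s t)).
Proof.
apply: (@eq_measurable_fun _ _ _ _ _ (fun t => g (pencil_curve s (clamp t)))).
  by move=> t; rewrite inE /= in_itv /= => t01; rewrite clamp_id.
exact: measurable_pencil_section.
Qed.

Lemma integral_pencilE s :
  \int[mu]_(t in `[0%R, 1%R]) g (pencil_curve s t) = \int[mu]_t pencil_density (s, t).
Proof.
rewrite -integral_itv_obnd_cbnd; last first.
  apply: (@measurable_funS _ _ _ _ (`[0%R, 1%R]%classic : set (measurableTypeR R))).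
  - exact: measurable_itv.
  - by apply: subset_itvr; rewrite bnd_simp.
  - exact: measurable_pencil_path.
rewrite integral_mkcond; apply: eq_integral => t _.
rewrite patchE /pencil_density /=; case: ifPn => //; rewrite inE /= in_itv /= => /andP[t0 t1].
by rewrite clamp_id// ltW.
Qed.

Lemma measurable_integral_pencil :
  measurable_fun setT (fun s => \int[mu]_(t in `[0%R, 1%R]) g (pencil_curve s t)).
Proof.
rewrite (_ : (fun s => _) = (fun s => \int[mu]_t pencil_density (s, t))); last first.
  by apply/funext => s; exact: integral_pencilE.
exact: (measurable_fun_fubini_tonelli_F (m2 := mu) _ measurable_pencil_density pencil_density_ge0).
Qed.

Lemma pencil_average_le (B : set (borelType G)) (p N : R) :
  finsler_ball F x (2 * L * r)%:E `<=` B -> (1 <= p)%R -> (n%:R < p)%R -> (0 <= N)%R ->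
  \int[hausdorff_measure F : set (borelType G) -> \bar R]_(z in B) `|g z| `^ p <= N%:E ->
  \int[P]_s \int[mu]_(t in `[0%R, 1%R]) g (pencil_curve s t) <=
    (2 * ((2 * (K / r)) ^+ n * N) `^ p^-1 / (1 - n%:R / p))%:E.
Proof.
move=> ballB p1 np N0 gN; have p0 : (0 < p)%R by exact: lt_le_trans p1.
have Kr : (0 < K / r)%R by rewrite divr_gt0.
have a0 : (0 <= n%:R / p)%R by rewrite divr_ge0// ltW.
have a1 : (n%:R / p < 1)%R by rewrite ltr_pdivrMr// mul1r.
under eq_integral do rewrite integral_pencilE.
rewrite (@fubini_tonelli _ _ _ _ _ P mu _ measurable_pencil_density pencil_density_ge0).
pose c : R := (2 * ((2 * (K / r)) ^+ n * N) `^ p^-1)%R.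
have c0 : (0 <= c)%R by rewrite mulr_ge0// powR_ge0.
apply: (@le_trans _ _ (\int[mu]_(t in I01) (c%:E * (t `^ (- (n%:R / p)))%:E))); last first.
  rewrite ge0_integralZl_EFin//; last 2 first.
  - by move=> t _; rewrite lee_fin powR_ge0.
  - by apply/measurable_EFinP; apply: measurable_funTS; exact: measurable_powR.
  rewrite -/c [leRHS]EFinM; apply: lee_wpmul2l; first by rewrite lee_fin.
  exact: integral_powR_le.
rewrite (_ : \int[mu]_t \int[P]_s pencil_density (s, t) =
    \int[mu]_(t in I01) \int[P]_s pencil_density (s, t)); last first.
  rewrite [RHS]integral_mkcond; apply: eq_integral => t _; rewrite patchE.
  case: ifPn => // tI; apply: integral0_eq => s _.
  by rewrite /pencil_density /= (negbTE tI).
apply: le_integral_gen.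
- by move=> t _; apply: integral_ge0 => s _; exact: pencil_density_ge0.
- by move=> t _; rewrite -EFinM lee_fin mulr_ge0// powR_ge0.
move=> t tI; split => //; have := tI; rewrite /= in_itv /= => /andP[t0 t1].
rewrite (_ : \int[P]_s pencil_density (s, t) = \int[P]_s g (pencil_curve s t)); last first.
  apply: eq_integral => s _; rewrite /pencil_density /= mem_set// clamp_id// ltW//.
apply: le_trans (pencil_slice_le ballB p1 N0 t0 t1 gN) _.
rewrite -EFinM lee_fin /c.
have -> : ((2 * (K / (t * r))) ^+ n * N = ((2 * (K / r)) ^+ n * N) * t ^- n)%R.
  rewrite -exprVn mulrAC -exprMn; congr (_ ^+ n * _)%R.
  by field; rewrite !gt_eqF.
rewrite powRM; last 2 first.
- by rewrite mulr_ge0// exprn_ge0// mulr_ge0// ltW.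
- by rewrite invr_ge0 exprn_ge0// ltW.
rewrite mulrA ler_wpM2l// -powR_invn ?(ltW t0)// -powRrM.
by rewrite mulNr.
Qed.

Lemma pencil_curve_continuous s : {within `[0%R, 1%R], continuous (pencil_curve s)}.
Proof.
apply: continuous_in_subspaceT => t; rewrite inE /= in_itv /= => t01.
have C : {for pencil s t, continuous psi}.
  by apply: chart_inv_continuous; exact: im (pencil_ball s t01).
have D : {for t, continuous (pencil s)}.
  apply: cvgD; first exact: cvg_cst.
  by apply: cvgZr_tmp; exact: cvg_id.
have E : {for t, continuous (fun t => psi (pencil s t))} by exact: continuous_comp.
apply: (@continuous_comp _ _ _ (fun t => psi (pencil s t)) (fun y => (x * y)%g)) => //.
exact: continuous_mulg_l.
Qed.

(** The curve is Lipschitz with constant 2 r L, and passing from arc length to the parameter t costs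
    the other factor 2. *)
Lemma pencil_upper_gradient (u : G -> \bar R) s : upper_gradient F u g ->
  `|u (x * psi (p0 + r *: (\row_i xi i s))%R)%g - u (x * psi q)%g| <=
    (2 * (2 * r * L))%:E * \int[mu]_(t in `[0%R, 1%R]) g (pencil_curve s t).
Proof.
move=> [_ _ ug]; have c0 : (0 < 2 * r * L)%R by rewrite !mulr_gt0.
have lip := @pencil_curve_lipschitz s.
apply: le_trans (line_integral_le c0 lip g0 (@measurable_pencil_path s)).
apply: ug; [|exact: pencil_curve0|exact: pencil_curve1].
apply: (rectifiable_lipschitz (L := (2 * r * L)%R)) => //; exact: (@pencil_curve_continuous s).
Qed.
End segment_pencil.

Section local_estimate.
Context (R : realType) (n : nat) (G : lieGroupType R n) (F : finsler_metric G).
Hypothesis Fl : left_invariant F.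
Local Open Scope ereal_scope.
Local Notation mu := (@lebesgue_measure R).

(* A constant path has length 0, so |u x - u x| <= 0. *)
Lemma upper_gradient_fin_num (u g : G -> \bar R) x : upper_gradient F u g -> u x \is a fin_num.
Proof.
move=> [_ _ ug]; pose c : R -> G := fun=> x.
have lip s t : (0 <= s)%R -> (s <= t)%R -> (t <= 1)%R ->
    finsler_dist F (c s) (c t) <= (1 * (t - s))%:E.
  by move=> _ st _; rewrite finsler_dist_xx lee_fin mul1r subr_ge0.
have l0 : path_length F 0 0 c = 0.
  apply/eqP; rewrite eq_le path_length_ge0// andbT.
  by have := path_length_le lip (lexx 0%R) ler01; rewrite mulr0.
have rc : rectifiable F 0 0 c.
  split; [exact: lexx|by apply: continuous_subspaceT => t; exact: cvg_cst|by rewrite l0].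
have := ug x x 0%R 0%R c rc erefl erefl.
rewrite /line_integral l0.
rewrite (_ : [set tau : R | (0 <= tau)%R /\ tau%:E <= 0] = [set 0%R]); last first.
  apply/seteqP; split => t /=; last by move=> ->.
  by rewrite lee_fin => -[t0 t1]; apply/eqP; rewrite eq_le t0 t1.
by rewrite integral_set1; case: (u x).
Qed.

(** The Hausdorff measure enters as a bare set function, so positivity is obtained by comparison
    with the zero measure. *)
Lemma integral_hausdorff_ge0 (B : set (borelType G)) (f : G -> \bar R) : (forall z, 0 <= f z) ->
  0 <= \int[hausdorff_measure F : set (borelType G) -> \bar R]_(z in B) f z.
Proof.
move=> f0.
have := @le_integral_measure _ (borelType G) R mzero (hausdorff_measure F) B B f 1%R.
rewrite integral_measure_zero mul1e; apply => //.
- exact: hausdorff_measure0.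
- exact: hausdorff_measure_ge0.
- by move=> A _ _; rewrite mul1e; exact: hausdorff_measure_ge0.
Qed.

Lemma Lp_norm_ge0 (p : R) (B : set G) (g : G -> \bar R) : 0 <= Lp_norm F p B g.
Proof. exact: poweR_ge0. Qed.

(** B may be any set that contains the ball, so that all the jumps of a subdivided curve can share
    one large ball around its origin. *)
Lemma local_estimate (p : R) : (n%:R < p)%R -> exists C e : R, [/\ (0 < C)%R, (0 < e)%R &
  forall u g, upper_gradient F u g -> forall x y (B : set G), finsler_dist F x y < e%:E ->
    finsler_ball F x (C%:E * finsler_dist F x y) `<=` B ->
    `|u x - u y| <= C%:E * finsler_dist F x y `^ (1 - n%:R / p) * Lp_norm F p B g].
Proof.
move=> np; have p0 : (0 < p)%R by rewrite (le_lt_trans _ np).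
have [d [L [K [d0 L0 K0 [im ub lb near1]]]]] := chart_bilipschitz F (1%g : G).
have [dT [T [P [xi [mxi xi01 Pxi]]]]] := frostman_family R n.
set psi := chart_inv (chart_at (1%g : G)) in ub lb near1.
set p0' := chart_at (1%g : G) (1%g : G) in im ub lb near1.
pose a : R := (n%:R / p)%R.
have a0 : (0 <= a)%R by rewrite divr_ge0// ltW.
have a1 : (a < 1)%R by rewrite ltr_pdivrMr// mul1r.
have b0 : (0 < 1 - a)%R by rewrite subr_gt0.
(* With r = K D, the 16 is 4 from [pencil_upper_gradient], times 2 for the two ends, times 2 from
   the average [A]. [C2] makes C2 D equal to the radius 2 L r, and e = d / (2 K) ensures 2 r <=
   d. *)
pose C1 : R := (16 * L * K * 2 `^ a / (1 - a))%R.
have C10 : (0 < C1)%R by rewrite /C1 divr_gt0// mulr_gt0 ?powR_gt0// !mulr_gt0.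
pose C2 : R := (2 * L * K)%R.
have C20 : (0 < C2)%R by rewrite /C2 !mulr_gt0.
exists (Num.max C1 C2), (d / (2 * K))%R; split.
- by rewrite lt_max C10.
- by rewrite divr_gt0// mulr_gt0.
move=> u g ug x y B xy_lt ballB.
have C0 : (0 < Num.max C1 C2)%R by rewrite lt_max C10.
have RHS0 : 0 <= (Num.max C1 C2)%:E * finsler_dist F x y `^ (1 - n%:R / p) * Lp_norm F p B g.
  by rewrite !mule_ge0 ?poweR_ge0 ?Lp_norm_ge0// lee_fin ltW.
have ufin z := @upper_gradient_fin_num u g z ug.
have dxy : finsler_dist F 1%g (x^-1 * y)%g = finsler_dist F x y.
  by rewrite -(finsler_dist_mulg x _ _ Fl) mulg1 mulgA mulgV mul1g.
have [|b yb bK] := near1 (x^-1 * y)%g.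
  rewrite dxy; apply: lt_le_trans xy_lt _; rewrite lee_fin ler_pM2l// lef_pV2 ?posrE ?mulr_gt0//.
  by rewrite ler_peMl ?(ltW K0)// ler1n.
rewrite dxy in bK.
have xp0 : (x * psi p0' = x)%g by rewrite /psi /p0' chart_invK ?mulg1//; exact: mem_chart_at.
have xb : (x * psi b = y)%g by rewrite yb mulgA mulgV mul1g.
have [bp|bp] := eqVneq b p0'.
  by have yx : y = x by [rewrite -xb bp xp0]; rewrite {1}yx subee ?abse0.
have dfin : finsler_dist F x y \is a fin_num.
  by rewrite ge0_fin_numE ?finsler_dist_ge0// (lt_trans xy_lt)// ltry.
pose D := fine (finsler_dist F x y).
have DE : finsler_dist F x y = D%:E by rewrite fineK.
rewrite !DE in xy_lt bK ballB RHS0 *.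
rewrite lte_fin in xy_lt; rewrite -EFinM lee_fin in bK.
have bp0 : (0 < `|b - p0'|)%R by rewrite normr_gt0 subr_eq0.
have D0 : (0 < D)%R by rewrite -(pmulr_rgt0 _ K0) (lt_le_trans bp0).
have p1 : (1 <= p)%R.
  (* For n = 0 the exponent p may be less than 1, but then R^n is a point and b = p0' is already
     excluded. *)
  have [n0|n0] := posnP n; last by rewrite ltW// (le_lt_trans _ np)// ler1n.
  have bE : b = p0' by apply/rowP => i; have := ltn_ord i; rewrite [X in (_ < X)%N]n0.
  by rewrite bE eqxx in bp.
pose r := (K * D)%R.
have r0 : (0 < r)%R by rewrite mulr_gt0.
have rd : (2 * r <= d)%R.
  by rewrite /r mulrA mulrC -ler_pdivlMr ?mulr_gt0// ltW.
case: (ug) => mg g0 _.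
pose N := \int[hausdorff_measure F : set (borelType G) -> \bar R]_(z in B) `|g z| `^ p.
have N0 : 0 <= N by apply: integral_hausdorff_ge0 => z; exact: poweR_ge0.
have LpE : Lp_norm F p B g = N `^ p^-1 by [].
(* As D > 0, an infinite norm makes the right-hand side infinite. *)
have [Ny|Nfin] := eqVneq N +oo.
  rewrite LpE Ny poweRyr ?invr_eq0 ?gt_eqF// poweR_EFin -EFinM gt0_muley ?leey//.
  by rewrite lte_fin mulr_gt0 ?powR_gt0.
have NE : N = (fine N)%:E by rewrite fineK// ge0_fin_numE// lt_neqAle Nfin leey.
have fN0 : (0 <= fine N)%R by rewrite fine_ge0.
have ballB' : finsler_ball F x (2 * L * r)%:E `<=` (B : set (borelType G)).
  move=> z; rewrite /finsler_ball /= => zr; apply: ballB; rewrite /finsler_ball /=.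
  apply: le_trans zr _; rewrite -EFinM lee_fin /r mulrA ler_wpM2r ?(ltW D0)//.
  by rewrite le_max lexx orbT.
have qr0 : (`|p0' - p0'| <= r)%R by rewrite subrr normr0 ltW.
have qr1 : (`|b - p0'| <= r)%R by [].
have HN : \int[hausdorff_measure F : set (borelType G) -> \bar R]_(z in B) `|g z| `^ p <= (fine N)%:E.
  by rewrite -NE.
(* The choice q = p0' starts at x and q = b at y; the other end depends only on s, so the two paths
   meet. *)
pose I q s := \int[mu]_(t in `[0%R, 1%R]) g (pencil_curve xi x r q s t).
have I0 q s : 0 <= I q s by apply: integral_ge0.
have mI q : (`|q - p0'| <= r)%R -> measurable_fun setT (I q).
  by move=> qr; exact: (measurable_integral_pencil im mxi xi01 x r0 rd qr mg g0).
pose A : R := (2 * ((2 * (K / r)) ^+ n * fine N) `^ p^-1 / (1 - n%:R / p))%R.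
have av q : (`|q - p0'| <= r)%R -> \int[P]_s I q s <= A%:E.
  by move=> qr; exact: (pencil_average_le Fl d0 L0 K0 im ub lb mxi xi01 Pxi r0 rd qr mg g0 ballB' p1 np fN0 HN).
have est s : `|u x - u y| <= (2 * (2 * r * L))%:E * (I p0' s + I b s).
  pose z := (x * psi (p0' + r *: (\row_i xi i s))%R)%g.
  have E0 : `|u z - u x| <= (2 * (2 * r * L))%:E * I p0' s.
    by rewrite -[X in u z - u X]xp0; exact: (pencil_upper_gradient Fl L0 im ub mxi xi01 x r0 rd qr0 mg g0 s ug).
  have E1 : `|u z - u y| <= (2 * (2 * r * L))%:E * I b s.
    by rewrite -[X in u z - u X]xb; exact: (pencil_upper_gradient Fl L0 im ub mxi xi01 x r0 rd qr1 mg g0 s ug).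
  rewrite muleDr//; last by rewrite ge0_adde_def// inE.
  apply: le_trans (leeD E0 E1).
  rewrite -(fineK (ufin x)) -(fineK (ufin y)) -(fineK (ufin z)) -!EFinB !abse_EFin -EFinD lee_fin.
  by rewrite (distrC (fine (u z)) (fine (u x))); exact: ler_distD.
have fin : `|u x - u y| <= (2 * (2 * r * L))%:E * (A%:E + A%:E).
  have c0 : 0 <= (2 * (2 * r * L))%:E by rewrite lee_fin !mulr_ge0// ltW.
  apply: (@le_trans _ _ (\int[P]_s `|u x - u y|)).
    rewrite (_ : \int[P]__ `|u x - u y| = `|u x - u y|)//.
    apply: etrans (integral_cst P measurableT _) _.
    by apply: etrans (congr1 (mule _) (probability_setT P)) _; exact: mule1.
  apply: (@le_trans _ _ (\int[P]_s ((2 * (2 * r * L))%:E * (I p0' s + I b s)))).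
    apply: ge0_le_integral => //.
    by apply: emeasurable_funM; [exact: measurable_cst|apply: emeasurable_funD; exact: mI].
  rewrite ge0_integralZl//; last 2 first.
  - by apply: emeasurable_funD; exact: mI.
  - by move=> s _; rewrite adde_ge0.
  rewrite ge0_integralD//; [|exact: mI|exact: mI].
  by apply: lee_wpmul2l => //; apply: leeD; exact: av.
apply: le_trans fin _.
rewrite -EFinD -EFinM LpE NE !poweR_EFin -!EFinM lee_fin.
rewrite -/a.
apply: (@le_trans _ _ (C1 * D `^ (1 - a) * fine N `^ p^-1)%R); last first.
  by rewrite !ler_wpM2r ?powR_ge0// le_max lexx.
rewrite le_eqVlt; apply/orP; left; apply/eqP.
have E1 : (2 * (K / r) = 2 / D)%R by rewrite /r; field; rewrite !gt_eqF.
have D20 : (0 < 2 / D)%R by rewrite divr_gt0.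
have E2 : (((2 * (K / r)) ^+ n * fine N) `^ p^-1 = 2 `^ a * (D `^ a)^-1 * fine N `^ p^-1)%R.
  rewrite E1 powRM ?exprn_ge0 ?(ltW D20)//; congr (_ * _)%R.
  rewrite -powR_mulrn ?(ltW D20)// -powRrM -/a powRM ?invr_ge0 ?(ltW D0)//.
  by rewrite -powR_inv1 ?(ltW D0)// -powRrM mulN1r powRN.
have E3 : (D `^ (1 - a) = D * (D `^ a)^-1)%R.
  by rewrite powRB ?powRr1 ?(ltW D0)// gt_eqF ?implybT.
rewrite /A -/a E2 E3 /C1 /r.
have n1 : (1 - a != 0)%R by rewrite gt_eqF.
have n2 : (D `^ a != 0)%R by rewrite gt_eqF ?powR_gt0.
by field; rewrite ?n1 ?n2.
Qed.
End local_estimate.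

(** * Subdivision of curves *)

Section chain.
Context (R : realType) (n : nat) (M : smoothManifoldType R n) (F : finsler_metric M).
Local Open Scope ereal_scope.

(** Both orders of the arguments are recorded because [pw_jump] arrives at T from an earlier time
    and leaves it for a later one. *)
Lemma finsler_dist_near (c : R -> M) a b T (e : R) : pw c a b -> (a <= T <= b)%R -> (0 < e)%R ->
  exists2 d : R, (0 < d)%R & forall t, (a <= t <= b)%R -> (`|T - t| < d)%R ->
    finsler_dist F (c T) (c t) < e%:E /\ finsler_dist F (c t) (c T) < e%:E.
Proof.
move=> cab aTb e0.
have [d [L [d0 L0 H]]] := finsler_dist_chart_ub F (c T).
pose r := (Num.min d (e / L))%R.
have r0 : (0 < r)%R by rewrite lt_min d0 divr_gt0.
have rd : (r <= d)%R by rewrite ge_min lexx.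
have re : (L * r <= e)%R by rewrite mulrC -ler_pdivlMr// ge_min lexx orbT.
have [|k k0 kP] := within_itv_open (continuous_pw cab) aTb (@open_chart_ball _ _ _ (c T) r).
  by split; [exact: mem_chart_at|rewrite subrr normr0].
exists k => // t tab /(kP t tab) [td tr].
have Hr : ball (chart_at (c T) (c T)) d (chart_at (c T) (c t)).
  by rewrite ball_rVE distrC; exact: lt_le_trans rd.
have H0 : ball (chart_at (c T) (c T)) d (chart_at (c T) (c T)) by exact: ballxx.
have Lr : (L * `|chart_at (c T) (c t) - chart_at (c T) (c T)| < e)%R.
  by apply: lt_le_trans re; rewrite ltr_pM2l.
have ET : chart_inv (chart_at (c T)) (chart_at (c T) (c T)) = c T.
  by apply: chart_invK; exact: mem_chart_at.
have Et : chart_inv (chart_at (c T)) (chart_at (c T) (c t)) = c t by exact: chart_invK.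
have := H _ _ H0 Hr; have := H _ _ Hr H0; rewrite ET Et => H1 H2; split.
- by apply: le_lt_trans H2 _; rewrite lte_fin.
- by apply: le_lt_trans H1 _; rewrite lte_fin distrC.
Qed.

(** T is the supremum of the times up to which the length is less than e / 2. No continuity of the
    length is invoked: s is taken slightly after T, so the length up to s is at least e / 2, while
    continuity of c keeps the distance below e / 2 + e / 4 + e / 4. If T = b, the end is already
    close enough. *)
Lemma pw_jump (c : R -> M) a b (e : R) : pw c a b -> (0 < e)%R ->
  finsler_dist F (c a) (c b) < e%:E \/
  exists s, [/\ (a <= s)%R, (s <= b)%R, pw c a s, pw c s b &
    finsler_dist F (c a) (c s) < e%:E /\ (e / 2)%:E <= len F c a s].
Proof.
move=> cab e0; have ab := pw_le cab.
have e20 : (0 < e / 2)%R by rewrite divr_gt0.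
have e40 : (0 < e / 4)%R by rewrite divr_gt0.
pose S := [set t : R | (a <= t <= b)%R /\ len F c a t < (e / 2)%:E].
have Sa : S a by split; [rewrite lexx|rewrite lenxx lte_fin].
have supS : has_sup S by split; [exists a|exists b => t [/andP[]]].
pose T := sup S.
have aT : (a <= T)%R by apply: ub_le_sup => //; case: supS.
have Tb : (T <= b)%R by apply: ge_sup; [exists a|move=> t [/andP[]]].
have aTb : (a <= T <= b)%R by rewrite aT.
have [d d0 dP] := finsler_dist_near cab aTb e40.
have [t [tab tl] tT] := sup_adherent d0 supS.
have tleT : (t <= T)%R by apply: ub_le_sup => //; case: supS.
have [dTt dtT] : finsler_dist F (c T) (c t) < (e / 4)%:E /\ finsler_dist F (c t) (c T) < (e / 4)%:E.
  by apply: dP => //; rewrite ger0_norm ?subr_ge0// ltrBlDr -ltrBlDl.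
have [at_ tb] := andP tab.
have dat : finsler_dist F (c a) (c t) < (e / 2)%:E.
  by apply: le_lt_trans tl; apply: finsler_dist_le_len; exact: (pw_split cab tab).1.
have daT : finsler_dist F (c a) (c T) < (e / 2 + e / 4)%:E.
  by apply: le_lt_trans (finsler_dist_triangle F (c t) _ _) _; rewrite EFinD lteD.
have [TeqB|TneB] := eqVneq T b.
  by left; rewrite -TeqB; apply: lt_trans daT _; rewrite lte_fin; lra.
right; have Tlb : (T < b)%R by rewrite lt_neqAle TneB.
pose s := (Num.min b (T + d / 2))%R.
have Ts : (T < s)%R by rewrite lt_min Tlb ltrDl divr_gt0.
have sb : (s <= b)%R by rewrite ge_min lexx.
have sd : (s <= T + d / 2)%R by rewrite ge_min lexx orbT.
have as_ : (a <= s)%R by rewrite (le_trans aT)// ltW.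
have sab : (a <= s <= b)%R by rewrite as_.
have [pas psb] := pw_split cab sab.
exists s; split => //; split.
  have [dTs _] : finsler_dist F (c T) (c s) < (e / 4)%:E /\ finsler_dist F (c s) (c T) < (e / 4)%:E.
    by apply: dP => //; rewrite distrC gtr0_norm ?subr_gt0//; lra.
  apply: le_lt_trans (finsler_dist_triangle F (c T) _ _) _.
  rewrite (_ : e = (e / 2 + e / 4) + e / 4)%R; last by field.
  by rewrite [X in _ < X]EFinD lteD.
rewrite leNgt; apply/negP => sl.
have : (s <= T)%R by apply: ub_le_sup; [case: supS|split].
by rewrite leNgt Ts.
Qed.

(* Greedy subdivision into jumps at distance less than e, each but the last of length at least e/2. *)
Lemma chain_le (u : M -> \bar R) (x : M) (A : \bar R) (e r : R) :
  (forall z, u z \is a fin_num) -> 0 <= A -> (0 < e)%R ->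
  (forall z w, finsler_dist F x z < r%:E -> finsler_dist F z w < e%:E -> `|u z - u w| <= A) ->
  forall N c a b, pw c a b -> finsler_dist F x (c a) + len F c a b < r%:E ->
    len F c a b < (N%:R * (e / 2))%:E -> `|u (c a) - u (c b)| <= N%:R%:E * A.
Proof.
move=> uf A0 e0 uA; elim=> [|N IH] c a b cab xr lN.
  by move: lN; rewrite mul0r ltNge len_ge0.
have dxa : finsler_dist F x (c a) < r%:E.
  by apply: le_lt_trans xr; rewrite leeDl// len_ge0.
have [small|[s [as_ sb pas psb [das lens]]]] := pw_jump cab e0.
  apply: le_trans (uA _ _ dxa small) _.
  by rewrite -[leLHS]mul1e; apply: lee_wpmul2r => //; rewrite lee_fin ler1n.
have lsplit := len_split F c as_ sb.
have H1 := uA _ _ dxa das.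
have H2 : `|u (c s) - u (c b)| <= N%:R%:E * A.
  apply: IH => //.
  (* The distance from x plus the remaining length does not increase along the chain, so every jump
     starts within r of x. *)
  - apply: le_lt_trans xr; rewrite lsplit (addeA (finsler_dist F x (c a)) (len F c a s) (len F c s b)).
    apply: (@leeD _ _ (finsler_dist F x (c a) + len F c a s) (len F c s b) (len F c s b)) => //.
    apply: le_trans (finsler_dist_triangle F (c a) _ _) _.
    exact: (leeD (lexx _) (finsler_dist_le_len F pas)).
  - have lfin : len F c a b \is a fin_num by rewrite ge0_fin_numE ?len_ge0// (lt_trans lN)// ltry.
    have sfin : len F c s b \is a fin_num.
      by rewrite ge0_fin_numE ?len_ge0//; apply: le_lt_trans (ltry (fine (len F c a b))); rewrite fineK// lsplit leeDr// len_ge0.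
    have : (e / 2)%:E + len F c s b < (N.+1%:R * (e / 2))%:E.
      by apply: le_lt_trans lN; rewrite lsplit; exact: (leeD lens (lexx _)).
    by rewrite -(fineK sfin) -EFinD !lte_fin -natr1; lra.
apply: (@le_trans _ _ (`|u (c a) - u (c s)| + `|u (c s) - u (c b)|)).
  rewrite -(fineK (uf (c a))) -(fineK (uf (c b))) -(fineK (uf (c s))) -!EFinB !abse_EFin -EFinD lee_fin.
  exact: ler_distD.
rewrite -natr1 EFinD ge0_muleDl ?lee_fin ?ler0n// mul1e [leRHS]addeC.
exact: leeD H1 H2.
Qed.
End chain.

(** * From small distances to distances at most 1 *)

Lemma le_poweR (R : realType) (a : R) (s t : \bar R) :
  0 <= a -> (0 <= s)%E -> (s <= t)%E -> (s `^ a <= t `^ a)%E.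
Proof.
move=> a0 s0 st; have t0 := le_trans s0 st.
by apply: gt0_ler_poweR; rewrite ?in_itv/= ?s0 ?t0 ?leey.
Qed.

Theorem corollary4p2 (R : realType) (n : nat) (G : lieGroupType R n)
    (F : finsler_metric G) (hF : left_invariant F) (p : R) (hp : n%:R < p) :
  exists C : R, 0 < C /\
    forall u g : G -> \bar R, upper_gradient F u g -> in_Lp F p g ->
    forall x y : G, (finsler_dist F x y <= 1)%E ->
      (`|u x - u y| <=
        C%:E * finsler_dist F x y `^ (1 - n%:R / p) *
        Lp_norm F p (finsler_ball F x (C%:E * finsler_dist F x y)) g)%E.
Proof.
have [C0 [e [C00 e0 loc]]] := local_estimate hF hp.
have p0 : 0 < p by rewrite (le_lt_trans _ hp).
have b0 : 0 <= 1 - n%:R / p by rewrite subr_ge0 ler_pdivrMr// mul1r ltW.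
(* This gives N e / 2 > 2, enough jumps for a curve of length less than 2. *)
pose N := (Num.truncn (4 / e)).+1.
have eN : 2 < N%:R * (e / 2).
  have : 4 / e < N%:R by exact: truncnS_gt.
  by rewrite ltr_pdivrMr//; lra.
(* The first term pays for N jumps. The other two give C e >= 2 + C0 e: when d(x, y) >= e, the ball
   around x contains the balls of radius C0 e around all points within 2 of x. The last term also
   covers d(x, y) < e. *)
pose C := N%:R * C0 + 2 / e + C0.
have NC0 : 0 < N%:R * C0 by rewrite mulr_gt0.
have e20 : 0 < 2 / e by rewrite divr_gt0.
have CC0 : C0 <= C by rewrite /C; lra.
have CN : N%:R * C0 <= C by rewrite /C; lra.
have Ce : 2 + C0 * e <= C * e.
  rewrite /C !mulrDl divfK ?gt_eqF//.
  have : 0 <= N%:R * C0 * e by rewrite mulr_ge0// ltW.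
  by lra.
have Cgt0 : 0 < C by exact: lt_le_trans CC0.
exists C; split => // u g ug _ x y dxy1.
have d0 : (0 <= finsler_dist F x y)%E by exact: finsler_dist_ge0.
have [dlt|dge] := ltP (finsler_dist F x y) e%:E.
  apply: (le_trans (loc u g ug x y (finsler_ball F x (C%:E * finsler_dist F x y)) dlt _)).
    move=> z; rewrite /finsler_ball /= => /le_trans; apply.
    by apply: lee_wpmul2r => //; rewrite lee_fin.
  apply: lee_wpmul2r; first exact: Lp_norm_ge0.
  by apply: lee_wpmul2r; [exact: poweR_ge0|rewrite lee_fin].
set B := finsler_ball F x _.
(* A bounds every jump uniformly; at the end e <= d(x, y) turns the power of e into the required
   power of the distance. *)
pose A := (C0%:E * (e%:E `^ (1 - n%:R / p)) * Lp_norm F p B g)%E.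
have A0 : (0 <= A)%E by rewrite !mule_ge0 ?poweR_ge0 ?Lp_norm_ge0// lee_fin ltW.
have uA z w : (finsler_dist F x z < 2%:E)%E -> (finsler_dist F z w < e%:E)%E ->
    (`|u z - u w| <= A)%E.
  move=> dxz dzw; apply: (le_trans (loc u g ug z w B dzw _)).
    move=> v; rewrite /B /finsler_ball /= => dzv.
    apply: le_trans (finsler_dist_triangle F z _ _) _.
    apply: (@le_trans _ _ (2 + C0 * e)%:E).
      rewrite EFinD; apply: leeD; first exact: ltW.
      apply: le_trans dzv _; rewrite EFinM; apply: lee_wpmul2l; last exact: ltW.
      by rewrite lee_fin ltW.
    apply: (@le_trans _ _ (C * e)%:E); first by rewrite lee_fin.
    by rewrite EFinM; apply: lee_wpmul2l => //; rewrite lee_fin ltW.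
  apply: lee_wpmul2r; first exact: Lp_norm_ge0.
  apply: lee_wpmul2l; first by rewrite lee_fin ltW.
  by apply: le_poweR => //; [exact: finsler_dist_ge0|exact: ltW].
have d2 : (finsler_dist F x y < 2%:E)%E by apply: le_lt_trans dxy1 _; rewrite lte_fin ltr1n.
have [c [c01 cx cy cl]] := finsler_dist_lt d2.
have := chain_le (fun z => upper_gradient_fin_num z ug) A0 e0 uA (N := N) c01.
rewrite cx cy finsler_dist_xx add0e => /(_ cl).
move=> /(_ (lt_trans cl _)); rewrite lte_fin => /(_ eN) /le_trans; apply.
rewrite /A !muleA -(EFinM N%:R C0); apply: lee_wpmul2r; first exact: Lp_norm_ge0.
apply: lee_pmul; rewrite ?poweR_ge0 ?lee_fin//; first exact: ltW.
by apply: le_poweR => //; rewrite lee_fin ltW.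
Qed.
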